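(* $\mathsf{RCA}_0^\omega$ proves that the following are equivalent: (i) $\mathsf{ACA}_0$ plus: for every set $A\subseteq[0,1]$ and every $F:[0,1]\to[0,1]$, $\sup_{x\in A}F(x)$ exists; (ii) $\mathsf{MCT}^{[0,1]}_{\mathsf{net}}$; (iii) $\mathsf{BOOT}$; (iv) for every RM-closed set $C\subseteq[0,1]$ and every $F:[0,1]\to[0,1]$, $\sup_{x\in C}F(x)$ exists.
   Context: Framework: Kohlenbach's higher-order arithmetic; $\mathsf{RCA}_0^\omega$ is the base theory (ordered semiring axioms, combinators/$\lambda$-abstraction, primitive recursion $\mathbf R_0$, extensionality at all finite types, quantifier-free induction, $\mathsf{QF\text{-}AC}^{1,0}$). $\mathsf{ACA}_0$ denotes arithmetical comprehension. Reals are fast-converging Cauchy sequences of rationals; $F:[0,1]\to[0,1]$ is any (possibly discontinuous) map respecting $=_{\mathbb R}$. A set $A\subseteq[0,1]$ is an arbitrary function $A:\mathbb R\to\mathbb R$ with $x\in A$ meaning $A(x)>0$. An RM-closed set $C\subseteq[0,1]$ is given by sequences of rationals $(a_n),(r_n)$, with $x\in C$ meaning $x\in[0,1]\wedge(\forall n)(|x-a_n|\ge r_n)$. ''$\sup_{x\in A}F(x)$ exists'' means there is a real $y$ with $F(x)\le y$ for all $x\in A$ and for every $k$ some $x\in A$ with $F(x)>y-2^{-k}$. $\mathsf{BOOT}$: $(\forall Y^2)(\exists X\subseteq\mathbb N)(\forall n)(n\in X\leftrightarrow(\exists f\in\mathbb N^{\mathbb N})(Y(f,n)=0))$. $\mathsf{MCT}^{[0,1]}_{\mathsf{net}}$: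 for every directed set $(D,\preceq_D)$ with $D\subseteq\mathbb N^{\mathbb N}$ (given by a characteristic functional, with $\preceq_D$ a binary relation on $D$ given by a functional, reflexive, transitive, and such that any two elements have a common upper bound), every net $x_{(\cdot)}:D\to[0,1]$ that is increasing ($d\preceq_De\to x_d\le x_e$) converges, i.e. there is $x$ with $(\forall k)(\exists d\in D)(\forall e\succeq_Dd)(|x_e-x|<2^{-k})$.
   Formalization: The sets A in (i), the RM-closed sets C in (iv) and the directed sets D in (ii) are taken to be nonempty, since by the stated definitions no supremum over the empty set exists and the empty net does not converge. *)

(* Defs.v *)
From Stdlib Require Import List Arith.
Import ListNotations.

Set Implicit Arguments.
Unset Strict Implicit.
Unset Printing Implicit Defensive.

(** * Finite types, terms and formulas of higher-order arithmetic *)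

Inductive ty : Type := N | Arr (sigma tau : ty).

Declare Scope ty_scope.
Delimit Scope ty_scope with ty.
Bind Scope ty_scope with ty.
Infix "~>" := Arr (at level 55, right associativity) : ty_scope.

Definition ty_eq_dec (s t : ty) : {s = t} + {s <> t}.
Proof. decide equality. Defined.

Definition ty1 : ty := (N ~> N)%ty.
Definition ty2 : ty := (ty1 ~> N)%ty.

(** [CRec] is the recursor R_0, with the number recursed upon as last
    argument; [CK] and [CS] are the combinators Pi and Sigma. *)
Inductive const : ty -> Type :=
| CZero : const N
| COne : const N
| CPlus : const (N ~> N ~> N)%ty
| CMult : const (N ~> N ~> N)%ty
| CK (s t : ty) : const (s ~> t ~> s)%ty
| CS (r s t : ty) : const ((r ~> s ~> t) ~> (r ~> s) ~> r ~> t)%ty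
| CRec : const ((N ~> N ~> N) ~> N ~> N ~> N)%ty.

(** Variables are de Bruijn indices, counted separately for each type:
    [Var s n] refers to the [n]-th enclosing quantifier over the type [s]. *)
Inductive term : ty -> Type :=
| Var (s : ty) (n : nat) : term s
| Con (s : ty) (c : const s) : term s
| App (s t : ty) (f : term (s ~> t)%ty) (x : term s) : term t.

(** As usual, only equality and order at type 0 are primitive.  The logic is
    classical, so the other connectives are abbreviations. *)
Inductive form : Type :=
| Eq (a b : term N)
| Lt (a b : term N)
| Bot
| Imp (p q : form)
| All (s : ty) (p : form).

Definition Not (p : form) : form := Imp p Bot.
Definition And (p q : form) : form := Not (Imp p (Not q)).
Definition Or (p q : form) : form := Imp (Not p) q.
Definition Iff (p q : form) : form := And (Imp p q) (Imp q p).
Definition Ex (s : ty) (p : form) : form := Not (All s (Not p)).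

Definition subst : Type := forall s : ty, nat -> term s.

Fixpoint tsubst (f : subst) (s : ty) (t : term s) : term s :=
  match t with
  | Var s n => f s n
  | Con c => Con c
  | App u v => App (tsubst f u) (tsubst f v)
  end.

Definition shift (s : ty) : subst := fun t n =>
  Var t (if ty_eq_dec t s then S n else n).

Definition scons (s : ty) (a : term s) (f : subst) : subst := fun t n =>
  match ty_eq_dec s t with
  | left e => match n with
              | O => eq_rect s term a t e
              | S m => f t m
              end
  | right _ => f t n
  end.

Definition up (s : ty) (f : subst) : subst :=
  scons (Var s 0) (fun t n => tsubst (shift s) (f t n)).

Fixpoint fsubst (f : subst) (p : form) : form :=
  match p with
  | Eq a b => Eq (tsubst f a) (tsubst f b)
  | Lt a b => Lt (tsubst f a) (tsubst f b)
  | Bot => Bot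
  | Imp p q => Imp (fsubst f p) (fsubst f q)
  | All s p => All s (fsubst (up s f) p)
  end.

Definition inst (s : ty) (a : term s) : form -> form := fsubst (scons a Var).
Definition fshift (s : ty) : form -> form := fsubst (shift s).

(** * Classical many-sorted natural deduction *)

(** A theory is a set of formulas; free variables of its elements are read
    universally, which is why [P_ax] applies in every context. *)
Definition theory : Type := form -> Prop.

Inductive deriv (T : theory) : list form -> form -> Prop :=
| P_ax G p : T p -> deriv T G p
| P_hyp G p : In p G -> deriv T G p
| P_impI G p q : deriv T (p :: G) q -> deriv T G (Imp p q)
| P_impE G p q : deriv T G (Imp p q) -> deriv T G p -> deriv T G q
| P_allI G s p : deriv T (map (fshift s) G) p -> deriv T G (All s p)
| P_allE G s p (a : term s) : deriv T G (All s p) -> deriv T G (inst a p)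
| P_raa G p : deriv T (Not p :: G) Bot -> deriv T G p.

Definition proves (T : theory) (p : form) : Prop := deriv T [] p.

Definition extend (T U : theory) : theory := fun p => T p \/ U p.

(** * Writing formulas with named bound variables *)

(** A [tm s] (resp. [fm]) is a term (resp. formula) to be placed under a given
    number of quantifiers of each type.  A variable bound at depth [k] and used
    at depth [k'] becomes the index [k' - (k + 1)]. *)
Definition depth : Type := ty -> nat.
Definition tm (s : ty) : Type := depth -> term s.
Definition fm : Type := depth -> form.

Definition all (s : ty) (p : tm s -> fm) : fm := fun k =>
  All s (p (fun k' => Var s (k' s - S (k s)))
           (fun t => if ty_eq_dec t s then S (k t) else k t)).

Definition sentence (p : fm) : form := p (fun _ => 0).

Definition con (s : ty) (c : const s) : tm s := fun _ => Con c.
Definition app (s t : ty) (f : tm (s ~> t)%ty) (x : tm s) : tm t :=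
  fun k => App (f k) (x k).
Definition feq (a b : tm N) : fm := fun k => Eq (a k) (b k).
Definition flt (a b : tm N) : fm := fun k => Lt (a k) (b k).
Definition fbot : fm := fun _ => Bot.
Definition fimp (p q : fm) : fm := fun k => Imp (p k) (q k).
Definition fnot (p : fm) : fm := fun k => Not (p k).
Definition fand (p q : fm) : fm := fun k => And (p k) (q k).
Definition for_ (p q : fm) : fm := fun k => Or (p k) (q k).
Definition fiff (p q : fm) : fm := fun k => Iff (p k) (q k).
Definition ex (s : ty) (p : tm s -> fm) : fm :=
  fnot (all (fun x => fnot (p x))).

Declare Scope ho_scope.
Delimit Scope ho_scope with ho.
Local Open Scope ho_scope.

Notation "'ALL' x : s , p" := (@all s (fun x => p))
  (at level 200, x name, s at level 60, p at level 200) : ho_scope.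
Notation "'EX' x : s , p" := (@ex s (fun x => p))
  (at level 200, x name, s at level 60, p at level 200) : ho_scope.
Infix "@" := app (at level 25, left associativity) : ho_scope.
Infix "=" := feq : ho_scope.
Infix "<" := flt : ho_scope.
Notation "a <= b" := (for_ (flt a b) (feq a b)) : ho_scope.
Notation "~ p" := (fnot p) : ho_scope.
Infix "/\" := fand : ho_scope.
Infix "\/" := for_ : ho_scope.
Infix "==>" := fimp (at level 90, right associativity) : ho_scope.
Infix "<==>" := fiff (at level 95, no associativity) : ho_scope.
Notation "0" := (con CZero) : ho_scope.
Notation "1" := (con COne) : ho_scope.
Notation "2" := (app (app (con CPlus) (con COne)) (con COne)) : ho_scope.
Notation "a + b" := (app (app (con CPlus) a) b) : ho_scope.
Notation "a * b" := (app (app (con CMult) a) b) : ho_scope.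

Fixpoint eqT (s : ty) : tm s -> tm s -> fm :=
  match s with
  | N => fun a b => a = b
  | Arr s1 s2 => fun f g => ALL x : s1, eqT (f @ x) (g @ x)
  end.

(** * The base theory *)

Definition semiring_axioms : list fm :=
  [ ALL x : N, x = x;
    ALL x : N, ALL y : N, x = y ==> y = x;
    ALL x : N, ALL y : N, ALL z : N, x = y ==> y = z ==> x = z;
    ALL x : N, ALL y : N, ALL u : N, ALL v : N,
      x = u ==> y = v ==> x < y ==> u < v;
    ALL x : N, ALL y : N, ALL z : N, (x + y) + z = x + (y + z);
    ALL x : N, ALL y : N, x + y = y + x;
    ALL x : N, x + 0 = x;
    ALL x : N, ALL y : N, ALL z : N, (x * y) * z = x * (y * z);
    ALL x : N, ALL y : N, x * y = y * x;
    ALL x : N, x * 1 = x;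
    ALL x : N, x * 0 = 0;
    ALL x : N, ALL y : N, ALL z : N, x * (y + z) = x * y + x * z;
    ALL x : N, ~ (x < x);
    ALL x : N, ALL y : N, ALL z : N, x < y ==> y < z ==> x < z;
    ALL x : N, ALL y : N, x < y \/ x = y \/ y < x;
    ALL x : N, ALL y : N, ALL z : N, x < y ==> x + z < y + z;
    ALL x : N, ALL y : N, ALL z : N, 0 < z ==> x < y ==> x * z < y * z;
    ALL x : N, 0 <= x;
    0 < 1 ].

Definition k_axiom (s t : ty) : fm :=
  ALL x : s, ALL y : t, eqT (con (CK s t) @ x @ y) x.

Definition s_axiom (r s t : ty) : fm :=
  ALL x : (r ~> s ~> t)%ty, ALL y : (r ~> s)%ty, ALL z : r,
    eqT (con (CS r s t) @ x @ y @ z) (x @ z @ (y @ z)).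

Definition rec_axiom : fm :=
  ALL f : (N ~> N ~> N)%ty, ALL m : N,
    con CRec @ f @ m @ 0 = m /\
    ALL n : N, con CRec @ f @ m @ (n + 1) = f @ n @ (con CRec @ f @ m @ n).

Definition ext_axiom (s t : ty) : fm :=
  ALL x : s, ALL y : s, ALL f : (s ~> t)%ty,
    eqT x y ==> eqT (f @ x) (f @ y).

Fixpoint quantifier_free (p : form) : Prop :=
  match p with
  | Eq _ _ | Lt _ _ | Bot => True
  | Imp p q => quantifier_free p /\ quantifier_free q
  | All _ _ => False
  end.

(** Here [p] is the formula p(n) with n = [Var N 0] and arbitrary parameters. *)
Definition induction_axiom (p : form) : form :=
  let succ : term N := App (App (Con CPlus) (Var N 0)) (Con COne) in
  let p_succ := fsubst (scons succ (fun t n => tsubst (shift N) (Var t n))) p in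
  Imp (inst (Con CZero) p) (Imp (All N (Imp p p_succ)) (All N p)).

(** Here [p] is the formula p(x,y) with x = [Var ty1 0] and y = [Var N 0]. *)
Definition qf_ac10_axiom (p : form) : form :=
  let Yx : term N := App (Var ty2 0) (Var ty1 0) in
  Imp (All ty1 (Ex N p)) (Ex ty2 (All ty1 (inst Yx (fshift ty2 p)))).

Inductive RCA0w : theory :=
| ax_semiring p : In p semiring_axioms -> RCA0w (sentence p)
| ax_K s t : RCA0w (sentence (k_axiom s t))
| ax_S r s t : RCA0w (sentence (s_axiom r s t))
| ax_rec : RCA0w (sentence rec_axiom)
| ax_ext s t : RCA0w (sentence (ext_axiom s t))
| ax_ind p : quantifier_free p -> RCA0w (induction_axiom p)
| ax_qf_ac10 p : quantifier_free p -> RCA0w (qf_ac10_axiom p).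

(** * Arithmetical comprehension *)

Fixpoint low_vars (s : ty) (t : term s) : Prop :=
  match t with
  | Var s _ => s = N \/ s = ty1
  | Con _ => True
  | App u v => low_vars u /\ low_vars v
  end%type.

(** Only number quantifiers, and only number and function parameters. *)
Fixpoint arithmetical (p : form) : Prop :=
  match p with
  | Eq a b | Lt a b => low_vars a /\ low_vars b
  | Bot => True
  | Imp p q => arithmetical p /\ arithmetical q
  | All s p => s = N /\ arithmetical p
  end%type.

Definition is_set (X : tm ty1) : fm := ALL n : N, X @ n <= 1.

(** [p] is the formula p(n) with n = [Var N 0]; the set X is [Var ty1 0]. *)
Definition comprehension (p : form) : form :=
  let X : term ty1 := Var ty1 0 in
  Ex ty1 (And (is_set (fun _ => X) (fun _ => O))
              (All N (Iff (Eq (App X (Var N 0)) (Con COne)) (fshift ty1 p)))).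

Definition ACA0 : theory := fun q =>
  (exists2 p : form, arithmetical p & q = comprehension p)%type.

(** * Rational numbers *)

(** The rational (pos - neg) / den, where den is a positive number. *)
Record rat : Type := Rat { pos : tm N; neg : tm N; den : tm N }.

Definition radd (a b : rat) : rat :=
  Rat (pos a * den b + pos b * den a) (neg a * den b + neg b * den a)
      (den a * den b).
Definition ropp (a : rat) : rat := Rat (neg a) (pos a) (den a).
Definition rsub (a b : rat) : rat := radd a (ropp b).
Definition rlt (a b : rat) : fm :=
  pos a * den b + neg b * den a < pos b * den a + neg a * den b.
Definition rle (a b : rat) : fm :=
  pos a * den b + neg b * den a <= pos b * den a + neg a * den b.

(** "K holds of the absolute value of a". *)
Definition with_rabs (a : rat) (K : rat -> fm) : fm :=
  EX z : N, (pos a = neg a + z \/ neg a = pos a + z) /\ K (Rat z 0 (den a)).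

(** c is the Cantor code (a + b)(a + b + 1) / 2 + b of the pair (a, b). *)
Definition is_pair (c a b : tm N) : fm :=
  c + c = (a + b) * ((a + b) + 1) + (b + b).

(** "K holds of the rational number with code q".  Every number codes exactly
    one rational: ((p, m), d) is the code of (p - m) / (d + 1). *)
Definition with_rat (q : tm N) (K : rat -> fm) : fm :=
  EX z : N, EX p : N, EX m : N, EX d : N,
    is_pair q z d /\ is_pair z p m /\ K (Rat p m (d + 1)).

(** The doubling function, as the combinator term S (+) (S K K). *)
Definition double : tm ty1 :=
  con (CS N N N) @ con CPlus @
  (con (CS N ty1 N) @ con (CK N ty1) @ con (CK N N)).

Definition pow2 (n : tm N) : tm N :=
  con CRec @ (con (CK ty1 N) @ double) @ 1 @ n.

Definition inv_pow2 (n : tm N) : rat := Rat 1 0 (pow2 n).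
Definition two_inv_pow2 (n : tm N) : rat := Rat 2 0 (pow2 n).

(** * Real numbers *)

(** A real is a sequence x of codes of rationals; [approx x n K] says that K
    holds of its n-th approximation.  Expressions denoting reals are given by
    their approximations in the same style. *)
Definition real : Type := tm N -> (rat -> fm) -> fm.

Definition approx (x : tm ty1) : real := fun n K => with_rat (x @ n) K.

Definition is_real (x : tm ty1) : fm :=
  ALL n : N, ALL i : N,
    approx x n (fun a => approx x (n + i) (fun b =>
      with_rabs (rsub a b) (fun c => rlt c (inv_pow2 n)))).

Definition eqR (x y : real) : fm :=
  ALL n : N, x n (fun a => y n (fun b =>
    with_rabs (rsub a b) (fun c => rle c (two_inv_pow2 n)))).
Definition leR (x y : real) : fm :=
  ALL n : N, x n (fun a => y n (fun b => rle a (radd b (two_inv_pow2 n)))).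
Definition ltR (x y : real) : fm := ~ leR y x.

Definition constR (a : rat) : real := fun _ K => K a.
Definition ratR (q : tm N) : real := fun _ K => with_rat q K.
(** The index n + 1 keeps the difference fast-converging. *)
Definition subR (x y : real) : real := fun n K =>
  x (n + 1) (fun a => y (n + 1) (fun b => K (rsub a b))).
Definition absR (x : real) : real := fun n K => x n (fun a => with_rabs a K).

Definition zeroR : real := constR (Rat 0 0 1).
Definition oneR : real := constR (Rat 1 0 1).
Definition inv_pow2R (k : tm N) : real := constR (inv_pow2 k).

Definition in_unit (x : tm ty1) : fm :=
  is_real x /\ leR zeroR (approx x) /\ leR (approx x) oneR.

(** F represents a map from the reals to the reals. *)
Definition fun_R (F : tm (ty1 ~> ty1)%ty) : fm :=
  (ALL x : ty1, is_real x ==> is_real (F @ x)) /\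
  (ALL x : ty1, ALL y : ty1, is_real x ==> is_real y ==>
     eqR (approx x) (approx y) ==> eqR (approx (F @ x)) (approx (F @ y))).

(** F represents a map from [0,1] to [0,1]. *)
Definition fun_unit (F : tm (ty1 ~> ty1)%ty) : fm :=
  (ALL x : ty1, in_unit x ==> in_unit (F @ x)) /\
  (ALL x : ty1, ALL y : ty1, in_unit x ==> in_unit y ==>
     eqR (approx x) (approx y) ==> eqR (approx (F @ x)) (approx (F @ y))).

Definition mem (A : tm (ty1 ~> ty1)%ty) (x : tm ty1) : fm :=
  is_real x /\ ltR zeroR (approx (A @ x)).

Definition subset_unit (A : tm (ty1 ~> ty1)%ty) : fm :=
  fun_R A /\ ALL x : ty1, mem A x ==> in_unit x.

Definition mem_closed (a r x : tm ty1) : fm :=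
  in_unit x /\
  ALL n : N, leR (ratR (r @ n)) (absR (subR (approx x) (ratR (a @ n)))).

Definition nonempty (P : tm ty1 -> fm) : fm := EX x : ty1, P x.

(** The supremum of F(x) over the x with P(x) exists. *)
Definition sup_exists (P : tm ty1 -> fm) (F : tm (ty1 ~> ty1)%ty) : fm :=
  EX y : ty1, is_real y /\
    (ALL x : ty1, P x ==> leR (approx (F @ x)) (approx y)) /\
    (ALL k : N, EX x : ty1, P x /\
       ltR (subR (approx y) (inv_pow2R k)) (approx (F @ x))).

(** * The principles *)

(** A supremum in the sense of [sup_exists] over the empty set never exists,
    so the sets are taken to be nonempty. *)
Definition SUP_sets : fm :=
  ALL A : (ty1 ~> ty1)%ty, ALL F : (ty1 ~> ty1)%ty,
    subset_unit A ==> nonempty (mem A) ==> fun_unit F ==>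
    sup_exists (mem A) F.

Definition SUP_closed : fm :=
  ALL a : ty1, ALL r : ty1, ALL F : (ty1 ~> ty1)%ty,
    nonempty (mem_closed a r) ==> fun_unit F ==>
    sup_exists (mem_closed a r) F.

Definition BOOT : fm :=
  ALL Y : (ty1 ~> N ~> N)%ty, EX X : ty1, is_set X /\
    ALL n : N, X @ n = 1 <==> EX f : ty1, Y @ f @ n = 0.

(** (D, P) is a directed set, with d in D when D(d) = 1 and d below e when
    P(d, e) = 1; directed sets are nonempty. *)
Definition directed (D : tm ty2) (P : tm (ty1 ~> ty1 ~> N)%ty) : fm :=
  (ALL d : ty1, D @ d <= 1) /\
  (ALL d : ty1, ALL e : ty1, P @ d @ e <= 1) /\
  (EX d : ty1, D @ d = 1) /\
  (ALL d : ty1, D @ d = 1 ==> P @ d @ d = 1) /\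
  (ALL c : ty1, ALL d : ty1, ALL e : ty1,
     D @ c = 1 ==> D @ d = 1 ==> D @ e = 1 ==>
     P @ c @ d = 1 ==> P @ d @ e = 1 ==> P @ c @ e = 1) /\
  (ALL d : ty1, ALL e : ty1, D @ d = 1 ==> D @ e = 1 ==>
     EX c : ty1, D @ c = 1 /\ P @ d @ c = 1 /\ P @ e @ c = 1).

Definition increasing_net (D : tm ty2) (P : tm (ty1 ~> ty1 ~> N)%ty)
    (x : tm (ty1 ~> ty1)%ty) : fm :=
  (ALL d : ty1, D @ d = 1 ==> in_unit (x @ d)) /\
  (ALL d : ty1, ALL e : ty1, D @ d = 1 ==> D @ e = 1 ==> P @ d @ e = 1 ==>
     leR (approx (x @ d)) (approx (x @ e))).

Definition converges (D : tm ty2) (P : tm (ty1 ~> ty1 ~> N)%ty)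
    (x : tm (ty1 ~> ty1)%ty) : fm :=
  EX y : ty1, is_real y /\
    ALL k : N, EX d : ty1, D @ d = 1 /\
      ALL e : ty1, D @ e = 1 ==> P @ d @ e = 1 ==>
        ltR (absR (subR (approx (x @ e)) (approx y))) (inv_pow2R k).

Definition MCT_net : fm :=
  ALL D : ty2, ALL P : (ty1 ~> ty1 ~> N)%ty, ALL x : (ty1 ~> ty1)%ty,
    directed D P ==> increasing_net D P x ==> converges D P x.

Definition ACA0_SUP_sets : theory :=
  extend ACA0 (fun q => q = sentence SUP_sets)%type.

(** ACA_0 is a scheme, so the equivalence between a theory U and a sentence p
    says that p follows from U and that p implies each element of U. *)
Definition proves_equiv (T U : theory) (p : form) : Prop :=
  (proves (extend T U) p /\ (forall q, U q -> proves T (Imp p q)))%type.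

(* Main.v *)
(** Derivability is reduced to truth in models: by Goedel's completeness theorem,
    proved with Henkin witnesses, it suffices to show that the principles are
    equivalent in every extensional model of RCA_0^omega, possibly with
    nonstandard numbers.  Combinators and the recursor provide a calculus of
    representable functions and decidable predicates on such a model, and its
    rationals form an ordered field in which real numbers are compared.

    MCT_net gives BOOT: finitely many witnesses f_i with Y(f_i, i) = 0 are ordered
    by the set of numbers they witness; the net of the sums of 4^(-i-1) over these
    sets increases, and the base four digits of its limit form the set required
    by BOOT.

    BOOT gives the rest: it decides numerical quantifiers, hence ACA_0, and it
    decides whether a value of a functional on Baire space exceeds a rational,
    hence suprema and limits of nets.  Points of an interval are presented as
    paths through its dyadic subintervals, and those of a closed set as paths
    through the subintervals not covered by the removed balls.

    For the converse, each supremum principle gives Sigma^0_1 comprehension, by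
    ACA_0 or as the infimum of a decreasing sequence.  If the functional E that
    decides (exists n) g(n) = 0 does not exist, then by Grilliot's trick every Y
    is determined by finite sequences and BOOT is Sigma^0_1 comprehension.  If it
    does, E and a choice functional turn a real into digits that respect equality
    of reals, and these into a sequence of functions f_n; BOOT is read off the
    supremum over [0, 1] of the sums of 4^(-n-1) over the n with Y(f_n, n) = 0. *)

From HB Require Import structures.
From mathcomp Require Import all_boot all_order all_algebra boolp ring lra zify.
From Stdlib Require Import List Cantor Eqdep_dec.
From Pilot Require Defs.
Import -(notations) Pilot.Defs.

Set Implicit Arguments.
Unset Strict Implicit.
Unset Printing Implicit Defensive.

(** * Substitutions *)

(** A model may be nonstandard and satisfies induction only for quantifier-free formulas with
    parameters. A function must therefore be shown representable ([rep]) before the recursor can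
    iterate it, and a predicate decidable ([dec]) before induction or a least number applies to it.
    An unbounded quantifier can occur in such a predicate only once BOOT or the functional E decides
    it. Base four with digits 0 and 1 is used because binary expansions are ambiguous: here the tail
    after a digit 0 stays a fixed proportion below the value of a digit 1, so a limit known only
    approximately still fixes its digits. BOOT is extracted from a limit or a supremum by an
    exchange argument. Close enough to the limit, digit n no longer changes. A witness f for n can
    replace the n-th function of an index without losing any other digit, so a digit that has
    settled is already 1 whenever a witness exists. The case distinction on E has its cause in
    extensionality on reals: a digit read from one rational approximation depends on the
    representation of the real, while an exact comparison with a threshold is a number quantifier,
    which E decides. *)

Definition valuation (D : ty -> Type) : Type := forall s : ty, nat -> D s.

(** For [D := term] this is convertible to [scons]. *)
Definition push (D : ty -> Type) (s : ty) (a : D s) (f : valuation D) :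
    valuation D := fun t n =>
  match ty_eq_dec s t with
  | left e => match n with
              | O => eq_rect s D a t e
              | S m => f t m
              end
  | right _ => f t n
  end.

Lemma valuation_ext (D : ty -> Type) (f g : valuation D) :
  (forall s n, f s n = g s n) -> f = g.
Proof. by move=> fg; do 2!apply: functional_extensionality_dep => ?. Qed.

Lemma push0 D s (a : D s) f : push a f s 0 = a.
Proof.
rewrite /push; case: ty_eq_dec => [e|//].
by rewrite (Prop_irrelevance e erefl).
Qed.

Lemma pushS D s (a : D s) f n : push a f s n.+1 = f s n.
Proof. by rewrite /push; case: ty_eq_dec. Qed.

Lemma push_neq D s (a : D s) f t n : s <> t -> push a f t n = f t n.
Proof. by rewrite /push; case: ty_eq_dec. Qed.

(** A case analysis on variables that hides the transport along [ty_eq_dec]. *)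
Lemma push_ind D s (a : D s) (f : valuation D) (P : forall t, nat -> D t -> Prop) :
  P s 0 a -> (forall n, P s n.+1 (f s n)) ->
  (forall t n, s <> t -> P t n (f t n)) -> forall t n, P t n (push a f t n).
Proof.
move=> P0 PS Pn t n; case: (ty_eq_dec s t) => [e|ne]; last first.
  by rewrite push_neq //; apply: Pn.
by subst t; case: n => [|n]; rewrite ?push0 ?pushS.
Qed.

Lemma shift_same s n : shift s s n = Var s n.+1.
Proof. by rewrite /shift; case: ty_eq_dec. Qed.

Lemma shift_neq s t n : s <> t -> shift s t n = Var t n.
Proof. by rewrite /shift => ne; case: ty_eq_dec => // e; case: ne. Qed.

Lemma scons0 s (a : term s) f : scons a f s 0 = a.
Proof. exact: (@push0 term). Qed.

Lemma sconsS s (a : term s) f n : scons a f s n.+1 = f s n.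
Proof. exact: (@pushS term). Qed.

Lemma scons_neq s (a : term s) f t n : s <> t -> scons a f t n = f t n.
Proof. exact: (@push_neq term). Qed.

Lemma tsubst_comp f g s (t : term s) :
  tsubst g (tsubst f t) = tsubst (fun s n => tsubst g (f s n)) t.
Proof. by elim: t => //= ? ? u -> v ->. Qed.

Lemma tsubst_var s (t : term s) : tsubst Var t = t.
Proof. by elim: t => //= ? ? u -> v ->. Qed.

Lemma scons_shift s (a : term s) f : 
  (fun t n => tsubst (scons a f) (shift s t n)) = f.
Proof.
apply: valuation_ext => t n.
case: (ty_eq_dec s t) => [e|ne]; last first.
  by rewrite shift_neq //= scons_neq.
by subst t; rewrite shift_same /= sconsS.
Qed.

Lemma scons_map s (a : term s) (f g : subst) :
  (fun t n => tsubst g (scons a f t n)) =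
  scons (tsubst g a) (fun t n => tsubst g (f t n)).
Proof.
apply: valuation_ext => t n; symmetry; move: t n.
apply: (@push_ind term _ _ _ (fun t n b => b = _)).
- by rewrite scons0.
- by move=> n; rewrite sconsS.
- by move=> t n ne; rewrite scons_neq.
Qed.

Lemma up_comp s (f g : subst) :
  (fun t n => tsubst (up s g) (up s f t n)) =
  up s (fun t n => tsubst g (f t n)).
Proof.
rewrite {2 3}/up scons_map /=.
rewrite {1}/up scons0; congr scons.
apply: valuation_ext => t n; rewrite tsubst_comp scons_shift.
by rewrite tsubst_comp.
Qed.

Lemma up_var s : up s Var = Var.
Proof.
apply: valuation_ext.
apply: (@push_ind term s _ _ (fun t n b => b = Var t n)) => //=.
- exact: shift_same.
- exact: shift_neq.
Qed.

Lemma fsubst_comp f g p :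
  fsubst g (fsubst f p) = fsubst (fun s n => tsubst g (f s n)) p.
Proof.
elim: p f g => //= [a b|a b|p IHp q IHq|s p IHp] f g.
- by rewrite !tsubst_comp.
- by rewrite !tsubst_comp.
- by rewrite IHp IHq.
- by rewrite IHp up_comp.
Qed.

Lemma fsubst_var p : fsubst Var p = p.
Proof.
elim: p => //= [a b|a b|p -> q ->|s p IHp] //; rewrite ?tsubst_var //.
by rewrite up_var IHp.
Qed.

Lemma inst_up s (a : term s) f p : inst a (fsubst (up s f) p) = fsubst (scons a f) p.
Proof.
rewrite /inst fsubst_comp /up scons_map /=.
rewrite scons0; congr (fsubst (scons _ _) _); apply: valuation_ext => t n.
by rewrite tsubst_comp scons_shift tsubst_var.
Qed.

Lemma scons_var_shift s : scons (Var s 0) (shift s) = Var.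
Proof. by rewrite -[RHS](up_var s). Qed.

(** * Finite supports *)

Definition agree (L : list ty) (k : nat) (f g : subst) : Prop :=
  forall s n, In s L -> n < k -> f s n = g s n.

Lemma agree_weaken L L' k k' f g :
  incl L L' -> k <= k' -> agree L' k' f g -> agree L k f g.
Proof. by move=> LL kk fg s n /LL sL /leq_trans /(_ kk); apply: fg. Qed.

Lemma tsubst_support s (t : term s) :
  exists L k, forall f g, agree L k f g -> tsubst f t = tsubst g t.
Proof.
elim: t => [{}s n|{}s c|r u a [L1 [k1 h1]] b [L2 [k2 h2]]] /=.
- by exists [:: s], n.+1 => f g; apply => //; left.
- by exists nil, 0.
- exists (List.app L1 L2), (maxn k1 k2) => f g fg; congr App.
  + apply: h1; apply: agree_weaken fg; last exact: leq_maxl.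
    by apply: incl_appl; apply: incl_refl.
  + apply: h2; apply: agree_weaken fg; last exact: leq_maxr.
    by apply: incl_appr; apply: incl_refl.
Qed.

Lemma agree_up L k s f g : agree L k f g -> agree L k (up s f) (up s g).
Proof.
move=> fg t n tL nk; case: (ty_eq_dec s t) => [e|ne]; last first.
  by rewrite /up !scons_neq // fg.
subst t; case: n nk => [|n] nk; rewrite /up ?scons0 ?sconsS //.
by rewrite fg // ltnW.
Qed.

Lemma fsubst_support p :
  exists L k, forall f g, agree L k f g -> fsubst f p = fsubst g p.
Proof.
elim: p => [a b|a b||p [L1 [k1 h1]] q [L2 [k2 h2]]|s p [L [k h]]] /=.
- have [L1 [k1 h1]] := tsubst_support a; have [L2 [k2 h2]] := tsubst_support b.
  exists (List.app L1 L2), (maxn k1 k2) => f g fg; congr Eq.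
  + apply: h1; apply: agree_weaken fg; last exact: leq_maxl.
    by apply: incl_appl; apply: incl_refl.
  + apply: h2; apply: agree_weaken fg; last exact: leq_maxr.
    by apply: incl_appr; apply: incl_refl.
- have [L1 [k1 h1]] := tsubst_support a; have [L2 [k2 h2]] := tsubst_support b.
  exists (List.app L1 L2), (maxn k1 k2) => f g fg; congr Lt.
  + apply: h1; apply: agree_weaken fg; last exact: leq_maxl.
    by apply: incl_appl; apply: incl_refl.
  + apply: h2; apply: agree_weaken fg; last exact: leq_maxr.
    by apply: incl_appr; apply: incl_refl.
- by exists nil, 0.
- exists (List.app L1 L2), (maxn k1 k2) => f g fg; congr Imp.
  + apply: h1; apply: agree_weaken fg; last exact: leq_maxl.
    by apply: incl_appl; apply: incl_refl.
  + apply: h2; apply: agree_weaken fg; last exact: leq_maxr.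
    by apply: incl_appr; apply: incl_refl.
- by exists L, k => f g fg; rewrite (h _ _ (agree_up s fg)).
Qed.

Fixpoint ssubst (l : list {s : ty & term s}) : subst :=
  match l with
  | nil => Var
  | existT s a :: l => scons a (ssubst l)
  end.

Lemma ssubst_block k s (h : nat -> term s) l : exists l',
  (forall n, n < k -> ssubst l' s n = h n) /\
  (forall t n, s <> t -> ssubst l' t n = ssubst l t n).
Proof.
elim: k h l => [|k IH] h l; first by exists l.
have [l' [h1 h2]] := IH (fun n => h n.+1) l.
exists (existT _ s (h 0) :: l'); split => [[|n] nk|t n ne] /=.
- exact: scons0.
- by rewrite sconsS h1.
- by rewrite scons_neq // h2.
Qed.

Lemma agree_ssubst L k f : exists l, agree L k (ssubst l) f.
Proof.
elim: L => [|s L [l lP]]; first by exists nil.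
have [l' [h1 h2]] := ssubst_block k (f s) l; exists l' => t n tL nk.
case: (ty_eq_dec s t) => [e|ne]; first by subst t; apply: h1.
by rewrite h2 //; apply: lP => //; case: tL.
Qed.

(** * Derivations *)

Lemma weaken T G G' p : deriv T G p -> incl G G' -> deriv T G' p.
Proof.
move=> d; elim: d G' => {G p} [G p Tp|G p pG|G p q _ IH|G p q _ IH1 _ IH2
    |G s p _ IH|G s p a _ IH|G p _ IH] G' GG.
- exact: P_ax.
- by apply: P_hyp; apply: GG.
- by apply: P_impI; apply: IH; apply: incl_cons; [left|apply: incl_tl].
- by apply: P_impE; [apply: IH1|apply: IH2].
- by apply: P_allI; apply: IH; apply: incl_map.
- by apply: P_allE; apply: IH.
- by apply: P_raa; apply: IH; apply: incl_cons; [left|apply: incl_tl].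
Qed.

Lemma deriv_impI_iff T G p q : deriv T G (Imp p q) <-> deriv T (p :: G) q.
Proof.
split; last exact: P_impI.
move=> d; apply: (@P_impE _ _ p); last by apply: P_hyp; left.
by apply: weaken d _; apply: incl_tl; apply: incl_refl.
Qed.

(** Discharging the context reduces substitution in derivations to the empty context, where [P_allI]
    has nothing to shift. *)
Fixpoint imps (G : list form) (p : form) : form :=
  match G with nil => p | h :: G => imps G (Imp h p) end.

Lemma deriv_imps T G p : deriv T G p <-> proves T (imps G p).
Proof. by elim: G p => //= h G IH p; rewrite -IH deriv_impI_iff. Qed.

Lemma fsubst_imps f G p :
  fsubst f (imps G p) = imps (List.map (fsubst f) G) (fsubst f p).
Proof. by elim: G p => //= h G IH p; rewrite IH. Qed.

(** One entry of the list at a time: generalize over the variable, substitute the remaining entries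
    under the quantifier, then instantiate. *)
Lemma proves_ssubst T l q : proves T q -> proves T (fsubst (ssubst l) q).
Proof.
elim: l q => [|[s a] l IH] q d /=; first by rewrite fsubst_var.
by rewrite -inst_up; apply: P_allE; apply: (IH (All s q)); apply: P_allI.
Qed.

(** The rules instantiate one variable at a time, but [q] depends on finitely many variables only,
    on which [f] agrees with a finite iteration of single instantiations. *)
Lemma proves_subst T f q : proves T q -> proves T (fsubst f q).
Proof.
have [L [k h]] := fsubst_support q; have [l lf] := agree_ssubst L k f.
by rewrite -(h _ _ lf); apply: proves_ssubst.
Qed.

Lemma deriv_subst T f G q :
  deriv T G q -> deriv T (List.map (fsubst f) G) (fsubst f q).
Proof. by rewrite !deriv_imps -fsubst_imps; apply: proves_subst. Qed.

(** Freshness is stated as invariance of substitution instead of by occurrences, with one bound for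
    the indices of all types. *)
Definition fresh_for (k : nat) (p : form) : Prop :=
  forall f g : subst, (forall s n, n < k -> f s n = g s n) ->
    fsubst f p = fsubst g p.

Lemma fresh_exists G : exists k, forall p, In p G -> fresh_for k p.
Proof.
elim: G => [|q G [k kP]]; first by exists 0.
have [L [k' h]] := fsubst_support q.
exists (maxn k k') => p [<-|/kP pk] f g fg.
  by apply: h => s n _ nk; apply: fg; rewrite leq_max nk orbT.
by apply: pk => s n nk; apply: fg; rewrite leq_max nk.
Qed.

Definition fresh (G : list form) : nat := sval (cid (fresh_exists G)).

Lemma freshP G p : In p G -> fresh_for (fresh G) p.
Proof. by rewrite /fresh; case: cid => k kP; apply: kP. Qed.

(** The variable [fresh G] can be moved to index 0 while all the others are
    shifted, so it is as good as the eigenvariable of [P_allI]. *)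
Lemma deriv_fresh T G s q (m := fresh G) :
  In (Not (All s q)) G ->
  deriv T G (inst (Var s m) q) -> deriv T G (All s q).
Proof.
move=> qG d; apply: P_allI.
pose tau : subst := fun t n =>
  if ty_eq_dec s t is left e then
    if n == m then eq_rect s term (Var s 0) t e else shift s t n
  else shift s t n.
have tau_shift t n : n < m -> tau t n = shift s t n.
  by move=> nm; rewrite /tau; case: ty_eq_dec => // e; rewrite (ltn_eqF nm).
have -> : List.map (fshift s) G = List.map (fsubst tau) G.
  apply: map_ext_in => p pG; apply: (freshP pG).
  by move=> t n nm; rewrite tau_shift.
have {1}-> : q = fsubst tau (inst (Var s m) q).
  rewrite /inst fsubst_comp scons_map /=.
  have -> : tau s m = Var s 0.
    rewrite /tau eqxx; case: ty_eq_dec => // e.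
    by rewrite (Prop_irrelevance e erefl).
  (* Membership of [Not (All s q)] in G is what makes the variable fresh for [q]. Stripping the
     quantifier and instantiating it with index 0 turns the right-hand side into [q] itself. *)
  have : fsubst tau (Not (All s q)) = fsubst (shift s) (Not (All s q)).
    by apply: (freshP qG); exact: tau_shift.
  case=> /(congr1 (inst (Var s 0))); rewrite !inst_up => ->.
  by rewrite scons_var_shift fsubst_var.
exact: deriv_subst.
Qed.

(** * Enumeration of formulas *)

Fixpoint code_ty (s : ty) : nat :=
  match s with
  | N => 0
  | Arr s t => (to_nat (code_ty s, code_ty t)).+1
  end.

Lemma to_nat_inj2 a b c d : to_nat (a, b) = to_nat (c, d) -> a = c /\ b = d.
Proof. by move=> /to_nat_inj []. Qed.

Lemma code_ty_inj s t : code_ty s = code_ty t -> s = t.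
Proof.
elim: s t => [|s IHs s' IHs'] [|t t'] //= [] /to_nat_inj2 [h1 h2].
by rewrite (IHs _ h1) (IHs' _ h2).
Qed.

Definition code_const (s : ty) (c : const s) : nat :=
  match c with
  | CZero => to_nat (0, 0)
  | COne => to_nat (1, 0)
  | CPlus => to_nat (2, 0)
  | CMult => to_nat (3, 0)
  | CRec => to_nat (4, 0)
  | CK s t => to_nat (5, to_nat (code_ty s, code_ty t))
  | CS r s t => to_nat (6, to_nat (code_ty r, to_nat (code_ty s, code_ty t)))
  end.

Lemma code_const_inj s (c : const s) s' (c' : const s') :
  code_const c = code_const c' -> existT const s c = existT const s' c'.
Proof.
case: c => [||||a b|a b d|]; case: c' => [||||a' b'|a' b' d'|];
  rewrite /code_const => /to_nat_inj2 [] //.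
- by move=> _ /to_nat_inj2 [/code_ty_inj -> /code_ty_inj ->].
- move=> _ /to_nat_inj2 [/code_ty_inj -> /to_nat_inj2 [/code_ty_inj ->]].
  by move=> /code_ty_inj ->.
Qed.

Fixpoint code_term (s : ty) (t : term s) : nat :=
  match t with
  | Var s n => to_nat (0, to_nat (code_ty s, n))
  | Con _ c => to_nat (1, code_const c)
  | App _ _ u v => to_nat (2, to_nat (code_term u, code_term v))
  end.

Lemma code_term_inj s (t : term s) s' (t' : term s') :
  code_term t = code_term t' -> existT term s t = existT term s' t'.
Proof.
elim: t s' t' => {s} [s n|s c|r s u IHu v IHv] s' [{}s' n'|{}s' c'|r' {}s' u' v'];
  cbn [code_term] => /to_nat_inj2 [] //.
- by move=> _ /to_nat_inj2 [/code_ty_inj -> ->].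
- move=> _ /code_const_inj h.
  exact: (congr1 (fun x => existT term (projT1 x) (Con (projT2 x))) h).
- move=> _ /to_nat_inj2 [/IHu hu /IHv hv].
  have [er es] : r = r' /\ s = s' by have := projT1_eq hu; case.
  subst r' s'.
  have -> : u = u' by apply: (inj_pair2_eq_dec _ ty_eq_dec) hu.
  by have -> : v = v' by apply: (inj_pair2_eq_dec _ ty_eq_dec) hv.
Qed.

Fixpoint code_form (p : form) : nat :=
  match p with
  | Bot => to_nat (0, 0)
  | Eq a b => to_nat (1, to_nat (code_term a, code_term b))
  | Lt a b => to_nat (2, to_nat (code_term a, code_term b))
  | Imp p q => to_nat (3, to_nat (code_form p, code_form q))
  | All s p => to_nat (4, to_nat (code_ty s, code_form p))
  end.

Lemma code_form_inj p q : code_form p = code_form q -> p = q.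
Proof.
have ct s (a b : term s) : code_term a = code_term b -> a = b.
  by move=> /code_term_inj; apply: (inj_pair2_eq_dec _ ty_eq_dec).
elim: p q => [a b|a b||p IHp p' IHp'|s p IHp] [a' b'|a' b'||q q'|s' q];
  cbn [code_form] => /to_nat_inj2 [] //.
- by move=> _ /to_nat_inj2 [/ct -> /ct ->].
- by move=> _ /to_nat_inj2 [/ct -> /ct ->].
- by move=> _ /to_nat_inj2 [/IHp -> /IHp' ->].
- by move=> _ /to_nat_inj2 [/code_ty_inj -> /IHp ->].
Qed.

(** Numbers that code no formula give [Bot], which is inconsistent with every context and hence
    never adopted by a stage. *)
Definition enum_form (n : nat) : form :=
  if pselect (exists p, code_form p = n) is left h then sval (cid h) else Bot.

Lemma enum_formK p : enum_form (code_form p) = p.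
Proof.
rewrite /enum_form; case: pselect => [h|[]]; last by exists p.
by case: cid => q /= /code_form_inj.
Qed.

(** * Structures and completeness *)

Record structure : Type := Structure {
  dom : ty -> Type;
  sap : forall s t, dom (Arr s t) -> dom s -> dom t;
  scon : forall s, const s -> dom s;
  seqv : dom N -> dom N -> Prop;
  slt : dom N -> dom N -> Prop }.

Fixpoint eval (S : structure) (rho : valuation (dom S)) (s : ty) (t : term s) :
    dom S s :=
  match t with
  | Var s n => rho s n
  | Con _ c => scon S c
  | App _ _ u v => sap (eval rho u) (eval rho v)
  end.

Fixpoint sat (S : structure) (rho : valuation (dom S)) (p : form) : Prop :=
  match p with
  | Eq a b => seqv (eval rho a) (eval rho b)
  | Lt a b => slt (eval rho a) (eval rho b)
  | Bot => False
  | Imp p q => sat rho p -> sat rho q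
  | All s p => forall a : dom S s, sat (push a rho) p
  end.

(** * The Henkin construction *)

Section Henkin.

Variables (T : theory) (p0 : form).
Hypothesis p0_unprovable : ~ proves T p0.

Definition consistent (G : list form) : Prop := ~ deriv T G Bot.

(** Existential formulas are negated universal ones, so this is the only shape that calls for a
    witness. Stages are finite, so a variable fresh for [p] and G can play the part of a Henkin
    constant. *)
Definition witnessed (p : form) (G : list form) : list form :=
  match p with
  | Imp (All s q) Bot => Not (inst (Var s (fresh (p :: G))) q) :: p :: G
  | _ => p :: G
  end.

Definition stage_step (p : form) (G : list form) : list form :=
  if pselect (consistent (p :: G)) is left _ then witnessed p G else G.

Fixpoint stage (n : nat) : list form :=
  match n with
  | O => [:: Not p0]
  | S n => stage_step (enum_form n) (stage n)
  end.

Lemma witnessed_incl p G : incl (p :: G) (witnessed p G).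
Proof.
case: p => [a b|a b||q r|s q] /=; try exact: incl_refl.
case: q => [a b|a b||q q'|s q]; try exact: incl_refl.
by case: r => *; try exact: incl_refl; apply: incl_tl; apply: incl_refl.
Qed.

Lemma witnessed_consistent p G : consistent (p :: G) -> consistent (witnessed p G).
Proof.
case: p => [a b|a b||q r|s q] //=.
case: q => [a b|a b||q q'|s q] //; case: r => // cG d; apply: cG.
have {d}/P_raa d := d.
apply: (@P_impE _ _ (All s q)); first by apply: P_hyp; left.
by apply: (@deriv_fresh T) d; left.
Qed.

Lemma stage_consistent n : consistent (stage n).
Proof.
elim: n => [|n IH] /=; first by move=> /P_raa.
by rewrite /stage_step; case: pselect => // /witnessed_consistent.
Qed.

Lemma stage_mono m n : m <= n -> incl (stage m) (stage n).
Proof.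
elim: n => [|n IH]; first by rewrite leqn0 => /eqP ->; apply: incl_refl.
rewrite leq_eqVlt => /orP [/eqP ->|/IH mn]; first exact: incl_refl.
apply: (incl_tran mn); rewrite /= /stage_step.
case: pselect => _; last exact: incl_refl.
by move=> p pG; apply: witnessed_incl; right.
Qed.

Definition henkin (p : form) : Prop := exists n, deriv T (stage n) p.

Lemma henkin2 p q r :
  (forall G, deriv T G p -> deriv T G q -> deriv T G r) ->
  henkin p -> henkin q -> henkin r.
Proof.
move=> h [m dm] [n dn]; exists (maxn m n); apply: h.
- by apply: weaken dm _; apply: stage_mono; apply: leq_maxl.
- by apply: weaken dn _; apply: stage_mono; apply: leq_maxr.
Qed.

Lemma henkin1 p q :
  (forall G, deriv T G p -> deriv T G q) -> henkin p -> henkin q.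
Proof. by move=> h [m /h dm]; exists m. Qed.

Lemma henkin_Bot : ~ henkin Bot.
Proof. by move=> [n /stage_consistent]. Qed.

(** When its turn comes, a derivable formula is consistent with the stage; otherwise that stage
    would prove its negation. *)
Lemma henkin_added p : henkin p -> incl (witnessed p (stage (code_form p)))
  (stage (code_form p).+1).
Proof.
move=> [m dm]; rewrite /= enum_formK /stage_step.
case: pselect => [_|[]]; first exact: incl_refl.
move=> /P_impI d; apply: henkin_Bot.
apply: (@henkin2 (Not p) p Bot) => [G||]; [exact: P_impE|by exists (code_form p)|by exists m].
Qed.

Lemma henkin_complete p : henkin p \/ henkin (Not p).
Proof.
case: (pselect (consistent (p :: stage (code_form p)))) => [c|/contrapT d].
  left; exists (code_form p).+1; rewrite /= enum_formK /stage_step.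
  by case: pselect => // _; apply: P_hyp; apply: witnessed_incl; left.
by right; exists (code_form p); apply: P_impI.
Qed.

Lemma henkin_Imp p q : henkin (Imp p q) <-> (henkin p -> henkin q).
Proof.
split=> [|h]; first by apply: henkin2 => G; apply: P_impE.
case: (henkin_complete p) => [/h|]; apply: henkin1 => G d.
  by apply: P_impI; apply: weaken d _; apply: incl_tl; apply: incl_refl.
apply: P_impI; apply: P_raa; apply: (@P_impE _ _ p).
  by apply: weaken d _; do 2!apply: incl_tl; apply: incl_refl.
by apply: P_hyp; right; left.
Qed.

(** From right to left the witnesses are used: if the universal formula is not derivable, its
    negation was adopted together with a counterexample, which contradicts the instance at that
    variable. *)
Lemma henkin_All s p : henkin (All s p) <-> forall a : term s, henkin (inst a p).
Proof.
split=> [h a|h]; first by apply: henkin1 h => G; apply: P_allE.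
case: (henkin_complete (All s p)) => // /henkin_added wit.
exfalso; apply: henkin_Bot; have [] := h (Var s (fresh (Not (All s p) ::
  stage (code_form (Not (All s p)))))).
move=> n; set a := inst _ p => d.
apply: (@henkin2 (Not a) a) => [G||]; [exact: P_impE| |by exists n].
by eexists; apply: P_hyp; apply: wit; left.
Qed.

(** Equality at type 0 is derivable equality, not identity of terms; the passage to classes comes
    later. *)
Definition term_structure : structure :=
  @Structure term App Con (fun a b => henkin (Eq a b)) (fun a b => henkin (Lt a b)).

Lemma eval_term_structure (rho : subst) s (t : term s) :
  @eval term_structure rho s t = tsubst rho t.
Proof. by elim: t => //= ? ? u -> v ->. Qed.

Lemma sat_term_structure (rho : subst) p :
  @sat term_structure rho p <-> henkin (fsubst rho p).
Proof.
elim: p rho => [a b|a b||p IHp q IHq|s p IHp] rho.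
- by rewrite /= !eval_term_structure.
- by rewrite /= !eval_term_structure.
- by split=> // /henkin_Bot.
- by rewrite [fsubst _ _]/= henkin_Imp -IHp -IHq.
- rewrite [fsubst _ _]/= henkin_All; split=> h a.
    by rewrite inst_up; apply/IHp; apply: h.
  by have := h a; rewrite inst_up => /IHp.
Qed.

Lemma term_structure_theory q rho : T q -> @sat term_structure rho q.
Proof.
move=> Tq; apply/sat_term_structure; exists 0.
have d : proves T (fsubst rho q) by apply: proves_subst; apply: P_ax.
by apply: weaken d _ => ? [].
Qed.

Lemma term_structure_refutes : ~ @sat term_structure Var p0.
Proof.
move=> /sat_term_structure; rewrite fsubst_var => h; apply: henkin_Bot.
apply: (@henkin2 (Not p0) p0) => [G||//]; first exact: P_impE.
by exists 0; apply: P_hyp; left.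
Qed.

End Henkin.

Theorem completeness (T : theory) (p : form) :
  (forall S : structure, (forall q rho, T q -> @sat S rho q) ->
     forall rho, @sat S rho p) -> proves T p.
Proof.
move=> h; apply: contrapT => np.
apply: (term_structure_refutes np); apply: h => q rho.
exact: term_structure_theory.
Qed.

(** * Denotations of formulas with named variables *)

Lemma sat_Not S rho p : @sat S rho (Not p) <-> ~ sat rho p.
Proof. by []. Qed.

Lemma sat_And S rho p q : @sat S rho (And p q) <-> sat rho p /\ sat rho q.
Proof.
split=> [h|[hp hq] h]; last exact: h.
by split; apply: contrapT => n; apply: h.
Qed.

Lemma sat_Or S rho p q : @sat S rho (Or p q) <-> sat rho p \/ sat rho q.
Proof.
split=> [h|[hp|hq] n]; [|by case: (n hp)|exact: hq].
by case: (pselect (sat rho p)) => [|/h]; [left|right].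
Qed.

Lemma sat_Iff S rho p q : @sat S rho (Iff p q) <-> (sat rho p <-> sat rho q).
Proof. by rewrite sat_And /=; split=> [[]|[]]. Qed.

Lemma sat_Ex S rho s p : @sat S rho (Ex s p) <-> exists a : dom S s, sat (push a rho) p.
Proof.
split=> [h|[a ha] h]; last exact: h ha.
by apply: contrapT => n; apply: h => a ha; apply: n; exists a.
Qed.

Section Denotations.

Variable S : structure.

(** A formula in named style is read in a valuation whose last [cdepth] values
    of each type are those of the quantifiers already passed. *)
Record ctx : Type := Ctx { cdepth : depth; cenv : valuation (dom S) }.

(** Counted from the outermost quantifier, a variable keeps its position when further quantifiers
    are entered, although its de Bruijn index grows. *)
Definition extends (c c' : ctx) : Prop := forall t,
  cdepth c t <= cdepth c' t /\
  forall j, j < cdepth c t ->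
    cenv c' t (cdepth c' t - j.+1) = cenv c t (cdepth c t - j.+1).

Lemma extends_refl c : extends c c.
Proof. by []. Qed.

Lemma extends_trans c1 c2 c3 : extends c1 c2 -> extends c2 c3 -> extends c1 c3.
Proof.
move=> h1 h2 t; have [le1 e1] := h1 t; have [le2 e2] := h2 t.
split=> [|j jc]; first exact: leq_trans le1 le2.
by rewrite e2 ?e1 //; apply: leq_trans le1.
Qed.

(** A named term may be used under more quantifiers than where it was introduced; quantifying over
    all extensions makes the denotation survive this. *)
Definition dt (c : ctx) (s : ty) (x : tm s) (v : dom S s) : Prop :=
  forall c', extends c c' -> eval (cenv c') (x (cdepth c')) = v.

Definition df (c : ctx) (p : fm) (P : Prop) : Prop :=
  forall c', extends c c' -> (sat (cenv c') (p (cdepth c')) <-> P).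

Lemma dt_mono c c' s (x : tm s) v : extends c c' -> dt c x v -> dt c' x v.
Proof. by move=> cc h c'' /(extends_trans cc); apply: h. Qed.

Lemma dt_con c s (k : const s) : dt c (con k) (scon S k).
Proof. by []. Qed.

Lemma dt_app c s t (f : tm (Arr s t)) (x : tm s) vf vx :
  dt c f vf -> dt c x vx -> dt c (app f x) (sap vf vx).
Proof. by move=> hf hx c' cc; rewrite /= hf // hx. Qed.

Lemma df_eq c a b va vb : dt c a va -> dt c b vb -> df c (feq a b) (seqv va vb).
Proof. by move=> ha hb c' cc; rewrite /= ha // hb. Qed.

Lemma df_lt c a b va vb : dt c a va -> dt c b vb -> df c (flt a b) (slt va vb).
Proof. by move=> ha hb c' cc; rewrite /= ha // hb. Qed.

Lemma df_imp c p q P Q : df c p P -> df c q Q -> df c (fimp p q) (P -> Q).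
Proof. by move=> hp hq c' cc; rewrite /= hp // hq. Qed.

Lemma df_not c p P : df c p P -> df c (fnot p) (~ P).
Proof. by move=> hp c' cc; rewrite sat_Not hp. Qed.

Lemma df_and c p q P Q : df c p P -> df c q Q -> df c (fand p q) (P /\ Q).
Proof. by move=> hp hq c' cc; rewrite sat_And hp // hq. Qed.

Lemma df_or c p q P Q : df c p P -> df c q Q -> df c (for_ p q) (P \/ Q).
Proof. by move=> hp hq c' cc; rewrite sat_Or hp // hq. Qed.

Lemma df_iff c p q P Q : df c p P -> df c q Q -> df c (fiff p q) (P <-> Q).
Proof. by move=> hp hq c' cc; rewrite sat_Iff hp // hq. Qed.

Lemma df_equiv c p P Q : df c p P -> (P <-> Q) -> df c p Q.
Proof. by move=> hp PQ c' cc; rewrite hp. Qed.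

Lemma df_all c s (p : tm s -> fm) (P : dom S s -> Prop) :
  (forall v c', extends c c' -> forall x, dt c' x v -> df c' (p x) (P v)) ->
  df c (all p) (forall v, P v).
Proof.
move=> h c1 cc1; rewrite [X in X <-> _]/=.
pose deeper : depth := fun t =>
  match ty_eq_dec t s with left _ => (cdepth c1 t).+1 | right _ => cdepth c1 t end.
suff hv v : sat (push v (cenv c1))
    (p (fun k' => Var s (k' s - (cdepth c1 s).+1)) deeper) <-> P v.
  by split=> H v; [exact: (iffLR (hv v)) (H v)|exact: (iffRL (hv v)) (H v)].
pose c2 := Ctx deeper (push v (cenv c1)).
have c12 : extends c1 c2.
  move=> t; rewrite /= /deeper; case: ty_eq_dec => [e|ne]; last first.
    by split=> // j _; rewrite push_neq // => e; apply: ne.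
  subst t; split=> // j jc; rewrite -(pushS v (cenv c1)); congr (push _ _ _ _).
  lia.
apply: (h v c2 (extends_trans cc1 c12) _ _ c2 (extends_refl c2)).
move=> c3 c23 /=; have [le e] := c23 s; rewrite /= /deeper in le e.
move: le e; case: ty_eq_dec => // _ le e.
by rewrite e // subSS subnn push0.
Qed.

Lemma df_ex c s (p : tm s -> fm) (P : dom S s -> Prop) :
  (forall v c', extends c c' -> forall x, dt c' x v -> df c' (p x) (P v)) ->
  df c (ex p) (exists v, P v).
Proof.
move=> h; apply: (@df_equiv _ _ (~ forall v, ~ P v)).
  by apply: df_not; apply: df_all => v c' cc x xv; apply: df_not; apply: h.
split=> [n|[v Pv] n]; last exact: n Pv.
by apply: contrapT => m; apply: n => v Pv; apply: m; exists v.
Qed.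

Fixpoint eqv (s : ty) : dom S s -> dom S s -> Prop :=
  match s with
  | N => fun a b => seqv a b
  | Arr s t => fun f g => forall x : dom S s, eqv (sap f x) (sap g x)
  end.

Lemma df_eqT c s (a b : tm s) va vb : dt c a va -> dt c b vb ->
  df c (eqT a b) (eqv va vb).
Proof.
elim: s c a b va vb => [|s _ t IH] c a b va vb ha hb /=; first exact: df_eq.
apply: df_all => v c' cc x xv; apply: IH; apply: dt_app => //.
- exact: dt_mono ha.
- exact: dt_mono hb.
Qed.

Definition ctx0 (rho : valuation (dom S)) : ctx := Ctx (fun _ => 0) rho.

Lemma sat_sentence rho p P : df (ctx0 rho) p P -> (sat rho (sentence p) <-> P).
Proof. by move=> h; apply: (h (ctx0 rho)); apply: extends_refl. Qed.

End Denotations.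

Ltac dt_lift :=
  repeat match goal with
  | E : extends ?c ?c', H : dt ?c ?x ?v |- dt ?c' ?x _ =>
      exact: (dt_mono E H)
  | E : extends ?c1 ?c', H : dt ?c ?x ?v |- dt ?c' ?x _ =>
      apply: (dt_mono E); clear E
  end.

Ltac den_step :=
  first
  [ assumption
  | apply: df_imp | apply: df_and | apply: df_or | apply: df_not | apply: df_iff
  | match goal with |- df _ (all _) _ =>
      let v := fresh "v" in let c := fresh "c" in let e := fresh "e" in
      let x := fresh "x" in let xv := fresh "xv" in
      apply: df_all => v c e x xv end
  | match goal with |- df _ (ex _) _ =>
      let v := fresh "v" in let c := fresh "c" in let e := fresh "e" in
      let x := fresh "x" in let xv := fresh "xv" in
      apply: df_ex => v c e x xv end
  | apply: df_eqT | apply: df_eq | apply: df_lt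
  | apply: dt_con | apply: dt_app
  | solve [dt_lift] ].

Ltac den := repeat den_step.

(** * Extensional models *)

Section Classes.

Variables (A : Type) (R : A -> A -> Prop).

Definition classes : Type := {P : A -> Prop | exists x, P = R x}.

Definition class_of (x : A) : classes := exist _ (R x) (ex_intro _ x erefl).

Definition class_repr (q : classes) : A := sval (cid (svalP q)).

Lemma class_reprK q : class_of (class_repr q) = q.
Proof.
by rewrite /class_repr; case: cid; case: q => P h x /= e; apply: eq_exist.
Qed.

Hypothesis R_refl : forall x, R x x.
Hypothesis R_sym : forall x y, R x y -> R y x.
Hypothesis R_trans : forall x y z, R x y -> R y z -> R x z.

Lemma class_of_eq x y : class_of x = class_of y <-> R x y.
Proof.
split=> [[->]|xy]; first exact: R_refl.
have e : R x = R y.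
  by apply: funext => z; apply: propext; split; apply: R_trans => //; apply: R_sym.
by rewrite /class_of; apply: eq_exist.
Qed.

End Classes.

Section Quotient.

Variable S : structure.
Hypothesis S_RCA0w : forall q rho, RCA0w q -> @sat S rho q.

Definition some_valuation : valuation (dom S).
Proof.
have d s : dom S s by elim: s => [|s _ t d]; [exact: (scon S CZero)|
  exact: (sap (scon S (CK t s)) d)].
by move=> s _; apply: d.
Defined.

Lemma semiring_sat q : In q semiring_axioms -> sat some_valuation (sentence q).
Proof. by move=> h; apply: S_RCA0w; apply: ax_semiring. Qed.

Lemma seqv_refl (x : dom S N) : seqv x x.
Proof. by have := @semiring_sat _ (or_introl erefl); apply. Qed.

Lemma seqv_sym (x y : dom S N) : seqv x y -> seqv y x.
Proof. by have := @semiring_sat _ (or_intror (or_introl erefl)); apply. Qed.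

Lemma seqv_trans (x y z : dom S N) : seqv x y -> seqv y z -> seqv x z.
Proof.
by have := @semiring_sat _ (or_intror (or_intror (or_introl erefl))); apply.
Qed.

Lemma slt_seqv (x y u v : dom S N) : seqv x u -> seqv y v -> slt x y -> slt u v.
Proof.
by have := @semiring_sat _ (or_intror (or_intror (or_intror (or_introl erefl)))); apply.
Qed.

Lemma eqv_refl s (x : dom S s) : eqv x x.
Proof. by elim: s x => [|s _ t IH] x /=; [exact: seqv_refl|]. Qed.

Lemma eqv_sym s (x y : dom S s) : eqv x y -> eqv y x.
Proof.
elim: s x y => [|s _ t IH] x y /=; first exact: seqv_sym.
by move=> h z; apply: IH.
Qed.

Lemma eqv_trans s (x y z : dom S s) : eqv x y -> eqv y z -> eqv x z.
Proof.
elim: s x y z => [|s _ t IH] x y z /=; first exact: seqv_trans.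
by move=> h k w; apply: IH (h w) (k w).
Qed.

(** Here the extensionality axioms enter: they give congruence in the argument, while congruence in
    the function is the definition of [eqv] at arrow types. *)
Lemma sap_eqv s t (f g : dom S (Arr s t)) x y :
  eqv f g -> eqv x y -> eqv (sap f x) (sap g y).
Proof.
move=> fg xy; apply: eqv_trans (fg y); move: x y f xy {g fg}.
have := S_RCA0w some_valuation (ax_ext s t).
apply: (iffLR (sat_sentence _)); rewrite /ext_axiom; den.
Qed.

Definition qdom (s : ty) : Type := classes (@eqv S s).

Definition qpi (s : ty) (x : dom S s) : qdom s := class_of _ x.
Definition qrepr (s : ty) (q : qdom s) : dom S s := class_repr q.

Lemma qpi_eq s (x y : dom S s) : qpi x = qpi y <-> eqv x y.
Proof.
by apply: class_of_eq; [exact: eqv_refl|exact: eqv_sym|exact: eqv_trans].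
Qed.

Lemma qreprK s (q : qdom s) : qpi (qrepr q) = q.
Proof. exact: class_reprK. Qed.

Lemma qrepr_pi s (x : dom S s) : eqv (qrepr (qpi x)) x.
Proof. by rewrite -qpi_eq qreprK. Qed.

Definition quotient : structure :=
  @Structure qdom (fun s t f x => qpi (sap (qrepr f) (qrepr x)))
    (fun s c => qpi (scon S c)) eq (fun a b => slt (qrepr a) (qrepr b)).

Lemma qpi_sap s t (f : dom S (Arr s t)) x :
  qpi (sap f x) = @sap quotient s t (qpi f) (qpi x).
Proof.
apply/qpi_eq; apply: (@sap_eqv s t).
- exact: (@eqv_sym (Arr s t) _ _ (qrepr_pi f)).
- exact: eqv_sym (qrepr_pi x).
Qed.

Definition qvaluation (rho : valuation (dom S)) : valuation (dom quotient) :=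
  fun s n => qpi (rho s n).

Lemma qvaluation_push s (a : dom S s) rho :
  qvaluation (push a rho) = push (qpi a : dom quotient s) (qvaluation rho).
Proof.
apply: valuation_ext => t n; symmetry; move: t n.
apply: (push_ind (P := fun t n b => b = qvaluation (push a rho) t n)).
- by rewrite /qvaluation push0.
- by move=> n; rewrite /qvaluation pushS.
- by move=> t n ne; rewrite /qvaluation push_neq.
Qed.

Lemma eval_quotient rho s (t : term s) :
  @eval quotient (qvaluation rho) s t = qpi (eval rho t).
Proof. by elim: t => //= r t' f -> x ->; symmetry; apply: qpi_sap. Qed.

Lemma sat_quotient rho p : @sat quotient (qvaluation rho) p <-> sat rho p.
Proof.
elim: p rho => [a b|a b||p IHp q IHq|s p IHp] rho //=.
- by rewrite !eval_quotient qpi_eq.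
- rewrite !eval_quotient; have h x : seqv (qrepr (qpi x)) x := @qrepr_pi N x.
  by split; apply: slt_seqv => //; apply: seqv_sym.
- by rewrite IHp IHq.
- split=> h a; first by rewrite -IHp qvaluation_push.
  by rewrite -(qreprK a) -qvaluation_push IHp.
Qed.

Lemma quotient_ext s t (f g : dom quotient (Arr s t)) :
  (forall x, sap f x = sap g x) -> f = g.
Proof.
move=> fg; rewrite -(qreprK f) -(qreprK g); apply/qpi_eq => x.
apply/qpi_eq; move: (fg (qpi x)); rewrite /= !qpi_eq => h.
apply: eqv_trans (eqv_trans h _).
- apply: (@sap_eqv s t); [exact: (@eqv_refl (Arr s t))|exact: eqv_sym (qrepr_pi _)].
- apply: (@sap_eqv s t); [exact: (@eqv_refl (Arr s t))|exact: qrepr_pi].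
Qed.

End Quotient.

Record model : Type := Model {
  mstr :> structure;
  m_eq : forall a b : dom mstr N, seqv a b <-> a = b;
  m_ext : forall s t (f g : dom mstr (Arr s t)), (forall x, sap f x = sap g x) -> f = g;
  m_ax : forall q rho, RCA0w q -> @sat mstr rho q }.

Theorem model_completeness (T : theory) (p : form) :
  (forall q, RCA0w q -> T q) ->
  (forall M : model, (forall q rho, T q -> @sat M rho q) ->
     forall rho, @sat M rho p) -> proves T p.
Proof.
move=> RT h; apply: completeness => S ST rho.
have SR q r : RCA0w q -> @sat S r q by move=> /RT; apply: ST.
have QT q r : T q -> @sat (quotient S) r q.
  move=> Tq; have -> : r = qvaluation (fun s n => qrepr (r s n)).
    by apply: valuation_ext => s n; rewrite /qvaluation qreprK.
  by apply/(sat_quotient SR); apply: ST.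
pose M := @Model (quotient S) (fun a b => conj id id) (@quotient_ext S SR)
  (fun q r Rq => QT q r (RT q Rq)).
by apply/(sat_quotient SR); apply: (h M).
Qed.

Import Order.TTheory GRing.Theory Num.Theory.
Local Open Scope ring_scope.

(** * Arithmetic in a model *)

Notation nn M := (dom (mstr M) N).

Lemma model_semiring (M : model) i : (i < 19)%N ->
  @sat M (some_valuation M) (sentence (List.nth i semiring_axioms fbot)).
Proof.
move=> i19; apply: m_ax; apply: ax_semiring; apply: nth_In.
by move: i19 => /ssrnat.ltP.
Qed.

HB.instance Definition _ (M : model) := gen_eqMixin (nn M).
HB.instance Definition _ (M : model) := gen_choiceMixin (nn M).

Section SemiringLaws.

Variable M : model.
Implicit Types x y z : nn M.

Let add x y : nn M := sap (sap (scon M CPlus) x) y.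
Let mul x y : nn M := sap (sap (scon M CMult) x) y.
Let zero : nn M := scon M CZero.
Let one : nn M := scon M COne.

Fact nn_addA : associative add.
Proof.
by move=> x y z; symmetry; apply/m_eq; apply: (@model_semiring M 4 isT).
Qed.

Fact nn_addC : commutative add.
Proof. by move=> x y; apply/m_eq; apply: (@model_semiring M 5 isT). Qed.

Fact nn_add0 : left_id zero add.
Proof.
by move=> x; rewrite nn_addC; apply/m_eq; apply: (@model_semiring M 6 isT).
Qed.

Fact nn_mulA : associative mul.
Proof.
by move=> x y z; symmetry; apply/m_eq; apply: (@model_semiring M 7 isT).
Qed.

Fact nn_mulC : commutative mul.
Proof. by move=> x y; apply/m_eq; apply: (@model_semiring M 8 isT). Qed.

Fact nn_mul1 : left_id one mul.
Proof.
by move=> x; rewrite nn_mulC; apply/m_eq; apply: (@model_semiring M 9 isT).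
Qed.

Fact nn_mul0 : left_zero zero mul.
Proof.
by move=> x; rewrite nn_mulC; apply/m_eq; apply: (@model_semiring M 10 isT).
Qed.

Fact nn_mulD : left_distributive mul add.
Proof.
move=> x y z; rewrite ![mul _ z]nn_mulC.
by apply/m_eq; apply: (@model_semiring M 11 isT).
Qed.

Fact nn_ltxx x : ~ slt x x.
Proof. exact: (@model_semiring M 12 isT x). Qed.

Fact nn_lt_trans x y z : slt x y -> slt y z -> slt x z.
Proof. exact: (@model_semiring M 13 isT). Qed.

Fact nn_lt_total x y : slt x y \/ x = y \/ slt y x.
Proof.
have h : ~ slt x y -> ~ seqv x y -> slt y x := @model_semiring M 14 isT x y.
case: (pselect (slt x y)) => [|/h {}h]; [by left|right].
by case: (pselect (seqv x y)) => [/m_eq|/h]; [left|right].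
Qed.

Fact nn_lt01 : slt zero one.
Proof. exact: (@model_semiring M 18 isT). Qed.

Fact nn_one_neq0 : one != zero.
Proof. by apply/eqP => e; have := nn_lt01; rewrite e; apply: nn_ltxx. Qed.

Definition nn_lt x y : bool := `[< slt x y >].
Fact nn_lt_irr : irreflexive nn_lt.
Proof. by move=> x; apply/asboolP; apply: nn_ltxx. Qed.

Fact nn_lt_transb : transitive nn_lt.
Proof.
by move=> y x z /asboolP xy /asboolP yz; apply/asboolP; apply: nn_lt_trans yz.
Qed.

Fact nn_lt_totalb x y : x != y -> nn_lt x y || nn_lt y x.
Proof.
move=> /eqP ne; case: (nn_lt_total x y) => [|[//|]] lt; apply/orP.
- by left; apply/asboolP.
- by right; apply/asboolP.
Qed.

End SemiringLaws.

HB.instance Definition _ (M : model) :=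
  GRing.isNmodule.Build (nn M) (@nn_addA M) (@nn_addC M) (@nn_add0 M).
HB.instance Definition _ (M : model) :=
  GRing.Nmodule_isComNzSemiRing.Build (nn M) (@nn_mulA M) (@nn_mulC M)
    (@nn_mul1 M) (@nn_mulD M) (@nn_mul0 M) (@nn_one_neq0 M).
HB.instance Definition _ (M : model) :=
  @Order.LtOrder.Build ring_display (nn M) _ _ _ _ 
   (fun _ _ => erefl) (fun _ _ => erefl) (fun _ _ => erefl)
   (@nn_lt_irr M) (@nn_lt_transb M) (@nn_lt_totalb M).

(** Without these notations, the arguments of [<] are elaborated in
    [porderZmodType], to which [nn M] does not belong. *)
Notation "x <^ y" := (@Order.lt ring_display (nn _) x%R y%R) (at level 70, no associativity).
Notation "x <=^ y" := (@Order.le ring_display (nn _) x%R y%R) (at level 70, no associativity).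

Section OrderLaws.

Variable M : model.
Implicit Types x y z : nn M.

Lemma nn_ltE x y : (x <^ y) <-> slt x y.
Proof. by change (nn_lt x y <-> slt x y); split=> /asboolP. Qed.

Lemma nn_ltD2r z x y : x <^ y -> x + z <^ y + z.
Proof. by move=> /nn_ltE h; apply/nn_ltE; exact: (@model_semiring M 15 isT x y z h). Qed.

Lemma nn_ltM2r z x y : 0 <^ z -> x <^ y -> x * z <^ y * z.
Proof.
move=> /nn_ltE h0 /nn_ltE h; apply/nn_ltE.
exact: (@model_semiring M 16 isT x y z h0 h).
Qed.

Lemma nn_ge0 x : 0 <=^ x.
Proof.
have h : ~ slt 0 x -> seqv 0 x := @model_semiring M 17 isT x.
rewrite le_eqVlt; case: (pselect (slt 0 x)) => [/nn_ltE ->|/h /m_eq ->].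
  by rewrite orbT.
by rewrite eqxx.
Qed.

Lemma nn_lt0 x : (x <^ 0) = false.
Proof. by rewrite ltNge nn_ge0. Qed.

Lemma nn_gt0 x : x <> 0 -> 0 <^ x.
Proof. by move=> /eqP; rewrite lt_def nn_ge0 => ->. Qed.

Lemma nn_leD2r z x y : x <=^ y -> x + z <=^ y + z.
Proof. by rewrite !le_eqVlt => /orP [/eqP ->|/(nn_ltD2r z) ->]; rewrite ?eqxx ?orbT. Qed.

Lemma nn_ltD2rE z x y : (x + z <^ y + z) = (x <^ y).
Proof.
apply/idP/idP; last exact: nn_ltD2r.
by rewrite !ltNge; apply: contra; apply: nn_leD2r.
Qed.

Lemma nn_leD2rE z x y : (x + z <=^ y + z) = (x <=^ y).
Proof. by rewrite !leNgt nn_ltD2rE. Qed.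

Lemma nn_addIr z : injective (fun x : nn M => x + z).
Proof.
move=> x y /= e; apply/eqP; rewrite eq_le -(nn_leD2rE z) -[X in _ && X](nn_leD2rE z).
by rewrite e lexx.
Qed.

Lemma nn_mulIr z : 0 <^ z -> injective (fun x : nn M => x * z).
Proof.
move=> z0 x y /= e; case: (ltgtP x y) => // /(nn_ltM2r z0); by rewrite e ltxx.
Qed.

Lemma nn_leM2rE z x y : 0 <^ z -> (x * z <=^ y * z) = (x <=^ y).
Proof.
move=> z0; rewrite !leNgt; congr (~~ _); apply/idP/idP; last exact: nn_ltM2r.
by rewrite !ltNge; apply: contra; rewrite !le_eqVlt => /orP [/eqP ->|/(nn_ltM2r z0) ->];
  rewrite ?eqxx ?orbT.
Qed.

Lemma nn_leDr x y : x <=^ x + y.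
Proof. by rewrite -{1}[x]add0r [x + y]addrC nn_leD2r ?nn_ge0. Qed.

Lemma nn_ltxS x : x <^ x + 1.
Proof.
by rewrite -{1}[x]add0r [x + 1]addrC nn_ltD2r //; apply/nn_ltE; apply: nn_lt01.
Qed.

End OrderLaws.

(** * Representable functions *)

(** [model_env G] is the type of valuations of a context [G]; a function on it
    is representable when an element of the model computes it uniformly. *)
Section Representable.

Variable M : model.

Fixpoint model_env (G : list ty) : Type :=
  match G with nil => unit | s :: G => (model_env G * dom M s)%type end.

Definition hd s G (g : model_env (s :: G)) : dom M s := g.2.
Definition tl s G (g : model_env (s :: G)) : model_env G := g.1.

Fixpoint arrs (G : list ty) (t : ty) : ty :=
  match G with nil => t | s :: G => arrs G (Arr s t) end.

Fixpoint sapn (G : list ty) (t : ty) : dom M (arrs G t) -> model_env G -> dom M t :=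
  match G with
  | nil => fun F _ => F
  | s :: G => fun F g => sap (@sapn G (Arr s t) F g.1) g.2
  end.

Definition rep (G : list ty) (t : ty) (e : model_env G -> dom M t) : Prop :=
  exists F, forall g, sapn F g = e g.

Lemma eqv_eq s (a b : dom M s) : eqv a b -> a = b.
Proof.
elim: s a b => [|s _ u IH] a b /=; first by move/m_eq.
by move=> h; apply: m_ext => z; apply: IH.
Qed.

Lemma sapK s t (x : dom M s) (y : dom M t) : sap (sap (scon M (CK s t)) x) y = x.
Proof.
apply: eqv_eq; move: x y.
have := @m_ax M _ (some_valuation M) (ax_K s t).
by apply: (iffLR (sat_sentence _)); rewrite /k_axiom; den.
Qed.

Lemma sapS r s t (x : dom M (Arr r (Arr s t))) (y : dom M (Arr r s)) (z : dom M r) :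
  sap (sap (sap (scon M (CS r s t)) x) y) z = sap (sap x z) (sap y z).
Proof.
apply: eqv_eq; move: x y z.
have := @m_ax M _ (some_valuation M) (ax_S r s t).
by apply: (iffLR (sat_sentence _)); rewrite /s_axiom; den.
Qed.

Lemma rep_ext G t (e e' : model_env G -> dom M t) : e =1 e' -> rep e -> rep e'.
Proof. by move=> ee [F h]; exists F => g; rewrite h ee. Qed.

Lemma rep_const G t (v : dom M t) : rep (fun _ : model_env G => v).
Proof.
elim: G t v => [|s G IH] t v; first by exists v.
have [F h] := IH _ (sap (scon M (CK t s)) v).
by exists F => g /=; rewrite h sapK.
Qed.

(** Bracket abstraction: the combinator S passes the last variable of the context to both parts, and
    the remaining variables are handled by induction. *)
Lemma rep_app G s t (f : model_env G -> dom M (Arr s t)) (x : model_env G -> dom M s) :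
  rep f -> rep x -> rep (fun g => sap (f g) (x g)).
Proof.
elim: G s t f x => [|r G IH] s t f x [F hf] [X hx].
  by exists (sap F X) => -[]; rewrite -hf -hx.
have [A hA] := rep_const G (scon M (CS r s t)).
have [B hB] : rep (fun g : model_env G =>
    sap (sap (scon M (CS r s t)) (@sapn G (Arr r (Arr s t)) F g)) (@sapn G (Arr r s) X g)).
  by apply: (IH); [apply: (IH); [exists A|exists F]|exists X].
by exists B => g /=; rewrite hB sapS -hf -hx.
Qed.

Lemma rep_weak G s t (e : model_env G -> dom M t) :
  rep e -> rep (fun g : model_env (s :: G) => e (tl g)).
Proof.
move=> he; have [F h] := rep_app (rep_const G (scon M (CK t s))) he.
by exists F => g /=; rewrite h sapK.
Qed.

Lemma rep_hd0 G s : rep (fun g : model_env (s :: G) => hd g).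
Proof.
have [F h] := rep_const G (sap (sap (scon M (CS s (Arr N s) s)) (scon M (CK s (Arr N s))))
  (scon M (CK s N))).
by exists F => g /=; rewrite h sapS sapK.
Qed.

Definition weakening G G' (p : model_env G -> model_env G') : Prop :=
  forall t (e : model_env G' -> dom M t), rep e -> rep (fun g => e (p g)).

Lemma weakening_id G : weakening (fun g : model_env G => g).
Proof. by []. Qed.

Lemma weakening_tl G G' s (p : model_env G -> model_env (s :: G')) :
  weakening p -> weakening (fun g => tl (p g)).
Proof. by move=> hp t e he; apply: (hp _ (fun g => e (tl g))); apply: rep_weak. Qed.

Lemma rep_hd G G' s (p : model_env G -> model_env (s :: G')) :
  weakening p -> rep (fun g => hd (p g)).
Proof. by move=> hp; apply: (hp _ (fun g => hd g)); apply: rep_hd0. Qed.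

Definition default s : dom M s := some_valuation M s 0%N.

(** The element of the model computing [e], or junk if there is none. *)
Definition lam s t (e : dom M s -> dom M t) : dom M (Arr s t) :=
  if pselect (exists F, forall x, sap F x = e x) is left h then sval (cid h)
  else default (Arr s t).

Lemma beta s t (e : dom M s -> dom M t) x :
  rep (fun g : model_env [:: s] => e (hd g)) -> sap (lam e) x = e x.
Proof.
move=> [F h]; rewrite /lam; case: pselect => [h'|[]]; first by case: cid.
by exists F => y; apply: (h (tt, y)).
Qed.

(** By extensionality the element chosen by [lam] coincides with the one computed from the
    environment, so these choices are uniform. *)
Lemma rep_lam G s t (b : model_env G -> dom M s -> dom M t) :
  rep (fun g : model_env (s :: G) => b (tl g) (hd g)) ->
  rep (fun g => lam (b g)).
Proof.
move=> [F h]; exists F => g; apply: m_ext => x.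
have hx y : sap (@sapn G (Arr s t) F g) y = b g y := h (g, y).
rewrite hx /lam; case: pselect => [h'|[]]; first by case: cid => f /= ->.
by exists (@sapn G (Arr s t) F g).
Qed.

Lemma rep_add G (a b : model_env G -> nn M) :
  rep a -> rep b -> rep (fun g => a g + b g).
Proof. by move=> ha hb; apply: rep_app => //; apply: rep_app => //; apply: rep_const. Qed.

Lemma rep_mul G (a b : model_env G -> nn M) :
  rep a -> rep b -> rep (fun g => a g * b g).
Proof. by move=> ha hb; apply: rep_app => //; apply: rep_app => //; apply: rep_const. Qed.

Lemma sap_lam_eta s t (f : dom M (Arr s t)) : lam (fun x => sap f x) = f.
Proof.
apply: m_ext => x; rewrite beta //.
by apply: rep_app; [apply: rep_const|apply: rep_hd0].
Qed.

End Representable.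

Arguments hd : simpl never.
Arguments tl : simpl never.

(** A hook, redefined each time new closure properties have been proved. *)
Ltac rep_more := fail.

Ltac rep_step :=
  lazymatch goal with
  | |- weakening _ => first [exact: weakening_id | apply: weakening_tl]
  | |- rep _ => first
      [ assumption
      | match goal with |- rep (fun _ => ?v) => exact: (rep_const _ v) end
      | apply: rep_hd
      | apply: rep_add
      | apply: rep_mul
      | apply: rep_lam
      | rep_more
      | apply: rep_app ]
  | _ => rep_more
  end.

Ltac rep_tac := solve [repeat rep_step].


(** * Recursion, predecessor and subtraction *)

Section Recursion.

Variable M : model.
Implicit Types x y z n m k : nn M.

Definition natrec x (f : nn M -> nn M -> nn M) n : nn M :=
  sap (sap (sap (scon M CRec) (lam (fun i => lam (fun r => f i r)))) x) n.

Lemma natrecE x f n :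
  natrec x f n = sap (sap (sap (scon M CRec) (lam (fun i => lam (fun r => f i r)))) x) n.
Proof. by []. Qed.

Lemma rep_natrec G (a n : model_env M G -> nn M) f :
  rep a -> rep n -> rep (fun g : model_env M [:: N, N & G] => f (tl (tl g)) (hd (tl g)) (hd g)) ->
  rep (fun g => natrec (a g) (f g) (n g)).
Proof.
move=> ha hn hf; rewrite /natrec; apply: rep_app => //.
apply: rep_app => //; apply: rep_app; first exact: rep_const.
by apply: rep_lam; apply: rep_lam.
Qed.

Lemma rec_spec (f : dom M (Arr N (Arr N N))) x :
  sap (sap (sap (scon M CRec) f) x) 0 = x /\ forall n, sap (sap (sap (scon M CRec) f) x) (n + 1) =
    sap (sap f n) (sap (sap (sap (scon M CRec) f) x) n).
Proof.
have : seqv (sap (sap (sap (scon M CRec) f) x) 0) x /\ (forall n,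
    seqv (sap (sap (sap (scon M CRec) f) x) (n + 1))
      (sap (sap f n) (sap (sap (sap (scon M CRec) f) x) n))).
  move: f x; have := @m_ax M _ (some_valuation M) ax_rec.
  by apply: (iffLR (sat_sentence _)); rewrite /rec_axiom; den.
by case=> /m_eq h1 h2; split=> // n; apply/m_eq.
Qed.

Lemma natrec0 x f : natrec x f 0 = x.
Proof. by rewrite /natrec; have [] := rec_spec (lam (fun i => lam (fun r => f i r))) x. Qed.

Lemma natrecS x f n :
  rep (fun g : model_env M [:: N; N] => f (hd (tl g)) (hd g)) ->
  natrec x f (n + 1) = f n (natrec x f n).
Proof.
move=> hf; rewrite /natrec; have [_ ->] := rec_spec (lam (fun i => lam (fun r => f i r))) x.
rewrite beta; last by apply: rep_lam.
rewrite (beta (e := f n)) //.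
pose p (g : model_env M [:: N]) : model_env M [:: N; N] := (tt, n, hd g).
have [F hF] := hf; exists (sap F n) => -[[] y] /=.
exact: (hF (tt, n, y)).
Qed.

(** Induction for equations and for conjunctions of two inequalities, from
    which subtraction and thereby all decidable predicates are obtained. *)
Lemma eq_ind_fun (f g : nn M -> nn M) :
  rep (fun e : model_env M [:: N] => f (hd e)) ->
  rep (fun e : model_env M [:: N] => g (hd e)) ->
  f 0 = g 0 -> (forall n, f n = g n -> f (n + 1) = g (n + 1)) -> forall n, f n = g n.
Proof.
move=> hf hg h0 hS n.
pose p := Eq (App (Var ty1 0) (Var N 0)) (App (Var ty1 1) (Var N 0)).
have Ip := @m_ax M _ (push (lam f : dom M ty1) (push (lam g : dom M ty1)
  (some_valuation M))) (ax_ind (p := p) I).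
have {Ip} : seqv (sap (lam f) 0) (sap (lam g) 0) ->
  (forall n, seqv (sap (lam f) n) (sap (lam g) n) ->
    seqv (sap (lam f) (n + 1)) (sap (lam g) (n + 1))) ->
  forall n, seqv (sap (lam f) n) (sap (lam g) n) := Ip.
have fE m : sap (lam f) m = f m by apply: beta.
have gE m : sap (lam g) m = g m by apply: beta.
move=> Ip; rewrite -fE -gE; apply/m_eq; apply: Ip => [|m /m_eq].
  by apply/m_eq; rewrite fE gE.
by rewrite fE gE => /hS h; apply/m_eq; rewrite fE gE.
Qed.

Lemma lt2_ind_fun (f g h k : nn M -> nn M) :
  rep (fun e : model_env M [:: N] => f (hd e)) ->
  rep (fun e : model_env M [:: N] => g (hd e)) ->
  rep (fun e : model_env M [:: N] => h (hd e)) ->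
  rep (fun e : model_env M [:: N] => k (hd e)) ->
  (f 0 <^ g 0) /\ (h 0 <^ k 0) ->
  (forall n, (f n <^ g n) /\ (h n <^ k n) ->
    (f (n + 1) <^ g (n + 1)) /\ (h (n + 1) <^ k (n + 1))) ->
  forall n, (f n <^ g n) /\ (h n <^ k n).
Proof.
move=> hf hg hh hk h0 hS n.
pose p := And (Lt (App (Var ty1 0) (Var N 0)) (App (Var ty1 1) (Var N 0)))
  (Lt (App (Var ty1 2) (Var N 0)) (App (Var ty1 3) (Var N 0))).
have Ip := @m_ax M _ (push (lam f : dom M ty1) (push (lam g : dom M ty1)
  (push (lam h : dom M ty1) (push (lam k : dom M ty1) (some_valuation M)))))
  (ax_ind (p := p) (conj (conj I (conj I I)) I)).
pose P n := ~ (slt (sap (lam f) n) (sap (lam g) n) ->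
  ~ slt (sap (lam h) n) (sap (lam k) n)).
have {Ip} : P 0 -> (forall n, P n -> P (n + 1)) -> forall n, P n := Ip.
have PE m : P m <-> (f m <^ g m) /\ (h m <^ k m).
  rewrite /P !beta // !nn_ltE.
  by split=> [H|[H1 H2] H]; [split; apply: contrapT => H'; apply: H|apply: H].
by move=> Ip; apply/PE; apply: Ip => [|m /PE /hS /PE]; first apply/PE.
Qed.

End Recursion.

#[global] Opaque natrec lam.

Ltac rep_more ::= apply: rep_natrec.

Ltac beta := rewrite beta; last by rep_tac.

Section Subtraction.

Variable M : model.
Implicit Types x y z n m k : nn M.

Definition nn_pred n : nn M := natrec 0 (fun i _ => i) n.

Lemma nn_pred0 : nn_pred 0 = 0.
Proof. exact: natrec0. Qed.

Lemma nn_predS n : nn_pred (n + 1) = n.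
Proof. by rewrite /nn_pred natrecS //; rep_tac. Qed.

(** At this point induction covers equations, so the disjunction is encoded by the sign [s n]: it is
    idempotent and n = s n * (pred n + 1). By cancellation an idempotent other than 0 is 1. *)
Lemma nn_case n : n = 0 \/ n = nn_pred n + 1.
Proof.
pose s n : nn M := natrec 0 (fun _ _ => 1) n.
have sS m : s (m + 1) = 1 by rewrite /s natrecS //; rep_tac.
have s0 : s 0 = 0 by exact: natrec0.
have e1 : n = s n * (nn_pred n + 1).
  move: n; apply: eq_ind_fun => [| | |m _]; try by rewrite /s /nn_pred; rep_tac.
  - by rewrite s0 mul0r.
  - by rewrite sS mul1r nn_predS.
have e2 : s n * s n = s n.
  move: n {e1}; apply: eq_ind_fun => [| | |m _]; try by rewrite /s; rep_tac.
  - by rewrite s0 mul0r.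
  - by rewrite sS mul1r.
case: (pselect (s n = 0)) => [s0'|/nn_gt0 s0']; first by left; rewrite e1 s0' mul0r.
right; rewrite {1}e1; suff -> : s n = 1 by rewrite mul1r.
by apply: (nn_mulIr s0'); rewrite /= e2 mul1r.
Qed.

Lemma nn_ltSS x y : (x + 1 <^ y + 1) = (x <^ y).
Proof. exact: nn_ltD2rE. Qed.

Definition nn_sub n m : nn M := natrec n (fun _ r => nn_pred r) m.

Lemma rep_pred G (a : model_env M G -> nn M) : rep a -> rep (fun g => nn_pred (a g)).
Proof. by move=> ha; apply: rep_natrec => //; rep_tac. Qed.

Lemma rep_sub G (a b : model_env M G -> nn M) :
  rep a -> rep b -> rep (fun g => nn_sub (a g) (b g)).
Proof. by move=> ha hb; apply: rep_natrec => //; apply: rep_pred; rep_tac. Qed.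

Lemma nn_sub0 n : nn_sub n 0 = n.
Proof. exact: natrec0. Qed.

Lemma nn_subS n m : nn_sub n (m + 1) = nn_pred (nn_sub n m).
Proof. by rewrite /nn_sub natrecS //; apply: rep_pred; rep_tac. Qed.

Lemma nn_addK m n : nn_sub (n + m) m = n.
Proof.
have sSS a b : nn_sub (a + 1) (b + 1) = nn_sub a b.
  move: b; apply: eq_ind_fun => [| | |b e]; try by apply: rep_sub; rep_tac.
  - by rewrite nn_subS !nn_sub0 nn_predS.
  - by rewrite [LHS]nn_subS [RHS]nn_subS e.
move: m; apply: eq_ind_fun => [| | |m e]; try by first [apply: rep_sub; rep_tac|rep_tac].
- by rewrite addr0 nn_sub0.
- by rewrite addrA sSS.
Qed.

Lemma nn_sub_eq0 n z : nn_sub n (n + z) = 0.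
Proof.
move: z; apply: eq_ind_fun => [| | |z e]; try by first [apply: rep_sub; rep_tac|rep_tac].
- by rewrite -{1}[n]add0r addr0 nn_addK.
- by rewrite addrA nn_subS e nn_pred0.
Qed.

(** Discreteness is not an axiom. If y < x < y + 1, taking predecessors of both numbers preserves
    these inequalities; after y steps they read 0 < z < 1, which [nn_case] excludes. *)
Lemma nn_ltS x y : (x <^ y + 1) = (x <=^ y).
Proof.
apply/idP/idP => [xy|/le_lt_trans]; last by apply; apply: nn_ltxS.
rewrite leNgt; apply/negP => yx.
have : (nn_sub y y <^ nn_sub x y) /\ (nn_sub x y <^ nn_sub y y + 1).
  move: {2 3 4 6}y; apply: lt2_ind_fun; try by repeat first [apply: rep_sub|rep_step].
    by rewrite !nn_sub0.
  move=> n; rewrite !nn_subS; move: (nn_sub x n) (nn_sub y n) => a b [ba ab].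
  case: (nn_case a) ba ab => ->; first by rewrite nn_lt0.
  rewrite nn_predS !nn_ltSS; move: (nn_pred a) => {}a ba ab.
  case: (nn_case b) ba ab => ->; first by rewrite nn_lt0.
  by rewrite nn_predS nn_ltSS.
have -> : nn_sub y y = 0 by rewrite -{2}[y]addr0 nn_sub_eq0.
case: (nn_case (nn_sub x y)) => ->; first by rewrite ltxx => -[].
by rewrite nn_ltSS nn_lt0 => -[].
Qed.

Lemma nn_leS x y : (x + 1 <=^ y) = (x <^ y).
Proof. by rewrite -nn_ltS nn_ltSS. Qed.

(** If no difference exists, then x + n < y follows for all n by induction and discreteness, which
    is absurd for n = y. *)
Lemma nn_le_exists x y : x <=^ y -> exists z, y = x + z.
Proof.
move=> xy; apply: contrapT => nz.
have : (x + y <^ y) /\ (x + y <^ y).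
  move: {1 3}y; apply: lt2_ind_fun; try by rep_tac.
    by rewrite addr0 lt_neqAle xy andbT; split; apply/eqP => e; apply: nz; exists 0;
      rewrite e addr0.
  move=> n [h _]; rewrite addrA lt_neqAle nn_leS h andbT.
  by split; apply/eqP => e; apply: nz; exists (n + 1); rewrite -e addrA.
by case; rewrite -{2}[y]add0r nn_ltD2rE nn_lt0.
Qed.

Lemma nn_subE x y : (x <=^ y) <-> nn_sub x y = 0.
Proof.
split=> [/nn_le_exists [z ->]|e]; first exact: nn_sub_eq0.
rewrite leNgt; apply/negP => yx; have [z ez] := nn_le_exists (ltW yx).
by move: yx e; rewrite ez addrC nn_addK => yx z0; rewrite z0 add0r ltxx in yx.
Qed.

Lemma nn_addsub x y : y <=^ x -> y + nn_sub x y = x.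
Proof. by move=> /nn_le_exists [z ->]; rewrite [y + z]addrC nn_addK addrC. Qed.

End Subtraction.

(** * The ordered field of fractions of a model *)

Section Fractions.

Variable M : model.

(** [Frac p m d _] stands for (p - m) / d. *)
Record frac : Type := Frac {
  fpos : nn M; fneg : nn M; fden : nn M; fden_gt0 : 0 <^ fden }.

Implicit Types x y z : frac.

Definition frac_eq x y : Prop :=
  fpos x * fden y + fneg y * fden x = fpos y * fden x + fneg x * fden y.

Lemma nn_gt0M (a b : nn M) : 0 <^ a -> 0 <^ b -> 0 <^ a * b.
Proof. by move=> a0 b0; rewrite -(mul0r b) nn_ltM2r. Qed.

Lemma frac_eq_refl x : frac_eq x x.
Proof. by []. Qed.

Lemma frac_eq_sym x y : frac_eq x y -> frac_eq y x.
Proof. by move=> e; rewrite /frac_eq -e. Qed.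

Lemma frac_eq_trans x y z : frac_eq x y -> frac_eq y z -> frac_eq x z.
Proof.
rewrite /frac_eq; case: x y z => [p1 m1 d1 g1] [p2 m2 d2 d2_gt0] [p3 m3 d3 g3] /= e1 e2.
apply: (nn_mulIr d2_gt0) => /=; apply: (@nn_addIr _ (m2 * d1 * d3 + p2 * d1 * d3)) => /=.
transitivity ((p1 * d2 + m2 * d1) * d3 + (p2 * d3 + m3 * d2) * d1); first by ring.
by rewrite e1 e2; ring.
Qed.

Definition fraction : Type := classes frac_eq.
Definition fpi x : fraction := class_of _ x.
Definition frepr (q : fraction) : frac := class_repr q.

Lemma fpi_eq x y : fpi x = fpi y <-> frac_eq x y.
Proof.
by apply: class_of_eq; [exact: frac_eq_refl|exact: frac_eq_sym|exact: frac_eq_trans].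
Qed.

Lemma freprK q : fpi (frepr q) = q.
Proof. exact: class_reprK. Qed.

Lemma frepr_pi x : frac_eq (frepr (fpi x)) x.
Proof. by apply/fpi_eq; apply: freprK. Qed.

Lemma fraction_ind (P : fraction -> Prop) : (forall x, P (fpi x)) -> forall q, P q.
Proof. by move=> h q; rewrite -(freprK q). Qed.

Definition nn_frac (n : nn M) : frac := @Frac n 0 1 (iffRL (nn_ltE _ _) (nn_lt01 M)).

Definition frac_add x y : frac :=
  @Frac (fpos x * fden y + fpos y * fden x) (fneg x * fden y + fneg y * fden x) _
    (nn_gt0M (fden_gt0 x) (fden_gt0 y)).
Definition frac_opp x : frac := @Frac (fneg x) (fpos x) _ (fden_gt0 x).
Definition frac_mul x y : frac :=
  @Frac (fpos x * fpos y + fneg x * fneg y) (fpos x * fneg y + fneg x * fpos y) _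
    (nn_gt0M (fden_gt0 x) (fden_gt0 y)).

Definition fadd (a b : fraction) : fraction := fpi (frac_add (frepr a) (frepr b)).
Definition fopp (a : fraction) : fraction := fpi (frac_opp (frepr a)).
Definition fmul (a b : fraction) : fraction := fpi (frac_mul (frepr a) (frepr b)).
Definition fnonneg (a : fraction) : bool := fneg (frepr a) <=^ fpos (frepr a).

Lemma fadd_pi x y : fadd (fpi x) (fpi y) = fpi (frac_add x y).
Proof.
apply/fpi_eq; move: (frepr_pi x) (frepr_pi y).
move: (frepr (fpi x)) (frepr (fpi y)) => x' y'.
case: x' y' x y => [p1 m1 d1 g1] [p2 m2 d2 g2] [p3 m3 d3 g3] [p4 m4 d4 g4].
rewrite /frac_eq /= => e1 e2.
transitivity ((p1 * d3 + m3 * d1) * d2 * d4 + (p2 * d4 + m4 * d2) * d1 * d3); first by ring.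
by rewrite e1 e2; ring.
Qed.

Lemma fopp_pi x : fopp (fpi x) = fpi (frac_opp x).
Proof.
apply/fpi_eq; move: (frepr_pi x); move: (frepr (fpi x)) => x'.
case: x' x => [p1 m1 d1 g1] [p2 m2 d2 g2].
by rewrite /frac_eq /= => e; rewrite addrC -e addrC.
Qed.

Lemma fmul_pi x y : fmul (fpi x) (fpi y) = fpi (frac_mul x y).
Proof.
have compat x1 x2 z : frac_eq x1 x2 -> frac_eq (frac_mul x1 z) (frac_mul x2 z).
  case: x1 x2 z => [p1 m1 d1 g1] [p2 m2 d2 g2] [p3 m3 d3 g3]; rewrite /frac_eq /= => e.
  transitivity ((p1 * d2 + m2 * d1) * p3 * d3 + (p2 * d1 + m1 * d2) * m3 * d3);
    first by ring.
  transitivity ((p2 * d1 + m1 * d2) * p3 * d3 + (p1 * d2 + m2 * d1) * m3 * d3);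
    first by rewrite e.
  by ring.
have comm x1 x2 : frac_eq (frac_mul x1 x2) (frac_mul x2 x1).
  by rewrite /frac_eq /=; ring.
apply/fpi_eq; apply: frac_eq_trans (compat _ _ _ (frepr_pi x)) _.
apply: frac_eq_trans (comm _ _) _; apply: frac_eq_trans (comm _ _).
exact: compat (frepr_pi y).
Qed.

Lemma fnonneg_pi x : fnonneg (fpi x) = (fneg x <=^ fpos x).
Proof.
rewrite /fnonneg; move: (frepr_pi x); move: (frepr (fpi x)) => x'.
case: x' x => [p1 m1 d1 d1_gt0] [p2 m2 d2 d2_gt0]; rewrite /frac_eq /= => e.
rewrite -(nn_leM2rE _ _ d2_gt0) -[RHS](nn_leM2rE _ _ d1_gt0).
rewrite -(nn_leD2rE (m2 * d1)) e -[RHS](nn_leD2rE (m1 * d2)).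
by rewrite [m1 * d2 + _]addrC.
Qed.

Fact fadd_comm : commutative (@fadd).
Proof.
move=> a b; elim/fraction_ind: a => x; elim/fraction_ind: b => y.
by rewrite !fadd_pi; apply/fpi_eq; rewrite /frac_eq /=; ring.
Qed.

Fact fadd_assoc : associative (@fadd).
Proof.
move=> a b c; elim/fraction_ind: a => x; elim/fraction_ind: b => y.
elim/fraction_ind: c => z.
by rewrite !fadd_pi; apply/fpi_eq; rewrite /frac_eq /=; ring.
Qed.

Definition fnat n : fraction := fpi (nn_frac n).

Fact fadd_0 : left_id (fnat 0) fadd.
Proof.
move=> a; elim/fraction_ind: a => x.
by rewrite !fadd_pi; apply/fpi_eq; rewrite /frac_eq /=; ring.
Qed.

Fact fadd_opp : left_inverse (fnat 0) fopp fadd.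
Proof.
move=> a; elim/fraction_ind: a => x.
by rewrite fopp_pi !fadd_pi; apply/fpi_eq; rewrite /frac_eq /=; ring.
Qed.

Fact fmul_assoc : associative fmul.
Proof.
move=> a b c; elim/fraction_ind: a => x; elim/fraction_ind: b => y.
elim/fraction_ind: c => z.
by rewrite !fmul_pi; apply/fpi_eq; rewrite /frac_eq /=; ring.
Qed.

Fact fmul_comm : commutative fmul.
Proof.
move=> a b; elim/fraction_ind: a => x; elim/fraction_ind: b => y.
by rewrite !fmul_pi; apply/fpi_eq; rewrite /frac_eq /=; ring.
Qed.

Fact fmul_1 : left_id (fnat 1) fmul.
Proof.
move=> a; elim/fraction_ind: a => x.
by rewrite !fmul_pi; apply/fpi_eq; rewrite /frac_eq /=; ring.
Qed.

Fact fmul_add : left_distributive fmul fadd.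
Proof.
move=> a b c; elim/fraction_ind: a => x; elim/fraction_ind: b => y.
elim/fraction_ind: c => z.
by rewrite fadd_pi !fmul_pi fadd_pi; apply/fpi_eq; rewrite /frac_eq /=; ring.
Qed.

Fact fone_neq0 : fnat 1 <> fnat 0.
Proof.
move=> /fpi_eq; rewrite /frac_eq /= !mulr1 !add0r addr0 => e.
by have /nn_ltE := nn_lt01 M; rewrite -[X in X <^ _]e ltxx.
Qed.

Definition frac_inv x : frac :=
  match pselect (0 <^ nn_sub (fpos x) (fneg x)) with
  | left h => @Frac (fden x) 0 _ h
  | right _ =>
    match pselect (0 <^ nn_sub (fneg x) (fpos x)) with
    | left h => @Frac 0 (fden x) _ h
    | right _ => nn_frac 0
    end
  end.

Definition finv (a : fraction) : fraction := fpi (frac_inv (frepr a)).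

Fact fmul_inv a : a <> fnat 0 -> fmul (finv a) a = fnat 1.
Proof.
move=> a0; rewrite -{2}(freprK a) /finv fmul_pi; apply/fpi_eq.
have : fpos (frepr a) <> fneg (frepr a).
  by move=> e; apply: a0; rewrite -(freprK a); apply/fpi_eq; rewrite /frac_eq /= e; ring.
case: (frepr a) => p m d g /= pm; rewrite /frac_inv /=.
case: pselect => [h|/negP h]; [|case: pselect => [h'|/negP h']]; rewrite /frac_eq /=.
- have e : p = m + nn_sub p m.
    rewrite nn_addsub //; case: (leP m p) => // /ltW /nn_subE e.
    by rewrite e ltxx in h.
  by rewrite [in LHS]e; ring.
- have e : m = p + nn_sub m p.
    rewrite nn_addsub //; case: (leP p m) => // /ltW /nn_subE e.
    by rewrite e ltxx in h'.
  by rewrite [in LHS]e; ring.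
- have h0 n : ~~ (0 <^ n) -> n = 0 by move=> hn; apply: contrapT => /nn_gt0; apply/negP.
  case: pm; apply: le_anti; apply/andP.
  by split; apply/nn_subE; apply: h0.
Qed.

Fact finv_0 : finv (fnat 0) = fnat 0.
Proof.
rewrite /finv; have := frepr_pi (nn_frac 0); rewrite -/(fnat 0).
case: (frepr _) => p m d g; rewrite /frac_eq /= mulr1 mul0r add0r !addr0 mulr1 => e.
rewrite /frac_inv /=; have -> : nn_sub p m = 0 by apply/nn_subE; rewrite e.
have -> : nn_sub m p = 0 by apply/nn_subE; rewrite e.
by case: pselect => [h|//]; exfalso; move: h; rewrite ltxx.
Qed.

Definition fle (a b : fraction) : bool := fnonneg (fadd b (fopp a)).
Definition fnorm (a : fraction) : fraction := if fle (fnat 0) a then a else fopp a.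

Fact fnonneg_add a b : fnonneg a -> fnonneg b -> fnonneg (fadd a b).
Proof.
elim/fraction_ind: a => x; elim/fraction_ind: b => y.
rewrite fadd_pi !fnonneg_pi /= => /nn_le_exists [z ->] /nn_le_exists [w ->].
rewrite !mulrDl; set u := fneg x * _; set v := fneg y * _.
have -> : u + z * fden y + (v + w * fden x) = u + v + (z * fden y + w * fden x) by ring.
exact: nn_leDr.
Qed.

Fact fnonneg_mul a b : fnonneg a -> fnonneg b -> fnonneg (fmul a b).
Proof.
elim/fraction_ind: a => x; elim/fraction_ind: b => y.
rewrite fmul_pi !fnonneg_pi /= => /nn_le_exists [z ->] /nn_le_exists [w ->].
set u := fneg x; set v := fneg y.
have -> : (u + z) * (v + w) + u * v = ((u + z) * v + u * (v + w)) + z * w by ring.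
exact: nn_leDr.
Qed.

Fact fnonneg_anti a : fnonneg a -> fnonneg (fopp a) -> a = fnat 0.
Proof.
elim/fraction_ind: a => x; rewrite fopp_pi !fnonneg_pi /= => h1 h2.
apply/fpi_eq; rewrite /frac_eq /= !mulr1 mul0r addr0 add0r.
by apply: le_anti; rewrite h1 h2.
Qed.

Fact fnonneg_total a : fnonneg a || fnonneg (fopp a).
Proof. by elim/fraction_ind: a => x; rewrite fopp_pi !fnonneg_pi /= le_total. Qed.

End Fractions.

HB.instance Definition _ (M : model) := gen_eqMixin (fraction M).
HB.instance Definition _ (M : model) := gen_choiceMixin (fraction M).
HB.instance Definition _ (M : model) :=
  GRing.isZmodule.Build (fraction M) (@fadd_assoc M) (@fadd_comm M) (@fadd_0 M) (@fadd_opp M).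

Fact fone_neq0b M : fnat 1 != 0 :> fraction M.
Proof. by apply/eqP; apply: fone_neq0. Qed.

HB.instance Definition _ (M : model) :=
  GRing.Zmodule_isComNzRing.Build (fraction M) (@fmul_assoc M) (@fmul_comm M)
    (@fmul_1 M) (@fmul_add M) (@fone_neq0b M).

Fact fmul_invb M (a : fraction M) : a != 0 -> finv a * a = 1.
Proof. by move=> /eqP; apply: fmul_inv. Qed.

HB.instance Definition _ (M : model) :=
  GRing.ComNzRing_isField.Build (fraction M) (@fmul_invb M) (@finv_0 M).

Section FractionOrder.

Variable M : model.
Implicit Types a b : fraction M.

Fact fle0 a : fle 0 a = fnonneg a.
Proof. by rewrite /fle -[fadd _ _]/(a - 0) subr0. Qed.

Fact fleN a : fle a 0 = fnonneg (- a).
Proof. by rewrite /fle -[fadd _ _]/(0 - a) sub0r. Qed.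

Fact fle0_add a b : fle 0 a -> fle 0 b -> fle 0 (a + b).
Proof. by rewrite !fle0; apply: fnonneg_add. Qed.

Fact fle0_mul a b : fle 0 a -> fle 0 b -> fle 0 (a * b).
Proof. by rewrite !fle0; apply: fnonneg_mul. Qed.

Fact fle0_anti a : fle 0 a -> fle a 0 -> a = 0.
Proof. by rewrite fle0 fleN; apply: fnonneg_anti. Qed.

Fact fsub_ge0 a b : fle 0 (b - a) = fle a b.
Proof. by rewrite fle0. Qed.

Fact fle0_total a : fle 0 a || fle a 0.
Proof. by rewrite fle0 fleN; apply: fnonneg_total. Qed.

Fact fnormN a : fnorm (- a) = fnorm a.
Proof.
rewrite /fnorm -[fnat 0]/(0 : fraction M) !fle0 -[fopp _]/(- - a) -[fopp a]/(- a) opprK.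
case: (boolP (fnonneg a)) => ha; case: (boolP (fnonneg (- a))) => hb //.
- by rewrite (fnonneg_anti ha hb) oppr0.
- by have := fnonneg_total a; rewrite (negbTE ha) -[fopp a]/(- a) (negbTE hb).
Qed.

Fact ge0_fnorm a : fle 0 a -> fnorm a = a.
Proof. by rewrite /fnorm -[fnat 0]/(0 : fraction M) => ->. Qed.

End FractionOrder.

HB.instance Definition _ (M : model) :=
  Num.IntegralDomain_isLeReal.Build (fraction M) (@fle0_add M) (@fle0_mul M) (@fle0_anti M)
    (@fsub_ge0 M) (@fle0_total M) (@fnormN M) (@ge0_fnorm M)
    (Rlt := fun a b => (b != a) && fle a b) (fun _ _ => erefl).

Section EmbedNat.

Variable M : model.
Implicit Types (n m : nn M) (a b : fraction M).

Lemma fnatD n m : fnat (n + m) = fnat n + fnat m.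
Proof. by symmetry; rewrite [LHS]fadd_pi; apply/fpi_eq; rewrite /frac_eq /=; ring. Qed.

Lemma fnatM n m : fnat (n * m) = fnat n * fnat m.
Proof. by symmetry; rewrite [LHS]fmul_pi; apply/fpi_eq; rewrite /frac_eq /=; ring. Qed.

Lemma fnat0 : fnat 0 = 0 :> fraction M.
Proof. by []. Qed.

Lemma fnat1 : fnat 1 = 1 :> fraction M.
Proof. by []. Qed.

Lemma fnat_le n m : (fnat n <= fnat m) = (n <^ m + 1).
Proof.
rewrite -[LHS]/(fle _ _) /fle fopp_pi fadd_pi fnonneg_pi /=.
by rewrite !mulr1 add0r addr0 nn_ltS.
Qed.

Lemma fnat_lt n m : (fnat n < fnat m) = (n <^ m).
Proof. by rewrite ltNge fnat_le nn_ltS -ltNge. Qed.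

Lemma fnat_inj : injective (@fnat M).
Proof.
by move=> n m e; apply: le_anti; rewrite -!nn_ltS -!fnat_le e lexx.
Qed.

Lemma fnat_ge0 n : 0 <= fnat n.
Proof. by rewrite -fnat0 fnat_le nn_ltS nn_ge0. Qed.

Lemma fnat_leS n m : n <^ m -> fnat n + 1 <= fnat m.
Proof. by rewrite -nn_leS -nn_ltS -fnat_le fnatD. Qed.

Lemma fnat_le_hyp n m : n <=^ m -> fnat n <= fnat m.
Proof. by rewrite fnat_le nn_ltS. Qed.

Lemma fnat_le_goal n m : fnat n < fnat m + 1 -> n <=^ m.
Proof. by rewrite -fnat1 -fnatD fnat_lt nn_ltS. Qed.

Lemma fraction_form a : exists p m d : nn M, 0 <^ d /\ a = (fnat p - fnat m) / fnat d.
Proof.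
elim/fraction_ind: a => -[p m d d0]; exists p, m, d; split=> //.
have d0' : fnat d != 0 by rewrite gt_eqF // -fnat0 fnat_lt.
apply: (mulIf d0'); rewrite mulfVK //.
have -> : fnat p - fnat m = fadd (fpi (nn_frac p)) (fopp (fpi (nn_frac m))) by [].
rewrite [LHS]fmul_pi fopp_pi fadd_pi; apply/fpi_eq; rewrite /frac_eq /=; ring.
Qed.

End EmbedNat.

#[global] Opaque fadd fopp fmul finv fle fnorm fnat nn_sub nn_pred.

Ltac fnat_facts :=
  repeat match goal with
  | |- context [@fnat ?M ?x] =>
      lazymatch goal with
      | _ : is_true (0 <= @fnat M x) |- _ => fail
      | _ => have := fnat_ge0 x; move=> ?
      end
  | _ : context [@fnat ?M ?x] |- _ =>
      lazymatch goal with
      | _ : is_true (0 <= @fnat M x) |- _ => fail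
      | _ => have := fnat_ge0 x; move=> ?
      end
  end.

(** Moves (in)equalities between naturals of the model to the ordered field of
    fractions, keeping track of discreteness. *)
Ltac is_nn x :=
  let T := type of x in
  lazymatch eval hnf in T with
  | @sig _ _ => fail
  | _ => idtac
  end.

Ltac nn_to_frac :=
  repeat match goal with
  | H : is_true (@Order.lt _ _ ?a _) |- _ => is_nn a; move/fnat_leS in H
  | H : is_true (@Order.le _ _ ?a _) |- _ => is_nn a; move/fnat_le_hyp in H
  | H : @eq _ ?a _ |- _ => is_nn a; move/(congr1 (@fnat _)) in H
  end;
  first [ rewrite -fnat_lt | apply: fnat_le_goal | apply: fnat_inj | idtac ];
  repeat match goal with
  | H : _ |- _ => rewrite !(fnatD, fnatM, fnat0, fnat1) in H
  end;
  rewrite ?(fnatD, fnatM, fnat0, fnat1);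
  fnat_facts.

Ltac nn_lra := nn_to_frac; lra.

(** * Decidable predicates *)

Section Decidable.

Variable M : model.
Implicit Types (x y n m k : nn M) (G : list ty).

Definition dec G (P : model_env M G -> Prop) : Prop :=
  exists2 c : model_env M G -> nn M, rep c & forall g, P g <-> c g = 0.

Definition cond (P : Prop) x y : nn M := if pselect P then x else y.

Lemma condT (P : Prop) x y : P -> cond P x y = x.
Proof. by rewrite /cond; case: pselect. Qed.

Lemma condF (P : Prop) x y : ~ P -> cond P x y = y.
Proof. by rewrite /cond; case: pselect. Qed.

Lemma cond_binary (P : Prop) : cond P 1 0 = 0 \/ cond P 1 0 = 1.
Proof. by rewrite /cond; case: pselect; [right|left]. Qed.

Lemma cond_eq1 (P : Prop) : cond P 1 0 = 1 <-> P.
Proof.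
rewrite /cond; case: pselect => h; split=> // /esym /eqP.
by rewrite oner_eq0.
Qed.

Definition nsg n : nn M := natrec 1 (fun _ _ => 0) n.

Lemma nsg0 : nsg 0 = 1.
Proof. exact: natrec0. Qed.

Lemma nsg_neq0 n : n <> 0 -> nsg n = 0.
Proof. by case: (nn_case n) => // -> _; rewrite /nsg natrecS //; rep_tac. Qed.

Lemma nsg_eq0 n : nsg n = 0 <-> n <> 0.
Proof.
split=> [e n0|]; last exact: nsg_neq0.
by move: e; rewrite n0 nsg0 => /eqP; rewrite oner_eq0.
Qed.

Lemma nn_mul_eq0 n m : n * m = 0 <-> n = 0 \/ m = 0.
Proof.
split=> [e|[->|->]]; rewrite ?mul0r ?mulr0 //.
case: (pselect (m = 0)) => [|/nn_gt0 m0]; [by right|left].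
by apply: (nn_mulIr m0); rewrite /= e mul0r.
Qed.

Lemma nn_add_eq0 n m : n + m = 0 <-> n = 0 /\ m = 0.
Proof.
split=> [e|[-> ->]]; last by rewrite addr0.
by split; apply: le_anti; rewrite nn_ge0 andbT -e ?nn_leDr // addrC nn_leDr.
Qed.

Lemma dec_equiv G (P Q : model_env M G -> Prop) :
  dec P -> (forall g, P g <-> Q g) -> dec Q.
Proof. by case=> c hc cP PQ; exists c => // g; rewrite -PQ. Qed.

(** A proposition independent of the environment has a constant characteristic function; excluded
    middle outside the model tells which one. *)
Lemma dec_const G (P : Prop) : dec (fun _ : model_env M G => P).
Proof.
case: (pselect P) => h; [exists (fun _ => 0)|exists (fun _ => 1)]; try exact: rep_const.
- by split.
- by split=> // /eqP; rewrite oner_eq0.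
Qed.

Lemma dec_imp G (P Q : model_env M G -> Prop) :
  dec P -> dec Q -> dec (fun g => P g -> Q g).
Proof.
case=> c hc cP [d hd dQ]; exists (fun g => nsg (c g) * d g).
  by apply: rep_mul => //; rewrite /nsg; apply: rep_natrec => //; rep_tac.
move=> g; rewrite nn_mul_eq0 nsg_eq0 cP dQ; split=> [h|[h|h] //].
by case: (pselect (c g = 0)) => [/h|]; [right|left].
Qed.

Lemma dec_not G (P : model_env M G -> Prop) : dec P -> dec (fun g => ~ P g).
Proof. by move=> h; apply: dec_imp => //; apply: dec_const. Qed.

Lemma dec_and G (P Q : model_env M G -> Prop) :
  dec P -> dec Q -> dec (fun g => P g /\ Q g).
Proof.
case=> c hc cP [d hd dQ]; exists (fun g => c g + d g); first exact: rep_add.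
by move=> g; rewrite nn_add_eq0 cP dQ.
Qed.

Lemma dec_or G (P Q : model_env M G -> Prop) :
  dec P -> dec Q -> dec (fun g => P g \/ Q g).
Proof.
case=> c hc cP [d hd dQ]; exists (fun g => c g * d g); first exact: rep_mul.
by move=> g; rewrite nn_mul_eq0 cP dQ.
Qed.

Lemma dec_iff G (P Q : model_env M G -> Prop) :
  dec P -> dec Q -> dec (fun g => P g <-> Q g).
Proof. by move=> hP hQ; apply: dec_and; apply: dec_imp. Qed.

Lemma dec_le G (a b : model_env M G -> nn M) :
  rep a -> rep b -> dec (fun g => a g <=^ b g).
Proof.
move=> ha hb; exists (fun g => nn_sub (a g) (b g)); first exact: rep_sub.
by move=> g; apply: nn_subE.
Qed.

Lemma dec_lt G (a b : model_env M G -> nn M) :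
  rep a -> rep b -> dec (fun g => a g <^ b g).
Proof.
move=> ha hb; apply: (@dec_equiv _ (fun g => a g + 1 <=^ b g)).
  by apply: dec_le => //; apply: rep_add => //; apply: rep_const.
by move=> g; rewrite nn_leS.
Qed.

Lemma dec_eq G (a b : model_env M G -> nn M) :
  rep a -> rep b -> dec (fun g => a g = b g).
Proof.
move=> ha hb; apply: (@dec_equiv _ (fun g => (a g <=^ b g) /\ (b g <=^ a g))).
  by apply: dec_and; apply: dec_le.
by move=> g; split=> [[h1 h2]|->]; [apply: le_anti; rewrite h1 h2|].
Qed.

Lemma rep_cond G (P : model_env M G -> Prop) a b :
  dec P -> rep a -> rep b -> rep (fun g => cond (P g) (a g) (b g)).
Proof.
case=> c hc cP ha hb.
have h : rep (fun g => nsg (c g) * a g + nsg (nsg (c g)) * b g).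
  by apply: rep_add; apply: rep_mul => //; rewrite /nsg; repeat (apply: rep_natrec => //);
    rep_tac.
apply: rep_ext h => g; case: (pselect (P g)) => h.
  rewrite condT // (iffLR (cP g) h).
  by rewrite nsg0 mul1r nsg_neq0 ?mul0r ?addr0 // => /eqP; rewrite oner_eq0.
have h' : c g <> 0 by move=> /cP.
by rewrite condF // (nsg_neq0 h') nsg0 mul0r mul1r add0r.
Qed.

Lemma rep_comp G s t (e : dom M s -> dom M t) (a : model_env M G -> dom M s) :
  rep (fun g : model_env M [:: s] => e (hd g)) -> rep a -> rep (fun g => e (a g)).
Proof.
move=> [F hF] ha.
apply: (@rep_ext _ _ _ (fun g => sap F (a g))) => [g|]; first exact: (hF (tt, a g)).
by apply: rep_app => //; apply: rep_const.
Qed.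

Lemma dec_comp G s (P : dom M s -> Prop) (a : model_env M G -> dom M s) :
  dec (fun g : model_env M [:: s] => P (hd g)) -> rep a -> dec (fun g => P (a g)).
Proof.
case=> c hc cP ha; exists (fun g => c (tt, a g)); last by move=> g; apply: (cP (tt, a g)).
by apply: (@rep_comp G s N (fun x : dom M s => c (tt, x)) a) => //; apply: rep_ext hc => -[[] x].
Qed.

Lemma nn_ind (P : nn M -> Prop) :
  dec (fun g : model_env M [:: N] => P (hd g)) ->
  P 0 -> (forall n, P n -> P (n + 1)) -> forall n, P n.
Proof.
case=> c hc cP P0 PS n; have cE m : P m <-> c (tt, m) = 0 := cP (tt, m).
apply/cE; move: n; apply: (eq_ind_fun (f := fun n => c (tt, n)) (g := fun _ => 0)).
- by apply: rep_ext hc => -[[] x].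
- exact: rep_const.
- exact/cE.
- by move=> m /cE /PS /cE.
Qed.

(** A bounded universal statement says that the sum of the characteristic function over the range
    vanishes. *)
Lemma dec_ball G (P : model_env M G -> nn M -> Prop) (b : model_env M G -> nn M) :
  dec (fun g : model_env M (N :: G) => P (tl g) (hd g)) -> rep b ->
  dec (fun g => forall x, x <^ b g -> P g x).
Proof.
case=> c hc cP hb; exists (fun g => natrec 0 (fun i r => r + c (g, i)) (b g)).
  apply: rep_natrec => //; first exact: rep_const.
  apply: rep_add; first by rep_tac.
  have [F hF] := hc; have [A hA] := rep_const G F.
  have h : rep (fun g : model_env M [:: N, N & G] => sap (sapn (G := G) (t := Arr N N) F (tl (tl g))) (hd (tl g))).
    apply: rep_app; last by rep_tac.
    apply: (@rep_weak _ _ _ _ (fun g : model_env M (N :: G) => sapn (G := G) (t := Arr N N) F (tl g))).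
    by apply: rep_weak; exists F.
  by apply: rep_ext h => -[[g i] r]; exact: (hF (g, i)).
move=> g; set S := natrec 0 _.
have rc : rep (fun h : model_env M [:: N] => c (g, hd h)).
  by have [F hF] := hc; exists (sapn (G := G) (t := Arr N N) F g) => -[[] x]; exact: (hF (g, x)).
have rS : rep (fun h : model_env M [:: N] => S (hd h)).
  apply: rep_natrec; [exact: rep_const|by rep_tac|].
  apply: rep_add; first by rep_tac.
  apply: (rep_comp (e := fun x => c (g, x)) (a := fun h : model_env M [:: N; N; N] => hd (tl h))) => //.
  by rep_tac.
have SS i : S (i + 1) = S i + c (g, i).
  rewrite /S natrecS //; apply: rep_add; first by rep_tac.
  apply: (rep_comp (e := fun x => c (g, x)) (a := fun h : model_env M [:: N; N] => hd (tl h))) => //.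
  by rep_tac.
have cE i : P g i <-> c (g, i) = 0 := cP (g, i).
move: (b g) => n; split=> [h|e i].
  suff : forall m, m <=^ n -> S m = 0 by apply.
  apply: nn_ind => [|_|m IH lemn]; last 2 first.
  - exact: natrec0.
  - rewrite SS; apply/nn_add_eq0; split.
      by apply: IH; apply: le_trans lemn; apply: nn_leDr.
    by apply/cE; apply: h; rewrite -nn_leS.
  apply: dec_imp; first by apply: dec_le; rep_tac.
  by apply: dec_eq => //; apply: rep_const.
rewrite -nn_leS => /nn_le_exists [z ez]; apply/cE.
suff : c (g, i) <=^ S n by rewrite e => h; apply: le_anti; rewrite h nn_ge0.
rewrite {}ez in e *; move: z {e}; apply: nn_ind.
- apply: dec_le; first exact: rep_const.
  by apply: (rep_comp (e := S)) => //; rep_tac.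
- by rewrite addr0 SS addrC nn_leDr.
- by move=> z IH; rewrite addrA SS; apply: le_trans (nn_leDr _ _).
Qed.

Lemma dec_bex G (P : model_env M G -> nn M -> Prop) (b : model_env M G -> nn M) :
  dec (fun g : model_env M (N :: G) => P (tl g) (hd g)) -> rep b ->
  dec (fun g => exists x, (x <^ b g) /\ P g x).
Proof.
move=> hP hb; apply: (@dec_equiv _ (fun g => ~ forall x, x <^ b g -> ~ P g x)).
  apply: dec_not; apply: (dec_ball (P := fun g x => ~ P g x)) => //.
  exact: dec_not.
move=> g; split=> [h|[x [xb px]] h]; last exact: h px.
by apply: contrapT => n; apply: h => x xb px; apply: n; exists x.
Qed.

End Decidable.

Ltac rep_more ::=
  lazymatch goal with
  | |- rep _ => first [apply: rep_cond | apply: rep_sub | apply: rep_pred | apply: rep_natrec]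
  | |- dec _ => first
      [ match goal with |- dec (fun _ => ?P) => exact: (dec_const _ P) end
      | assumption
      | apply: dec_ball | apply: dec_bex | apply: dec_iff
      | apply: dec_and | apply: dec_or | apply: dec_not | apply: dec_imp
      | apply: dec_lt | apply: dec_le | apply: dec_eq ]
  end.

Section Search.

Variable M : model.
Implicit Types (n m b : nn M).

(** The least [n < b] with [P n], or [b] if there is none. *)
Definition bmin (P : nn M -> Prop) b : nn M :=
  natrec 0 (fun i r => cond (r = i /\ ~ P i) (i + 1) r) b.

Lemma rep_bmin G (P : model_env M G -> nn M -> Prop) (b : model_env M G -> nn M) :
  dec (fun g : model_env M (N :: G) => P (tl g) (hd g)) -> rep b ->
  rep (fun g => bmin (P g) (b g)).
Proof.
move=> hP hb; rewrite /bmin; apply: rep_natrec => //; first exact: rep_const.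
apply: rep_cond; [|by rep_tac|by rep_tac].
apply: dec_and; first by rep_tac.
apply: dec_not; case: hP => c hc cP.
exists (fun g => c (tl (tl g), hd (tl g))); last by move=> g; apply: (cP (tl (tl g), hd (tl g))).
have h := @rep_weak _ _ N _ _ hc.
by apply: rep_ext h => -[[g i] r].
Qed.

Variable P : nn M -> Prop.
Hypothesis P_dec : dec (fun g : model_env M [:: N] => P (hd g)).

Lemma bmin0 : bmin P 0 = 0.
Proof. exact: natrec0. Qed.

Lemma bminS b : bmin P (b + 1) = cond (bmin P b = b /\ ~ P b) (b + 1) (bmin P b).
Proof.
rewrite /bmin natrecS //; apply: rep_cond; [|by rep_tac|by rep_tac].
apply: dec_and; first by rep_tac.
by apply: dec_not; apply: (dec_comp (P := P)) => //; rep_tac.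
Qed.

Lemma bmin_spec b : [/\ bmin P b <=^ b, forall n, n <^ bmin P b -> ~ P n
  & bmin P b <^ b -> P (bmin P b)].
Proof.
suff : (bmin P b <=^ b) /\ (forall n, n <^ bmin P b -> ~ P n)
    /\ (bmin P b <^ b -> P (bmin P b)) by case=> ? [].
have rP G (a : model_env M G -> nn M) : rep a -> dec (fun g => P (a g)).
  by apply: (dec_comp (P := P)).
have rb : rep (fun g : model_env M [:: N] => bmin P (hd g)).
  by apply: (rep_bmin (P := fun _ => P)); [apply: rP|]; rep_tac.
have rb' G (a : model_env M G -> nn M) : rep a -> rep (fun g => bmin P (a g)).
  by apply: (rep_comp (e := bmin P)).
move: b; apply: nn_ind.
- apply: dec_and; first by apply: dec_le => //; rep_tac.
  apply: dec_and.
    by apply: dec_ball => //; apply: dec_not; apply: rP; rep_tac.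
  by apply: dec_imp; [apply: dec_lt => //; rep_tac|apply: rP].
- rewrite bmin0; split=> //; split=> [n|]; by rewrite nn_lt0.
move=> b [h1 [h2 h3]]; rewrite bminS.
case: (pselect (bmin P b = b /\ ~ P b)) => h; [rewrite condT //|rewrite condF //].
  have [e nP] := h; split=> //; split=> [n|]; last by rewrite ltxx.
  by rewrite nn_ltS le_eqVlt => /orP [/eqP -> //|]; rewrite -{1}e; apply: h2.
split; first by apply: le_trans h1 _; apply: nn_leDr.
split=> // _; case: (pselect (bmin P b = b)) => [e|ne].
  by rewrite e; apply: contrapT => nP; case: h.
by apply: h3; rewrite lt_neqAle h1 andbT; apply/eqP.
Qed.

Lemma bmin_P b n : n <^ b -> P n -> P (bmin P b).
Proof.
move=> nb Pn; have [h1 h2 h3] := bmin_spec b; apply: h3.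
rewrite ltNge; apply/negP => h; apply: h2 Pn; exact: lt_le_trans nb h.
Qed.

Lemma nn_least n : P n -> exists m, P m /\ forall k, k <^ m -> ~ P k.
Proof.
move=> Pn; exists (bmin P (n + 1)); split; first exact: bmin_P (nn_ltxS n) Pn.
by have [_ h _] := bmin_spec (n + 1).
Qed.

End Search.

#[global] Opaque bmin cond nsg.

(** * Pairing *)

Section Pairing.

Variable M : model.
Implicit Types (a b c n m s : nn M).

Lemma rep_comp2 G (r s t : ty) (f : dom M r -> dom M s -> dom M t) x y :
  rep (fun g : model_env M [:: s; r] => f (hd (tl g)) (hd g)) ->
  rep x -> rep y -> rep (fun g : model_env M G => f (x g) (y g)).
Proof.
move=> [F hF] hx hy; have h : rep (fun g : model_env M G => sap (sap F (x g)) (y g)).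
  by apply: rep_app => //; apply: rep_app => //; apply: rep_const.
by apply: rep_ext h => g; apply: (hF (tt, x g, y g)).
Qed.

Lemma dec_comp2 G (r s : ty) (P : dom M r -> dom M s -> Prop) x y :
  dec (fun g : model_env M [:: s; r] => P (hd (tl g)) (hd g)) ->
  rep x -> rep y -> dec (fun g : model_env M G => P (x g) (y g)).
Proof.
case=> c hc cP hx hy; exists (fun g => c (tt, x g, y g)).
  apply: (@rep_comp2 G r s N (fun (u : dom M r) (v : dom M s) => c (tt, u, v))) => //.
  by apply: rep_ext hc => -[[[] u] v].
by move=> g; apply: (cP (tt, x g, y g)).
Qed.

Definition tri s : nn M := natrec 0 (fun i r => r + (i + 1)) s.

Lemma triS s : tri (s + 1) = tri s + (s + 1).
Proof. by rewrite /tri natrecS //; rep_tac. Qed.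

Lemma triE s : tri s + tri s = s * (s + 1).
Proof.
move: s; apply: nn_ind => [||s IH]; first by rewrite /tri; rep_tac.
- by rewrite /tri natrec0 mul0r addr0.
- by rewrite triS; nn_lra.
Qed.

Definition npair a b : nn M := tri (a + b) + b.

(** The doubled form, which avoids halving, is the one used by [is_pair]. *)
Lemma npairE a b : npair a b + npair a b = (a + b) * ((a + b) + 1) + (b + b).
Proof. by rewrite /npair; have := triE (a + b); move: (tri _) => t h; nn_lra. Qed.

Lemma npair_inj a b a' b' : npair a b = npair a' b' -> a = a' /\ b = b'.
Proof.
move=> e; have := npairE a b; rewrite e npairE => {}e.
have lt c d c' d' : c + d <^ c' + d' ->
    (c + d) * ((c + d) + 1) + (d + d) <> (c' + d') * ((c' + d') + 1) + (d' + d').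
  move=> h /(congr1 (@fnat M)); move/fnat_leS: h; rewrite !(fnatD, fnatM, fnat1).
  have := fnat_ge0 c; have := fnat_ge0 d; have := fnat_ge0 d'.
  move: (fnat c) (fnat d) (fnat c') (fnat d') => x y x' y' y'0 y0 x0 h e'.
  (* With s = x + y, the doubled code s(s + 1) + 2y lies below (s + 1)(s + 2), where the codes on
     the next diagonal begin. *)
  have : (x + y + 1) * (x + y + 2) <= (x' + y') * (x' + y' + 1) by apply: ler_pM; lra.
  by lra.
case: (ltgtP (a + b) (a' + b')) => [/lt|/lt|es] //; first by move=> /(_ (esym e)).
have eb : b = b' by rewrite es in e; nn_lra.
by split=> //; rewrite eb in es; exact: nn_addIr es.
Qed.

Lemma rep_npair0 : rep (fun g : model_env M [:: N; N] => npair (hd (tl g)) (hd g)).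
Proof. by rewrite /npair /tri; rep_tac. Qed.

Lemma npair_gt a b : (a <^ npair a b + 1) /\ (b <^ npair a b + 1).
Proof.
have := npairE a b; move: (npair a b) => c /(congr1 (@fnat M)).
rewrite -!fnat_lt !(fnatD, fnatM, fnat1); have := fnat_ge0 a; have := fnat_ge0 b.
move: (fnat a) (fnat b) => x y y0 x0 h.
have : 0 <= (x + y) * (x + y - 1) \/ x + y < 1.
  by case: (leP 1 (x + y)) => h'; [left; apply: mulr_ge0; lra|right].
have : 0 <= (x + y) * (x + y + 1) by apply: mulr_ge0; lra.
by move=> h1; case=> h2; split; lra.
Qed.

(** Induction along the diagonals: (a + 1, b) is followed by (a, b + 1), and (0, b) by (b + 1, 0).
    The bounds on a and b make the statement decidable. *)
Lemma npair_surj c : exists a, (a <^ c + 1) /\ exists b, (b <^ c + 1) /\ c = npair a b.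
Proof.
move: c; apply: nn_ind => [||c [a [_ [b [_ ->]]]]].
- apply: dec_bex; last by rep_tac.
  apply: dec_bex; last by rep_tac.
  apply: dec_eq; first by rep_tac.
  by apply: (rep_comp2 rep_npair0); rep_tac.
- exists 0; split; first exact: nn_ltxS.
  exists 0; split; first exact: nn_ltxS.
  by rewrite /npair !addr0 /tri natrec0.
suff [a' [b' e]] : exists a' b', npair a b + 1 = npair a' b'.
  exists a'; have [h1 h2] := npair_gt a' b'; split; first by rewrite e.
  by exists b'; split; rewrite e.
case: (nn_case a) => ->; last first.
  exists (nn_pred a), (b + 1); rewrite /npair; move: (nn_pred a) => {}a.
  have -> : a + 1 + b = a + (b + 1) by ring.
  by rewrite [RHS]addrA.
by exists (b + 1), 0; rewrite /npair add0r !addr0 triS addrA.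
Qed.

Definition nfst c : nn M :=
  bmin (fun a => exists b, (b <^ c + 1) /\ c = npair a b) (c + 1).
Definition nsnd c : nn M := bmin (fun b => c = npair (nfst c) b) (c + 1).

Lemma rep_nfst0 : rep (fun g : model_env M [:: N] => nfst (hd g)).
Proof.
apply: rep_bmin; last by rep_tac.
apply: dec_bex; last by rep_tac.
apply: dec_eq; first by rep_tac.
by apply: (rep_comp2 rep_npair0); rep_tac.
Qed.

Lemma rep_nsnd0 : rep (fun g : model_env M [:: N] => nsnd (hd g)).
Proof.
apply: rep_bmin; last by rep_tac.
apply: dec_eq; first by rep_tac.
apply: (rep_comp2 rep_npair0); last by rep_tac.
by apply: (rep_comp rep_nfst0); rep_tac.
Qed.

Lemma npair_eta c : npair (nfst c) (nsnd c) = c.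
Proof.
have [a [ha [b [hb e]]]] := npair_surj c.
have [||b' [hb' e']] := @bmin_P M (fun a => exists b, (b <^ c + 1) /\ c = npair a b) _ (c + 1) a ha.
- apply: dec_bex; last by rep_tac.
  by apply: dec_eq; [|apply: (rep_comp2 rep_npair0)]; rep_tac.
- by exists b.
symmetry; apply: (@bmin_P M (fun b => c = npair (nfst c) b) _ _ b' hb') => //.
by apply: dec_eq; [|apply: (rep_comp2 rep_npair0)]; rep_tac.
Qed.

Lemma nfst_pair a b : nfst (npair a b) = a.
Proof. by have [] := npair_inj (npair_eta (npair a b)). Qed.

Lemma nsnd_pair a b : nsnd (npair a b) = b.
Proof. by have [] := npair_inj (npair_eta (npair a b)). Qed.

End Pairing.

(** * Powers of two *)

Section PowersOfTwo.

Variable M : model.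
Implicit Types (n m k : nn M) (e : fraction M).

Definition npow2 n : nn M := natrec 1 (fun _ r => r + r) n.

Lemma rep_npow20 : rep (fun g : model_env M [:: N] => npow2 (hd g)).
Proof. by rewrite /npow2; rep_tac. Qed.

Lemma npow2E n : npow2 n = natrec 1 (fun _ r => r + r) n.
Proof. by []. Qed.

Lemma npow2_0 : npow2 0 = 1.
Proof. exact: natrec0. Qed.

Lemma npow2_S n : npow2 (n + 1) = npow2 n + npow2 n.
Proof. by rewrite /npow2 natrecS //; rep_tac. Qed.

Lemma npow2_D n m : npow2 (n + m) = npow2 n * npow2 m.
Proof.
move: m; apply: nn_ind => [||m IH].
- by apply: dec_eq; [apply: (rep_comp rep_npow20)|apply: rep_mul;
    first exact: rep_const; apply: (rep_comp rep_npow20)]; rep_tac.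
- by rewrite npow2_0 addr0 mulr1.
- by rewrite addrA !npow2_S IH mulrDr.
Qed.

Lemma npow2_gt n : n <^ npow2 n.
Proof.
move: n; apply: nn_ind => [||n IH].
- by apply: dec_lt; [|apply: (rep_comp rep_npow20)]; rep_tac.
- by rewrite npow2_0; nn_lra.
- by rewrite npow2_S; nn_lra.
Qed.

Lemma npow2_gt0 n : 0 <^ npow2 n.
Proof. by apply: le_lt_trans (npow2_gt n); apply: nn_ge0. Qed.

Definition ip n : fraction M := (fnat (npow2 n))^-1.

Lemma fnpow2_gt0 n : 0 < fnat (npow2 n).
Proof. by rewrite -fnat0 fnat_lt npow2_gt0. Qed.

Lemma fnpow2_neq0 n : fnat (npow2 n) != 0.
Proof. by rewrite gt_eqF // fnpow2_gt0. Qed.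

Lemma ip_gt0 n : 0 < ip n.
Proof. by rewrite invr_gt0 fnpow2_gt0. Qed.

Lemma ip_0 : ip 0 = 1.
Proof. by rewrite /ip npow2_0 fnat1 invr1. Qed.

Lemma ip_S n : ip (n + 1) = ip n / 2.
Proof.
have := fnpow2_gt0 n; rewrite /ip npow2_S fnatD; move: (fnat _) => x x0.
by field; rewrite !gt_eqF //; lra.
Qed.

Lemma ip_D n m : ip (n + m) = ip n * ip m.
Proof. by rewrite /ip npow2_D fnatM invfM. Qed.

Lemma ip_half n : ip n = ip (n + 1) + ip (n + 1).
Proof. by rewrite ip_S; field. Qed.

Lemma ip_le1 n : ip n <= 1.
Proof.
rewrite invf_le1 ?fnpow2_gt0 // -fnat1 fnat_le nn_ltS.
by have := npow2_gt0 n; rewrite -nn_leS add0r.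
Qed.

Lemma ip_le n m : n <=^ m -> ip m <= ip n.
Proof.
move=> /nn_le_exists [z ->]; rewrite ip_D; have := ip_le1 z; have := ip_gt0 n; nra.
Qed.

Lemma ip_mul n : ip n * fnat (npow2 n) = 1.
Proof. by rewrite mulVf ?fnpow2_neq0. Qed.

(** The fractions are Archimedean relative to the numbers of the model: a positive (p - m) / d is at
    least 1 / d, and d is less than 2 ^ d. *)
Lemma ip_small e : 0 < e -> exists n, ip n < e.
Proof.
have [p [m [d [d0 ->]]]] := fraction_form e => e0; exists d.
have fd0 : 0 < fnat d by rewrite -fnat0 fnat_lt.
have pm : 1 <= fnat p - fnat m.
  have : fnat m < fnat p by move: e0; rewrite pmulr_lgt0 ?invr_gt0 // subr_gt0.
  by rewrite fnat_lt => /fnat_leS; lra.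
apply: (@lt_le_trans _ _ (fnat d)^-1).
  by rewrite /ip ltf_pV2 ?posrE ?fnpow2_gt0 // fnat_lt npow2_gt.
by rewrite -[X in X <= _]mul1r ler_pM2r // invr_gt0.
Qed.

Lemma ip_le_all (a b c : fraction M) : 0 <= c -> (forall n, a <= b + c * ip n) -> a <= b.
Proof.
move=> c0 h; rewrite leNgt; apply/negP => ba.
have [n hn] : exists n, ip n < (a - b) / (c + 1).
  by apply: ip_small; apply: divr_gt0; lra.
have := h n; have := ip_gt0 n.
rewrite ltr_pdivlMr in hn; last by lra.
by nra.
Qed.

Lemma ip_le_all1 (a b : fraction M) : (forall n, a <= b + ip n) -> a <= b.
Proof. by move=> h; apply: (@ip_le_all a b 1) => [|n]; [apply: ler01|rewrite mul1r]. Qed.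

End PowersOfTwo.

(** * Codes of fractions *)

Lemma ltr_divs (R : realFieldType) (x y u v : R) :
  0 < u -> 0 < v -> (x / u < y / v) = (x * v < y * u).
Proof. by move=> u0 v0; rewrite ltr_pdivrMr // mulrAC ltr_pdivlMr. Qed.

Lemma ler_divs (R : realFieldType) (x y u v : R) :
  0 < u -> 0 < v -> (x / u <= y / v) = (x * v <= y * u).
Proof. by move=> u0 v0; rewrite ler_pdivrMr // mulrAC ler_pdivlMr. Qed.

Section Codes.

Variable M : model.
Implicit Types (G : list ty) (p m d c n : nn M).

Definition qval c : fraction M :=
  (fnat (nfst (nfst c)) - fnat (nsnd (nfst c))) / fnat (nsnd c + 1).

Lemma qvalE c : qval c =
  (fnat (nfst (nfst c)) - fnat (nsnd (nfst c))) / fnat (nsnd c + 1).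
Proof. by []. Qed.

Definition qcode p m d : nn M := npair (npair p m) (nn_pred d).

Lemma qval_code p m d : 0 <^ d -> qval (qcode p m d) = (fnat p - fnat m) / fnat d.
Proof.
rewrite /qval /qcode !nfst_pair !nsnd_pair => d0; congr (_ / fnat _).
by case: (nn_case d) d0 => ->; rewrite ?ltxx // nn_predS.
Qed.

Lemma rep_qcode G (p m d : model_env M G -> nn M) : rep p -> rep m -> rep d ->
  rep (fun g => qcode (p g) (m g) (d g)).
Proof.
move=> hp hm hd; apply: (rep_comp2 (@rep_npair0 M)); last exact: rep_pred.
exact: (rep_comp2 (@rep_npair0 M)).
Qed.

(** Fractions are classes and not elements of the model, so a function into them is represented by
    numerators and a positive denominator. *)
Definition repq G (e : model_env M G -> fraction M) : Prop :=
  exists p m d : model_env M G -> nn M, [/\ rep p, rep m, rep d, (forall g, 0 <^ d g)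
    & forall g, e g = (fnat (p g) - fnat (m g)) / fnat (d g)].

Lemma fnat_gt0 d : 0 <^ d -> 0 < fnat d.
Proof. by rewrite -fnat_lt. Qed.

Lemma repq_code G (e : model_env M G -> fraction M) : repq e ->
  exists c : model_env M G -> nn M, rep c /\ forall g, qval (c g) = e g.
Proof.
move=> [p [m [d [hp hm hd d0 E]]]]; exists (fun g => qcode (p g) (m g) (d g)).
split; last by move=> g; rewrite qval_code.
apply: (rep_comp2 (@rep_npair0 M)); last by apply: rep_pred.
exact: (rep_comp2 (@rep_npair0 M)).
Qed.

Lemma repq_qval G (c : model_env M G -> nn M) : rep c -> repq (fun g : model_env M G => qval (c g)).
Proof.
move=> hc; exists (fun g => nfst (nfst (c g))), (fun g => nsnd (nfst (c g))),
  (fun g => nsnd (c g) + 1); split=> //.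
- by do 2!apply: (rep_comp (@rep_nfst0 M)).
- by apply: (rep_comp (@rep_nsnd0 M)); apply: (rep_comp (@rep_nfst0 M)).
- by apply: rep_add; [apply: (rep_comp (@rep_nsnd0 M))|apply: rep_const].
- by move=> g; nn_lra.
Qed.

Lemma repq_nat G (c : model_env M G -> nn M) : rep c -> repq (fun g : model_env M G => fnat (c g)).
Proof.
move=> hc; exists c, (fun _ => 0), (fun _ => 1); split=> //; try exact: rep_const.
- by move=> _; nn_lra.
- by move=> g; rewrite fnat0 fnat1 subr0 divr1.
Qed.

Lemma repq_const G (q : fraction M) : repq (fun _ : model_env M G => q).
Proof.
have [p [m [d [d0 ->]]]] := fraction_form q.
by exists (fun _ => p), (fun _ => m), (fun _ => d); split=> //; apply: rep_const.
Qed.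

Lemma repq_ip G (c : model_env M G -> nn M) : rep c -> repq (fun g : model_env M G => ip (c g)).
Proof.
move=> hc; exists (fun _ => 1), (fun _ => 0), (fun g => npow2 (c g)).
split; try exact: rep_const.
- exact: (rep_comp (@rep_npow20 M)).
- by move=> g; apply: npow2_gt0.
- by move=> g; rewrite fnat0 fnat1 subr0 div1r.
Qed.

Lemma repq_opp G (a : model_env M G -> fraction M) : repq a -> repq (fun g => - a g).
Proof.
move=> [p [m [d [hp hm hd d0 E]]]]; exists m, p, d; split=> // g.
by rewrite E -mulNr opprB.
Qed.

Lemma repq_add G (a b : model_env M G -> fraction M) :
  repq a -> repq b -> repq (fun g => a g + b g).
Proof.
move=> [p [m [d [hp hm hd d0 E]]]] [p' [m' [d' [hp' hm' hd' d0' E']]]].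
exists (fun g => p g * d' g + p' g * d g), (fun g => m g * d' g + m' g * d g),
  (fun g => d g * d' g); split.
1-3: by rep_tac.
- by move=> g; apply: nn_gt0M.
- move=> g; rewrite E E' !fnatD !fnatM.
  have := fnat_gt0 (d0 g); have := fnat_gt0 (d0' g) => h h'.
  by field; rewrite !gt_eqF.
Qed.

Lemma repq_mul G (a b : model_env M G -> fraction M) :
  repq a -> repq b -> repq (fun g => a g * b g).
Proof.
move=> [p [m [d [hp hm hd d0 E]]]] [p' [m' [d' [hp' hm' hd' d0' E']]]].
exists (fun g => p g * p' g + m g * m' g), (fun g => m g * p' g + p g * m' g),
  (fun g => d g * d' g); split.
1-3: by rep_tac.
- by move=> g; apply: nn_gt0M.
- move=> g; rewrite E E' !fnatD !fnatM.
  have := fnat_gt0 (d0 g); have := fnat_gt0 (d0' g) => h h'.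
  by field; rewrite !gt_eqF.
Qed.

Lemma dec_ltq G (a b : model_env M G -> fraction M) :
  repq a -> repq b -> dec (fun g => a g < b g).
Proof.
move=> [p [m [d [hp hm hd d0 E]]]] [p' [m' [d' [hp' hm' hd' d0' E']]]].
apply: (@dec_equiv _ _ (fun g => p g * d' g + m' g * d g <^ p' g * d g + m g * d' g)).
  by rep_tac.
move=> g; rewrite E E' (ltr_divs _ _ (fnat_gt0 (d0 g)) (fnat_gt0 (d0' g))).
by rewrite -fnat_lt !fnatD !fnatM; split; lra.
Qed.

Lemma dec_leq G (a b : model_env M G -> fraction M) :
  repq a -> repq b -> dec (fun g => a g <= b g).
Proof.
move=> ha hb; apply: (@dec_equiv _ _ (fun g => ~ (b g < a g))).
  by apply: dec_not; apply: dec_ltq.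
by move=> g; split=> [/negP|h]; [rewrite -leNgt|apply/negP; rewrite -leNgt].
Qed.

End Codes.

(** The orders on numbers and on fractions are told apart by unfolding the carrier: only
    [fraction M] is a [sig] type. *)
Ltac rep_more ::=
  lazymatch goal with
  | |- rep _ => first
      [ apply: rep_cond | apply: rep_sub | apply: rep_pred | apply: rep_bmin
      | apply: (rep_comp2 (@rep_npair0 _)) | apply: (rep_comp (@rep_nfst0 _))
      | apply: rep_qcode | apply: (rep_comp (@rep_nsnd0 _)) | apply: (rep_comp (@rep_npow20 _))
      | apply: rep_natrec ]
  | |- repq (fun _ => ?q) => exact: (repq_const _ q)
  | |- repq (fun _ => Algebra.add _ _) => apply: repq_add
  | |- repq (fun _ => Algebra.opp _) => apply: repq_opp
  | |- repq (fun _ => GRing.mul _ _) => apply: repq_mul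
  | |- repq (fun _ => fnat _) => apply: repq_nat
  | |- repq (fun _ => ip _) => apply: repq_ip
  | |- repq (fun _ => qval _) => apply: repq_qval
  | |- repq _ => assumption
  | |- dec (fun _ => is_true (@Order.le _ ?T _ _)) =>
      lazymatch eval hnf in (Order.Preorder.sort T) with
      | @sig _ _ => apply: dec_leq
      | _ => apply: dec_le
      end
  | |- dec (fun _ => is_true (@Order.lt _ ?T _ _)) =>
      lazymatch eval hnf in (Order.Preorder.sort T) with
      | @sig _ _ => apply: dec_ltq
      | _ => apply: dec_lt
      end
  | |- dec _ => first
      [ match goal with |- dec (fun _ => ?P) => exact: (dec_const _ P) end
      | assumption
      | apply: dec_ball | apply: dec_bex | apply: dec_iff
      | apply: dec_and | apply: dec_or | apply: dec_not | apply: dec_imp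
      | apply: dec_eq ]
  end.

#[global] Opaque ip npow2 qval qcode npair nfst nsnd.

(** * Real numbers in a model *)

Section SemanticReals.

Variable M : model.

Implicit Types (n m k i : nn M) (X Y : nn M -> fraction M) (x y z : dom M ty1)
  (F A : dom M (Arr ty1 ty1)).

Definition rq x n : fraction M := qval (sap x n).

Definition Leq X Y : Prop := forall n, X n <= Y n + 2 * ip n.
Definition Eqr X Y : Prop := forall n, `|X n - Y n| <= 2 * ip n.
Definition Real x : Prop := forall n i, `|rq x n - rq x (n + i)| < ip n.
Definition Sub X Y : nn M -> fraction M := fun n => X (n + 1) - Y (n + 1).
Definition Abs X : nn M -> fraction M := fun n => `|X n|.

Definition In_unit x : Prop :=
  Real x /\ Leq (fun _ => 0) (rq x) /\ Leq (rq x) (fun _ => 1).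
Definition Fun_R F : Prop :=
  (forall x, Real x -> Real (sap F x)) /\
  (forall x y, Real x -> Real y -> Eqr (rq x) (rq y) ->
     Eqr (rq (sap F x)) (rq (sap F y))).
Definition Fun_unit F : Prop :=
  (forall x, In_unit x -> In_unit (sap F x)) /\
  (forall x y, In_unit x -> In_unit y -> Eqr (rq x) (rq y) ->
     Eqr (rq (sap F x)) (rq (sap F y))).
Definition Mem A x : Prop := Real x /\ ~ Leq (rq (sap A x)) (fun _ => 0).
Definition Subset_unit A : Prop := Fun_R A /\ forall x, Mem A x -> In_unit x.
Definition Mem_closed (a r x : dom M ty1) : Prop :=
  In_unit x /\ forall n, Leq (fun _ => rq r n) (Abs (Sub (rq x) (fun _ => rq a n))).

Definition Sup_exists (P : dom M ty1 -> Prop) F : Prop :=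
  exists y, Real y /\ (forall x, P x -> Leq (rq (sap F x)) (rq y)) /\
    forall k, exists x, P x /\ ~ Leq (rq (sap F x)) (Sub (rq y) (fun _ => ip k)).

Definition Sup_sets : Prop := forall A F, Subset_unit A -> (exists x, Mem A x) ->
  Fun_unit F -> Sup_exists (Mem A) F.
Definition Sup_closed : Prop := forall (a r : dom M ty1) F,
  (exists x, Mem_closed a r x) -> Fun_unit F -> Sup_exists (Mem_closed a r) F.

Definition Is_set x : Prop := forall n, slt (sap x n) 1 \/ seqv (sap x n) 1.
Definition Boot : Prop := forall Y : dom M (Arr ty1 (Arr N N)),
  exists x, Is_set x /\ forall n, seqv (sap x n) 1 <->
    exists f, seqv (sap (sap Y f) n) 0.

Definition Directed (D : dom M ty2) (P : dom M (Arr ty1 (Arr ty1 N))) : Prop :=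
  (forall d, slt (sap D d) 1 \/ seqv (sap D d) 1) /\
  (forall d e, slt (sap (sap P d) e) 1 \/ seqv (sap (sap P d) e) 1) /\
  (exists d, seqv (sap D d) 1) /\
  (forall d, seqv (sap D d) 1 -> seqv (sap (sap P d) d) 1) /\
  (forall c d e, seqv (sap D c) 1 -> seqv (sap D d) 1 -> seqv (sap D e) 1 ->
     seqv (sap (sap P c) d) 1 -> seqv (sap (sap P d) e) 1 -> seqv (sap (sap P c) e) 1) /\
  (forall d e, seqv (sap D d) 1 -> seqv (sap D e) 1 ->
     exists c, seqv (sap D c) 1 /\ seqv (sap (sap P d) c) 1 /\ seqv (sap (sap P e) c) 1).

Definition Increasing (D : dom M ty2) (P : dom M (Arr ty1 (Arr ty1 N))) F : Prop :=
  (forall d, seqv (sap D d) 1 -> In_unit (sap F d)) /\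
  (forall d e, seqv (sap D d) 1 -> seqv (sap D e) 1 -> seqv (sap (sap P d) e) 1 ->
     Leq (rq (sap F d)) (rq (sap F e))).

Definition Converges (D : dom M ty2) (P : dom M (Arr ty1 (Arr ty1 N))) F : Prop :=
  exists y, Real y /\ forall k, exists d, seqv (sap D d) 1 /\
    forall e, seqv (sap D e) 1 -> seqv (sap (sap P d) e) 1 ->
      ~ Leq (fun _ => ip k) (Abs (Sub (rq (sap F e)) (rq y))).

Definition Mct : Prop := forall D P F, Directed D P -> Increasing D P F -> Converges D P F.

End SemanticReals.

(** * Denotations of the principles *)

Section DenotationReals.

Variable M : model.
Implicit Types (c : ctx M).

Definition drat c (a : Defs.rat) (q : fraction M) : Prop :=
  exists p m d : nn M, [/\ dt c (pos a) p, dt c (neg a) m, dt c (Defs.den a) d, 0 <^ d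
    & q = (fnat p - fnat m) / fnat d].

Lemma drat_mono c c' a q : extends c c' -> drat c a q -> drat c' a q.
Proof.
by move=> cc [p [m [d [hp hm hd d0 ->]]]]; exists p, m, d; split=> //; apply: dt_mono cc _.
Qed.

Lemma dt_add c (a b : tm N) (x y : nn M) : dt c a x -> dt c b y ->
  dt c (Defs.app (Defs.app (con CPlus) a) b) (x + y).
Proof. by move=> ha hb; den. Qed.

Lemma dt_mul c (a b : tm N) (x y : nn M) : dt c a x -> dt c b y ->
  dt c (Defs.app (Defs.app (con CMult) a) b) (x * y).
Proof. by move=> ha hb; den. Qed.

Lemma dt_1 c : dt c (con COne) (1 : nn M).
Proof. by []. Qed.

Lemma df_nneq c (a b : tm N) (x y : nn M) : dt c a x -> dt c b y ->
  df c (feq a b) (x = y).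
Proof. by move=> ha hb; apply: df_equiv (m_eq _ _); apply: df_eq. Qed.

Lemma df_nnlt c (a b : tm N) (x y : nn M) : dt c a x -> dt c b y ->
  df c (flt a b) (x <^ y).
Proof. by move=> ha hb; apply: df_equiv (iff_sym (nn_ltE _ _)); apply: df_lt. Qed.

Lemma drat_add c a b x y : drat c a x -> drat c b y -> drat c (radd a b) (x + y).
Proof.
move=> [p [m [d [hp hm hd d0 ->]]]] [p' [m' [d' [hp' hm' hd' d0' ->]]]].
exists (p * d' + p' * d), (m * d' + m' * d), (d * d').
split; [by apply: dt_add; apply: dt_mul|by apply: dt_add; apply: dt_mul|exact: dt_mul|
  exact: nn_gt0M|].
rewrite !fnatD !fnatM; have := fnat_gt0 d0; have := fnat_gt0 d0' => h h'.
by field; rewrite !gt_eqF.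
Qed.

Lemma drat_opp c a x : drat c a x -> drat c (ropp a) (- x).
Proof.
by move=> [p [m [d [hp hm hd d0 ->]]]]; exists m, p, d; split=> //; rewrite -mulNr opprB.
Qed.

Lemma drat_sub c a b x y : drat c a x -> drat c b y -> drat c (rsub a b) (x - y).
Proof. by move=> ha hb; apply: drat_add => //; apply: drat_opp. Qed.

Lemma df_rlt c a b x y : drat c a x -> drat c b y -> df c (rlt a b) (x < y).
Proof.
move=> [p [m [d [hp hm hd d0 ->]]]] [p' [m' [d' [hp' hm' hd' d0' ->]]]].
apply: (@df_equiv _ _ _ (p * d' + m' * d <^ p' * d + m * d')).
  by apply: df_nnlt; apply: dt_add; apply: dt_mul.
rewrite (ltr_divs _ _ (fnat_gt0 d0) (fnat_gt0 d0')) -fnat_lt !fnatD !fnatM.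
by split; lra.
Qed.

Lemma df_rle c a b x y : drat c a x -> drat c b y -> df c (rle a b) (x <= y).
Proof.
move=> [p [m [d [hp hm hd d0 ->]]]] [p' [m' [d' [hp' hm' hd' d0' ->]]]].
apply: (@df_equiv _ _ _ ((p * d' + m' * d <^ p' * d + m * d') \/
    p * d' + m' * d = p' * d + m * d')).
  by apply: df_or; [apply: df_nnlt|apply: df_nneq]; apply: dt_add; apply: dt_mul.
rewrite (ler_divs _ _ (fnat_gt0 d0) (fnat_gt0 d0')).
split=> [[/fnat_leS|/(congr1 (@fnat M))]|h].
- by rewrite !(fnatD, fnatM); lra.
- by rewrite !(fnatD, fnatM); lra.
- case: (ltgtP (p * d' + m' * d) (p' * d + m * d')) => [|h'|]; [by left| |by right].
  by exfalso; move/fnat_leS: h'; rewrite !(fnatD, fnatM); lra.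
Qed.

(** Rationals reach formulas through continuations; such a continuation denotes a predicate of the
    value alone, whichever numerator and denominator present it. *)
Definition dcont c (K : Defs.rat -> fm) (P : fraction M -> Prop) : Prop :=
  forall c', extends c c' -> forall a q, drat c' a q -> df c' (K a) (P q).

Lemma dcont_mono c c' K P : extends c c' -> dcont c K P -> dcont c' K P.
Proof. by move=> cc h c'' /(extends_trans cc); apply: h. Qed.

Lemma df_rabs c a q K P : drat c a q -> dcont c K P -> df c (with_rabs a K) (P `|q|).
Proof.
move=> ha hK; have [p [m [d [hp hm hd d0 qE]]]] := ha.
apply: (@df_equiv _ _ _ (exists z, (p = m + z \/ m = p + z) /\
    P ((fnat z - fnat 0) / fnat d))).
  apply: df_ex => z c' cc x xz; apply: df_and.
    by apply: df_or; apply: df_nneq; try apply: dt_add => //; apply: dt_mono cc _.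
  apply: hK => //; exists z, 0, d; split=> //.
  exact: dt_mono cc _.
have fd0 := fnat_gt0 d0.
have absE (u v z : nn M) : u = v + z ->
    (fnat z - fnat 0) / fnat d = `|(fnat u - fnat v) / fnat d|.
  move=> ->; rewrite fnatD fnat0 subr0 addrAC subrr add0r ger0_norm //.
  by apply: divr_ge0; [apply: fnat_ge0|apply: ltW].
have absE' (u v z : nn M) : v = u + z ->
    (fnat z - fnat 0) / fnat d = `|(fnat u - fnat v) / fnat d|.
  by move=> /absE ->; rewrite -normrN -mulNr opprB.
rewrite qE; split=> [[z [[/absE|/absE'] ->]] //|h].
case: (leP m p) => [|/ltW] /nn_le_exists [z e]; exists z.
- by split; [left|rewrite (absE _ _ _ e)].
- by split; [right|rewrite (absE' _ _ _ e)].
Qed.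

Lemma df_rat c (q : tm N) v K P : dt c q v -> dcont c K P ->
  df c (with_rat q K) (P (qval v)).
Proof.
move=> hq hK; apply: (@df_equiv _ _ _ (exists z p m d, npair z d = v /\
    npair p m = z /\ P ((fnat p - fnat m) / fnat (d + 1)))); last first.
  split=> [[_ [p [m [d [<- [<-]]]]]]|h].
    by rewrite qvalE !(nfst_pair, nsnd_pair).
  exists (nfst v), (nfst (nfst v)), (nsnd (nfst v)), (nsnd v).
  by rewrite !npair_eta -qvalE.
have hpair c' (w a b : tm N) wv av bv : dt c' w wv -> dt c' a av -> dt c' b bv ->
    df c' (is_pair w a b) (npair av bv = wv).
  move=> hw ha hb.
  apply: (@df_equiv _ _ _ (wv + wv = (av + bv) * ((av + bv) + 1) + (bv + bv))).
    by rewrite /is_pair; apply: df_nneq; repeat first [assumption|apply: dt_add|apply: dt_mul|exact: dt_1].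
  rewrite -npairE; move: (npair av bv) => w'.
  by split=> [e|->] //; nn_lra.
apply: df_ex => zv c1 e1 z hz; apply: df_ex => pv c2 e2 p hp.
apply: df_ex => mv c3 e3 m hm; apply: df_ex => dv c4 e4 d hd.
have hz' : dt c4 z zv by dt_lift.
have hp' : dt c4 p pv by dt_lift.
have hm' : dt c4 m mv by dt_lift.
have hq' : dt c4 q v by dt_lift.
apply: df_and; first exact: hpair.
apply: df_and; first exact: hpair.
apply: hK; first exact: (extends_trans e1 (extends_trans e2 (extends_trans e3 e4))).
exists pv, mv, (dv + 1); split=> //; first exact: dt_add.
by apply: le_lt_trans (nn_ltxS dv); apply: nn_ge0.
Qed.

Lemma double_sap (r : nn M) :
  sap (sap (sap (scon M (CS N N N)) (scon M CPlus))
    (sap (sap (scon M (CS N (Arr N N) N)) (scon M (CK N (Arr N N)))) (scon M (CK N N)))) r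
  = r + r.
Proof. by rewrite !sapS !sapK. Qed.

Lemma dt_pow2 c (n : tm N) (v : nn M) : dt c n v -> dt c (pow2 n) (npow2 v).
Proof.
move=> hn; have -> : npow2 v = sap (sap (sap (scon M CRec)
    (sap (scon M (CK (Arr N N) N)) (sap (sap (scon M (CS N N N)) (scon M CPlus))
    (sap (sap (scon M (CS N (Arr N N) N)) (scon M (CK N (Arr N N)))) (scon M (CK N N))))))
    1) v.
  rewrite npow2E natrecE; congr (sap (sap (sap _ _) _) _).
  apply: m_ext => i; apply: m_ext => r; rewrite sapK double_sap.
  by beta; beta.
by rewrite /pow2 /double; den.
Qed.

Lemma drat_inv_pow2 c (n : tm N) (v : nn M) : dt c n v -> drat c (inv_pow2 n) (ip v).
Proof.
move=> hn; exists 1, 0, (npow2 v); split=> //; first exact: dt_pow2.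
- exact: npow2_gt0.
- by rewrite fnat0 fnat1 subr0 div1r.
Qed.

Lemma drat_two_inv_pow2 c (n : tm N) (v : nn M) :
  dt c n v -> drat c (two_inv_pow2 n) (2 * ip v).
Proof.
move=> hn; exists (1 + 1), 0, (npow2 v); split=> //; first exact: dt_pow2.
- exact: npow2_gt0.
- by rewrite fnatD fnat0 fnat1 subr0.
Qed.

Definition dreal c (x : Defs.real) (X : nn M -> fraction M) : Prop :=
  forall c', extends c c' -> forall n nv, dt c' n nv ->
    forall K P, dcont c' K P -> df c' (x n K) (P (X nv)).

Lemma dreal_mono c c' x X : extends c c' -> dreal c x X -> dreal c' x X.
Proof. by move=> cc h c'' /(extends_trans cc); apply: h. Qed.

Lemma dreal_approx c x v : dt c x v -> dreal c (approx x) (rq v).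
Proof.
move=> hx c' cc n nv hn K P hK; apply: df_rat => //; apply: dt_app => //.
exact: dt_mono cc _.
Qed.

Lemma dreal_const c a q : drat c a q -> dreal c (constR a) (fun _ => q).
Proof. by move=> ha c' cc n nv hn K P hK; apply: hK => //; apply: drat_mono cc _. Qed.

Lemma dreal_ratR c (q : tm N) v : dt c q v -> dreal c (ratR q) (fun _ => qval v).
Proof. by move=> hq c' cc n nv hn K P hK; apply: df_rat => //; apply: dt_mono cc _. Qed.

Lemma dreal_sub c x y X Y : dreal c x X -> dreal c y Y -> dreal c (subR x y) (Sub X Y).
Proof.
move=> hx hy c' cc n nv hn K P hK; rewrite /subR.
apply: (hx c' cc _ (nv + 1) _ _ (fun q => P (q - Y (nv + 1)))); first exact: dt_add.
move=> c1 e1 a q ha.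
apply: (hy c1 (extends_trans cc e1) _ (nv + 1) _ _ (fun q' => P (q - q'))).
  by apply: dt_add => //; apply: dt_mono e1 _.
move=> c2 e2 b q' hb; apply: hK; first exact: extends_trans e1 e2.
by apply: drat_sub => //; apply: drat_mono e2 _.
Qed.

Lemma dreal_abs c x X : dreal c x X -> dreal c (absR x) (Abs X).
Proof.
move=> hx c' cc n nv hn K P hK.
apply: (hx c' cc _ nv hn _ (fun q => P `|q|)) => c1 e1 a q ha.
by apply: df_rabs => //; apply: dcont_mono e1 _.
Qed.

Lemma df_leR c x y X Y : dreal c x X -> dreal c y Y -> df c (leR x y) (Leq X Y).
Proof.
move=> hx hy; apply: df_all => nv c1 e1 n hn.
apply: (hx c1 e1 n nv hn _ (fun q => q <= Y nv + 2 * ip nv)) => c2 e2 a q ha.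
apply: (hy c2 (extends_trans e1 e2) n nv _ _ (fun q' => q <= q' + 2 * ip nv)).
  exact: dt_mono e2 _.
move=> c3 e3 b q' hb; apply: df_rle; first exact: drat_mono e3 _.
apply: drat_add => //; apply: drat_two_inv_pow2.
exact: dt_mono (extends_trans e2 e3) _.
Qed.

Lemma df_eqR c x y X Y : dreal c x X -> dreal c y Y -> df c (eqR x y) (Eqr X Y).
Proof.
move=> hx hy; apply: df_all => nv c1 e1 n hn.
apply: (hx c1 e1 n nv hn _ (fun q => `|q - Y nv| <= 2 * ip nv)) => c2 e2 a q ha.
apply: (hy c2 (extends_trans e1 e2) n nv _ _ (fun q' => `|q - q'| <= 2 * ip nv)).
  exact: dt_mono e2 _.
move=> c3 e3 b q' hb.
apply: (df_rabs (q := q - q') (P := fun z => z <= 2 * ip nv)).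
  by apply: drat_sub => //; apply: drat_mono e3 _.
move=> c4 e4 z zv hz; apply: df_rle => //; apply: drat_two_inv_pow2.
by apply: dt_mono (extends_trans e2 (extends_trans e3 e4)) _.
Qed.

Lemma df_ltR c x y X Y : dreal c x X -> dreal c y Y -> df c (ltR x y) (~ Leq Y X).
Proof. by move=> hx hy; apply: df_not; apply: df_leR. Qed.

Lemma df_is_real c x v : dt c x v -> df c (is_real x) (Real v).
Proof.
move=> hx; apply: df_all => nv c1 e1 n hn; apply: df_all => iv c2 e2 i hi.
have hx2 : dreal c2 (approx x) (rq v).
  by apply: dreal_approx; apply: dt_mono (extends_trans e1 e2) _.
have hn2 : dt c2 n nv by apply: dt_mono e2 _.
apply: (hx2 c2 (@extends_refl _ c2) n nv hn2 _
  (fun q => `|q - rq v (nv + iv)| < ip nv)) => c3 e3 a q ha.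
apply: (hx2 c3 e3 _ (nv + iv) _ _ (fun q' => `|q - q'| < ip nv)).
  by apply: dt_add; apply: dt_mono e3 _.
move=> c4 e4 b q' hb.
apply: (df_rabs (q := q - q') (P := fun z => z < ip nv)).
  by apply: drat_sub => //; apply: drat_mono e4 _.
move=> c5 e5 z zv hz; apply: df_rlt => //; apply: drat_inv_pow2.
by apply: dt_mono (extends_trans e3 (extends_trans e4 e5)) _.
Qed.

Lemma drat_0 c : drat c (Rat (con CZero) (con CZero) (con COne)) 0.
Proof.
by exists 0, 0, 1; split=> //; [nn_lra|rewrite fnat0 subr0 mul0r].
Qed.

Lemma drat_1 c : drat c (Rat (con COne) (con CZero) (con COne)) 1.
Proof.
by exists 1, 0, 1; split=> //; [nn_lra|rewrite fnat0 fnat1 subr0 divr1].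
Qed.

End DenotationReals.

Ltac den_lift :=
  first
  [ assumption
  | match goal with
    | E : extends ?c ?c' |- dt ?c' _ _ => apply: (dt_mono E); clear E; den_lift
    | E : extends ?c ?c' |- drat ?c' _ _ => apply: (drat_mono E); clear E; den_lift
    | E : extends ?c ?c' |- dreal ?c' _ _ => apply: (dreal_mono E); clear E; den_lift
    end ].

Ltac rden_step :=
  first
  [ solve [den_lift]
  | lazymatch goal with
    | |- df _ (is_real _) _ => apply: df_is_real
    | |- df _ (leR _ _) _ => apply: df_leR
    | |- df _ (eqR _ _) _ => apply: df_eqR
    | |- df _ (ltR _ _) _ => apply: df_ltR
    | |- dreal _ (approx _) _ => apply: dreal_approx
    | |- dreal _ zeroR _ => apply: dreal_const; exact: drat_0
    | |- dreal _ oneR _ => apply: dreal_const; exact: drat_1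
    | |- dreal _ (inv_pow2R _) _ => apply: dreal_const; apply: drat_inv_pow2
    | |- dreal _ (ratR _) _ => apply: dreal_ratR
    | |- dreal _ (subR _ _) _ => apply: dreal_sub
    | |- dreal _ (absR _) _ => apply: dreal_abs
    end
  | match goal with |- df _ (all _) _ =>
      let v := fresh "v" in let c := fresh "c" in let e := fresh "e" in
      let x := fresh "x" in let xv := fresh "xv" in
      apply: df_all => v c e x xv end
  | match goal with |- df _ (ex _) _ =>
      let v := fresh "v" in let c := fresh "c" in let e := fresh "e" in
      let x := fresh "x" in let xv := fresh "xv" in
      apply: df_ex => v c e x xv end
  | apply: df_imp | apply: df_and | apply: df_or | apply: df_not | apply: df_iff
  | apply: df_eq | apply: df_lt
  | apply: dt_con | apply: dt_app ].

Ltac rden := repeat rden_step.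

Section DenotationPrinciples.

Variable M : model.
Implicit Types (c : ctx M).

Lemma df_fun_unit c f v : dt c f v -> df c (fun_unit f) (Fun_unit v).
Proof. by move=> hx; rewrite /fun_unit /in_unit; rden. Qed.

Lemma df_mem c a x av v : dt c a av -> dt c x v -> df c (mem a x) (Mem av v).
Proof. by move=> ha hx; rewrite /mem; rden. Qed.

Lemma df_mem_closed c a r x av rv v : dt c a av -> dt c r rv -> dt c x v ->
  df c (mem_closed a r x) (Mem_closed av rv v).
Proof. by move=> ha hr hx; rewrite /mem_closed /in_unit; rden. Qed.

Lemma df_sup_exists c (P : tm ty1 -> fm) (Q : dom M ty1 -> Prop) f v :
  (forall c', extends c c' -> forall x xv, dt c' x xv -> df c' (P x) (Q xv)) ->
  dt c f v -> df c (sup_exists P f) (Sup_exists Q v).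
Proof.
move=> hP hf; apply: df_ex => yv c1 e1 y hy; apply: df_and; first by rden.
apply: df_and.
  apply: df_all => xv c2 e2 x hx; apply: df_imp; last by rden.
  by apply: hP => //; apply: extends_trans e1 e2.
apply: df_all => kv c2 e2 k hk; apply: df_ex => xv c3 e3 x hx; apply: df_and; last by rden.
by apply: hP => //; apply: extends_trans e1 (extends_trans e2 e3).
Qed.

Lemma sat_BOOT rho : @sat M rho (sentence BOOT) <-> Boot M.
Proof. by apply: sat_sentence; rewrite /BOOT /is_set; rden. Qed.

Lemma sat_SUP_sets rho : @sat M rho (sentence SUP_sets) <-> Sup_sets M.
Proof.
apply: sat_sentence; apply: df_all => A c1 e1 a ha; apply: df_all => F c2 e2 f hf.
apply: df_imp; first by rewrite /subset_unit /fun_R /mem /in_unit; rden.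
apply: df_imp; first by rewrite /nonempty /mem; rden.
apply: df_imp; first by apply: df_fun_unit.
apply: df_sup_exists => // c3 e3 x xv hx; apply: df_mem => //; den_lift.
Qed.

Lemma sat_SUP_closed rho : @sat M rho (sentence SUP_closed) <-> Sup_closed M.
Proof.
apply: sat_sentence; apply: df_all => A c1 e1 a ha; apply: df_all => R c2 e2 r hr.
apply: df_all => F c3 e3 f hf.
apply: df_imp; first by rewrite /nonempty /mem_closed /in_unit; rden.
apply: df_imp; first by apply: df_fun_unit.
apply: df_sup_exists => // c4 e4 x xv hx; apply: df_mem_closed => //; den_lift.
Qed.

Lemma sat_MCT_net rho : @sat M rho (sentence MCT_net) <-> Mct M.
Proof.
apply: sat_sentence.
by rewrite /MCT_net /directed /increasing_net /converges /in_unit; rden.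
Qed.

End DenotationPrinciples.

(** * Comparing reals *)

Section Comparison.

Variable M : model.
Implicit Types (n m k i j : nn M) (X Y : nn M -> fraction M) (q r : fraction M)
  (x y : dom M ty1).

(** Weaker than [Real] and symmetric, so that estimates can be made at two independent indices. *)
Definition Reg X : Prop := forall n m, `|X n - X m| <= ip n + ip m.

(** [Ge X q] and [Le X q] compare the real given by [X] with a fraction. *)
Definition Ge X q : Prop := forall n, q <= X n + ip n.
Definition Le X q : Prop := forall n, X n - ip n <= q.

Lemma Reg_const q : Reg (fun _ => q).
Proof.
move=> n m; rewrite subrr normr0; have := ip_gt0 n; have := ip_gt0 m; lra.
Qed.

Lemma Reg_Sub X Y : Reg X -> Reg Y -> Reg (Sub X Y).
Proof.
move=> hX hY n m; have := hX (n + 1) (m + 1); have := hY (n + 1) (m + 1).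
rewrite /Sub !ip_S !ler_norml => /andP [h1 h2] /andP [h3 h4].
by apply/andP; split; lra.
Qed.

Lemma Reg_Abs X : Reg X -> Reg (Abs X).
Proof. by move=> hX n m; apply: le_trans (ler_dist_dist _ _) (hX n m). Qed.

Lemma Real_Reg x : Real x -> Reg (rq x).
Proof.
move=> hx n m; have := ip_gt0 n; have := ip_gt0 m.
case: (leP n m) => [|/ltW] /nn_le_exists [z ->].
- by move=> h1 h2; apply: ltW; apply: lt_trans (hx n z) _; lra.
- by move=> h1 h2; rewrite distrC; apply: ltW; apply: lt_trans (hx m z) _; lra.
Qed.

Lemma Leq_Reg X Y : Reg X -> Reg Y ->
  Leq X Y <-> forall n m, X n - ip n <= Y m + ip m.
Proof.
move=> hX hY; split=> [h n m|h n]; last by have := h n n; lra.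
(* Going from n to k and from k to m costs 2 ^ (- k) each, and the comparison at k costs twice
   that. *)
apply: (@ip_le_all _ _ _ 4) => [|k]; first by [].
have := hX n k; have := hY k m; have := h k.
by rewrite !ler_norml => h1 /andP [h2 h3] /andP [h4 h5]; lra.
Qed.

Lemma Leq_Ge q X : Reg X -> Leq (fun _ => q) X <-> Ge X q.
Proof.
move=> hX; rewrite (Leq_Reg (Reg_const q) hX).
split=> h n; last by move=> m; have := h m; have := ip_gt0 n; lra.
by apply: (@ip_le_all _ _ _ 1) => // k; have := h k n; lra.
Qed.

Lemma Leq_Le X q : Reg X -> Leq X (fun _ => q) <-> Le X q.
Proof.
move=> hX; rewrite (Leq_Reg hX (Reg_const q)).
split=> h n; last by move=> m; have := h n; have := ip_gt0 m; lra.
by apply: (@ip_le_all _ _ _ 1) => // k; have := h n k; lra.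
Qed.

Lemma Le_Ge_le X q r : Ge X q -> Le X r -> q <= r.
Proof.
move=> h1 h2; apply: (@ip_le_all _ _ _ 2) => // n; have := h1 n; have := h2 n; lra.
Qed.

Lemma Ge_trans X q r : q <= r -> Ge X r -> Ge X q.
Proof. by move=> h hX n; apply: le_trans (hX n). Qed.

Lemma Le_trans X q r : q <= r -> Le X q -> Le X r.
Proof. by move=> h hX n; apply: le_trans (hX n) _. Qed.

(** By regularity X n - 2 ^ (- n) is itself a lower bound of X. Transitivity of [Leq] becomes
    immediate in this form, in which the tolerances no longer add up. *)
Lemma Leq_by_Ge X Y : Reg X -> Reg Y -> Leq X Y <-> forall q, Ge X q -> Ge Y q.
Proof.
move=> hX hY; rewrite Leq_Reg //; split=> [h q hq m|h n m].
  apply: (@ip_le_all _ _ _ 2) => // n; have := hq n; have := h n m; lra.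
have hn : Ge X (X n - ip n) by move=> k; have := hX n k; rewrite ler_norml => /andP [h1 h2]; lra.
exact: h hn m.
Qed.

Lemma Leq_trans_Reg X Y (Z : nn M -> fraction M) : Reg X -> Reg Y -> Reg Z ->
  Leq X Y -> Leq Y Z -> Leq X Z.
Proof.
move=> hX hY hZ; rewrite !Leq_by_Ge // => h1 h2 q /h1; exact: h2.
Qed.

Lemma Le_or_Ge X q : Reg X -> Le X q \/ Ge X q.
Proof.
move=> hX; case: (pselect (Le X q)) => h; [by left|right=> m].
have [n hn] : exists n, ~ (X n - ip n <= q).
  by apply: contrapT => h'; apply: h => n; apply: contrapT => h''; apply: h'; exists n.
have := hX n m; rewrite ler_norml => /andP [h1 h2].
by move/negP: hn; rewrite -ltNge; lra.
Qed.

(** Strict inequalities are used through a pair of separating fractions, which can then be compared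
    with other bounds. *)
Lemma not_Leq X Y : Reg X -> Reg Y -> ~ Leq X Y ->
  exists q r, [/\ q < r, Le Y q & Ge X r].
Proof.
move=> hX hY; rewrite Leq_Reg // => h.
have [n [m hnm]] : exists n m, ~ (X n - ip n <= Y m + ip m).
  apply: contrapT => h'; apply: h => n m; apply: contrapT => h''; apply: h'.
  by exists n, m.
exists (Y m + ip m), (X n - ip n); split.
- by move/negP: hnm; rewrite -ltNge.
- by move=> k; have := hY m k; rewrite ler_norml => /andP [h1 h2]; lra.
- by move=> k; have := hX n k; rewrite ler_norml => /andP [h1 h2]; lra.
Qed.

Lemma not_Leq_intro X Y q r : Reg X -> Reg Y -> q < r -> Le Y q -> Ge X r -> ~ Leq X Y.
Proof.
move=> hX hY qr h1 h2; rewrite Leq_by_Ge // => /(_ r h2) h3.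
by have := Le_Ge_le h3 h1; lra.
Qed.

Lemma Eqr_Leq X Y : Eqr X Y <-> Leq X Y /\ Leq Y X.
Proof.
split=> [h|[h1 h2] n].
  by split=> n; have := h n; rewrite ler_norml => /andP [h1 h2]; lra.
by have := h1 n; have := h2 n; rewrite ler_norml => h3 h4; apply/andP; split; lra.
Qed.

Lemma Sub_ip_Le X k q : Reg X -> Le X q -> Le (Sub X (fun _ => ip k)) (q - ip k).
Proof.
move=> hX h n; have := h (n + 1); rewrite /Sub ip_S; have := ip_gt0 n; lra.
Qed.

Lemma Le_Sub_ip X k q : Reg X -> Le (Sub X (fun _ => ip k)) q -> Le X (q + ip k).
Proof.
move=> hX h n; rewrite lerBlDr; apply: (@ip_le_all _ _ _ 2) => // m.
have := h m; have := hX (m + 1) n; rewrite /Sub ler_norml => h1 h2.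
by move: h1 => /andP [h3 h4]; have := ip_gt0 m; rewrite ip_S in h3 h4 *; lra.
Qed.

End Comparison.

(** * Binary digits in base four *)

(** A 0-1 sequence is recovered from the real whose base four digits it gives:
    such reals are separated by gaps, so approximations decide the digits. *)
Section Digits.

Variable M : model.
Implicit Types (n m k i j : nn M) (s : nn M -> nn M) (q r : fraction M).

Definition horner s n : nn M := natrec 0 (fun i a => a + a + a + a + s i) n.

Definition repN1 s : Prop := rep (fun g : model_env M [:: N] => s (hd g)).

Lemma hornerS s n : repN1 s -> horner s (n + 1) =
  horner s n + horner s n + horner s n + horner s n + s n.
Proof.
move=> hs; rewrite /horner natrecS //; apply: rep_add; first by rep_tac.
by apply: (rep_comp hs); rep_tac.
Qed.

Lemma horner0 s : horner s 0 = 0.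
Proof. exact: natrec0. Qed.

Lemma rep_horner G (s : model_env M G -> nn M -> nn M) (a : model_env M G -> nn M) :
  rep (fun g : model_env M (N :: G) => s (tl g) (hd g)) -> rep a ->
  rep (fun g => horner (s g) (a g)).
Proof.
move=> hs ha; apply: rep_natrec => //; first exact: rep_const.
apply: rep_add; first by rep_tac.
by apply: rep_ext (@rep_weak _ _ N _ _ hs) => -[[g i] r].
Qed.

Lemma repN1_horner s : repN1 s -> repN1 (horner s).
Proof. by move=> hs; apply: rep_horner; [apply: (rep_comp hs)|]; rep_tac. Qed.

Definition binary s : Prop := forall n, s n = 0 \/ s n = 1.

Definition hval s n : fraction M := fnat (horner s n) * ip (n + n).

Lemma ip_SS n : ip (n + 1 + (n + 1)) = ip (n + n) / 4.
Proof.
have -> : n + 1 + (n + 1) = n + n + 1 + 1 by ring.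
by rewrite !ip_S; field.
Qed.

Lemma hval0 s : hval s 0 = 0.
Proof. by rewrite /hval horner0 mul0r. Qed.

Lemma hvalS s n : repN1 s -> hval s (n + 1) = hval s n + fnat (s n) * ip (n + n) / 4.
Proof. by move=> hs; rewrite /hval hornerS // ip_SS !fnatD; field. Qed.

Lemma binary_fnat s n : binary s -> 0 <= fnat (s n) <= 1.
Proof. by case/(_ n) => ->; rewrite ?fnat0 ?fnat1 lexx ler01. Qed.

Lemma repq_hval G (s : model_env M G -> nn M -> nn M) (a : model_env M G -> nn M) :
  rep (fun g : model_env M (N :: G) => s (tl g) (hd g)) -> rep a ->
  repq (fun g => hval (s g) (a g)).
Proof.
move=> hs ha; apply: repq_mul; last by rep_tac.
by apply: repq_nat; apply: rep_horner.
Qed.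

(** If all the digits at positions n, ..., n + k - 1 are 1, they add up to exactly (4 ^ (- n) - 4 ^
    (- n - k)) / 3; keeping the subtracted term makes the induction go through. *)
Lemma hval_tail s n k : repN1 s -> binary s ->
  hval s n <= hval s (n + k) /\ hval s (n + k) <= hval s n + ip (n + n) / 3 - ip (n + k + (n + k)) / 3.
Proof.
move=> hs bs; have hq (a : model_env M [:: N] -> nn M) : rep a -> repq (fun g => hval s (a g)).
  by move=> ha; apply: (repq_hval (s := fun _ => s)) => //; apply: (rep_comp hs); rep_tac.
move: k; apply: nn_ind => [||k [h1 h2]].
- apply: dec_and; apply: dec_leq; try by apply: repq_const.
  + by apply: hq; rep_tac.
  + by apply: hq; rep_tac.
  + by rep_tac.
- by rewrite addr0; split; lra.
- have -> : n + (k + 1) = n + k + 1 by rewrite addrA.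
  rewrite (hvalS _ hs) ip_SS.
  have [h3 h4] : 0 <= fnat (s (n + k)) * ip (n + k + (n + k)) /\
      fnat (s (n + k)) * ip (n + k + (n + k)) <= ip (n + k + (n + k)).
    have := ip_gt0 (n + k + (n + k)).
    by case: (bs (n + k)) => ->; rewrite ?fnat0 ?fnat1 ?mul0r ?mul1r; split; lra.
  by split; lra.
Qed.

Lemma hval_mono s n m : repN1 s -> binary s -> n <=^ m -> hval s n <= hval s m.
Proof. by move=> hs bs /nn_le_exists [k ->]; have [] := hval_tail n k hs bs. Qed.

Lemma hval_ub s n m : repN1 s -> binary s -> hval s m <= hval s n + ip (n + n) / 3.
Proof.
move=> hs bs; have := ip_gt0 (n + n); case: (leP n m) => [|/ltW h].
  by move=> /nn_le_exists [k ->]; have [_] := hval_tail n k hs bs; have := ip_gt0 (n + k + (n + k)); lra.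
by have := hval_mono hs bs h; lra.
Qed.

Lemma hval_ge0 s n : 0 <= hval s n.
Proof. by apply: mulr_ge0; [apply: fnat_ge0|apply: ltW; apply: ip_gt0]. Qed.

Lemma hval_le1 s n : repN1 s -> binary s -> hval s n <= 1.
Proof.
move=> hs bs; have := hval_ub 0 n hs bs; rewrite hval0 addr0 ip_0; lra.
Qed.

Lemma hval_cmp s s' n : repN1 s -> repN1 s' ->
  (forall j, j <^ n -> fnat (s j) <= fnat (s' j)) -> hval s n <= hval s' n.
Proof.
move=> hs hs' h; suff : forall j, j <=^ n -> hval s j <= hval s' j by apply.
have hq t (a : model_env M [:: N] -> nn M) : repN1 t -> rep a -> repq (fun g => hval t (a g)).
  by move=> ht ha; apply: (repq_hval (s := fun _ => t)) => //; apply: (rep_comp ht); rep_tac.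
apply: nn_ind => [||j IH jn].
- by apply: dec_imp; [rep_tac|apply: dec_leq; apply: hq => //; rep_tac].
- by rewrite !hval0.
- rewrite (hvalS _ hs) (hvalS _ hs'); have := h j; rewrite -nn_leS => /(_ jn).
  have := IH (le_trans (nn_leDr _ _) jn) => h1 /(ler_wpM2r (ltW (ip_gt0 (j + j)))); lra.
Qed.

(** [digit d n] is the [n]-th digit when [d m n] computes it from the value [m]
    of the previous ones. *)
Definition digits (d : nn M -> nn M -> nn M) n : nn M :=
  natrec 0 (fun i a => a + a + a + a + d a i) n.
Definition digit d n : nn M := d (digits d n) n.

Definition repN2 (d : nn M -> nn M -> nn M) : Prop :=
  rep (fun g : model_env M [:: N; N] => d (hd (tl g)) (hd g)).

Lemma rep_digits d : repN2 d -> repN1 (digits d).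
Proof.
move=> hd'; apply: rep_natrec; [exact: rep_const|by rep_tac|].
by apply: rep_add; [rep_tac|apply: (rep_comp2 hd'); rep_tac].
Qed.

Lemma rep_digit d : repN2 d -> repN1 (digit d).
Proof.
move=> hd'; apply: (rep_comp2 hd'); last by rep_tac.
exact: rep_digits.
Qed.

Lemma digit_correct d s n : repN2 d -> repN1 s ->
  (forall j, j <=^ n -> d (horner s j) j = s j) -> forall j, j <=^ n -> digit d j = s j.
Proof.
move=> hd' hs h.
have e : forall j, j <=^ n -> digits d j = horner s j.
  apply: nn_ind => [|_|j IH jn].
  - apply: dec_imp; first by rep_tac.
    apply: dec_eq; first by apply: (rep_comp (rep_digits hd')); rep_tac.
    by apply: (rep_comp (repN1_horner hs)); rep_tac.
  - by rewrite horner0 /digits natrec0.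
  - have jn' := le_trans (nn_leDr _ _) jn.
    rewrite hornerS // -(h _ jn') -(IH jn') /digits natrecS //.
    by apply: rep_add; [rep_tac|apply: (rep_comp2 hd'); rep_tac].
by move=> j jn; rewrite /digit e ?h.
Qed.

(** The threshold between the digits 0 and 1 after the value [m] of the first
    [j] digits. *)
Definition threshold m j : fraction M := (fnat m + 1 / 8) * ip (j + j).

(** In units of 4 ^ (- j), a tail starting with digit 0 is worth at most 1/12 and one starting with
    1 at least 1/4, so 1/8 separates them. The error u is at most 1/64 of the unit, and the margins
    1/16 and 1/64 still fit. *)
Lemma digit_bounds s n j (lo hi : fraction M) : repN1 s -> binary s -> j <=^ n ->
  let u := ip (n + 1 + (n + 1)) / 16 in
  let t := threshold (horner s j) j in
  hval s (n + 1) - u <= hi -> lo <= hval s (n + 1) + ip (n + 1 + (n + 1)) / 3 + u ->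
  (s j = 1 -> t <= hi - ip (j + j) / 16) /\ (s j = 0 -> lo <= t - ip (j + j) / 64).
Proof.
move=> hs bs jn; rewrite /= /threshold.
have [k ->] : exists k, n + 1 = j + 1 + k.
  by have [k ->] := nn_le_exists jn; exists k; rewrite addrAC.
have := hval_tail (j + 1) k hs bs; rewrite (hvalS _ hs) ip_SS.
have -> : (fnat (horner s j) + 1 / 8) * ip (j + j) = hval s j + ip (j + j) / 8.
  by rewrite /hval; field.
have : ip (j + 1 + k + (j + 1 + k)) <= ip (j + j) / 4.
  rewrite -ip_SS; apply: ip_le.
  by rewrite [X in _ <=^ X](_ : _ = (j + 1 + (j + 1)) + (k + k)) ?nn_leDr //; ring.
move=> h0 [h1 h2] h3 h4; have := ip_gt0 (j + 1 + k + (j + 1 + k)).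
move: h0 h1 h2 h3 h4; move: (ip (_ + k + _)) (ip (j + j)) (hval s (_ + k)) (hval s j).
move=> u v a b h0 h1 h2 h3 h4 u0; split=> e.
- have ef : fnat (s j) = 1 by rewrite e.
  by rewrite ef in h1 h2; lra.
- have ef : fnat (s j) = 0 by rewrite e.
  by rewrite ef in h1 h2; lra.
Qed.

Section DigitsOfReal.

Variable y : dom M ty1.

(** The index yields precision 4 ^ (- j) / 128, half of the smaller margin in [digit_bounds]. *)
Definition real_bit m j : nn M :=
  cond (threshold m j <= rq y (j + j + 1 + 1 + 1 + 1 + 1 + 1 + 1)) 1 0.

Lemma rep_real_bit : repN2 real_bit.
Proof. by rewrite /repN2 /real_bit /threshold /rq; rep_tac. Qed.

Definition real_digit n : nn M := digit real_bit n.

Lemma rep_real_digit : repN1 real_digit.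
Proof. exact: rep_digit rep_real_bit. Qed.

Lemma real_digit_binary : binary real_digit.
Proof.
by move=> n; apply: cond_binary.
Qed.

Lemma real_digit_correct s n : repN1 s -> binary s ->
  let u := ip (n + 1 + (n + 1)) / 16 in
  Ge (rq y) (hval s (n + 1) - u) ->
  Le (rq y) (hval s (n + 1) + ip (n + 1 + (n + 1)) / 3 + u) ->
  forall j, j <=^ n -> real_digit j = s j.
Proof.
move=> hs bs u hge hle; apply: digit_correct => // [|j jn]; first exact: rep_real_bit.
set k := j + j + 1 + 1 + 1 + 1 + 1 + 1 + 1.
have ek : ip k = ip (j + j) / 128 by rewrite /k !ip_S; field.
have := hge k; have := hle k; rewrite ek => h1 h2.
have [||b1 b0] := @digit_bounds s n j (rq y k - ip (j + j) / 128) (rq y k + ip (j + j) / 128) hs bs jn.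
- by rewrite -/u; lra.
- by rewrite -/u; lra.
have := ip_gt0 (j + j) => j0.
rewrite /real_bit -/k; case: (bs j) => e; rewrite e.
- by rewrite condF //; apply/negP; rewrite -ltNge; have := b0 e; lra.
- by rewrite condT //; have := b1 e; lra.
Qed.

End DigitsOfReal.

End Digits.

#[global] Opaque horner hval digits threshold.

(** * Monotone convergence of nets implies BOOT *)

Section Families.

Variable M : model.
Implicit Types (n m k i j L : nn M) (d e f x y : dom M ty1) (Y : dom M (Arr ty1 (Arr N N))).

Definition BOOT_for Y : Prop := exists X : nn M -> nn M,
  [/\ repN1 X, binary X & forall n, X n = 1 <-> exists f, sap (sap Y f) n = 0].

Lemma Is_set_binary x : Is_set x <-> binary (fun n => sap x n).
Proof.
have h n : slt (sap x n) 1 \/ seqv (sap x n) 1 <-> sap x n = 0 \/ sap x n = 1.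
  rewrite m_eq -nn_ltE -[X in _ <^ X]add0r nn_ltS.
  split=> [[|]|[->|]]; [|by right|by left; rewrite lexx|by right].
  by move=> h; left; apply: le_anti; rewrite h nn_ge0.
by split=> H n; apply/h.
Qed.

Lemma Boot_iff : Boot M <-> forall Y, BOOT_for Y.
Proof.
split=> [h Y|h Y].
  have [x [/Is_set_binary sx hx]] := h Y; exists (fun n => sap x n).
  split=> // [|n]; first by rewrite /repN1; rep_tac.
  have := hx n; rewrite m_eq => ->.
  by split=> -[f]; [move/m_eq; exists f|exists f; apply/m_eq].
have [X [hX bX HX]] := h Y; exists (lam X); split.
  by apply/Is_set_binary => n; rewrite beta.
move=> n; rewrite m_eq beta // HX.
by split=> -[f]; [move=> e; exists f; apply/m_eq|move/m_eq; exists f].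
Qed.

(** A function codes a length and a sequence of functions. *)
Definition slen d : nn M := sap d 0.
Definition sfam d n : dom M ty1 := lam (fun i => sap d (npair n i + 1)).
Definition mkfam L (f : nn M -> nn M -> nn M) : dom M ty1 :=
  lam (fun k => cond (k = 0) L (f (nfst (nn_pred k)) (nsnd (nn_pred k)))).

Lemma rep_sfam0 : rep (fun g : model_env M [:: N; ty1] => sfam (hd (tl g)) (hd g)).
Proof. by rewrite /sfam; rep_tac. Qed.

Lemma rep_slen0 : rep (fun g : model_env M [:: ty1] => slen (hd g)).
Proof. by rewrite /slen; rep_tac. Qed.

Lemma rep_mkfam_body L (f : nn M -> nn M -> nn M) : repN2 f -> repN1 (fun k =>
  cond (k = 0) L (f (nfst (nn_pred k)) (nsnd (nn_pred k)))).
Proof.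
move=> hf; apply: rep_cond; [by rep_tac|by rep_tac|].
by apply: (rep_comp2 hf); rep_tac.
Qed.

Lemma slen_mkfam L (f : nn M -> nn M -> nn M) : repN2 f -> slen (mkfam L f) = L.
Proof. by move=> hf; rewrite /slen /mkfam beta ?condT //; apply: rep_mkfam_body. Qed.

Lemma nn_S_neq0 n : n + 1 <> 0.
Proof.
by move=> /nn_add_eq0 [_ /eqP]; rewrite oner_eq0.
Qed.

Lemma sfam_mkfam L (f : nn M -> nn M -> nn M) n i : repN2 f -> sap (sfam (mkfam L f) n) i = f n i.
Proof.
move=> hf; rewrite /sfam beta; last by rep_tac.
rewrite /mkfam beta; last exact: rep_mkfam_body.
by rewrite condF ?nn_predS ?nfst_pair ?nsnd_pair //; apply: nn_S_neq0.
Qed.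

Lemma near_const X q k : Reg X -> ~ Leq (fun _ => ip k) (Abs (Sub (fun _ => q) X)) ->
  Ge X (q - ip k) /\ Le X (q + ip k :> fraction M).
Proof.
move=> hX /(@not_Leq M _ _ (Reg_const _) (Reg_Abs (Reg_Sub (Reg_const _) hX))).
move=> [a [b [ab ha hb]]].
have bk : b <= ip k by apply: (@ip_le_all _ _ _ 1) => // n; have := hb n; lra.
have hn n : `|q - X (n + 1)| <= ip k + ip n by have := ha n; rewrite /Abs /Sub; lra.
split=> m.
- apply: (@ip_le_all _ _ _ 2) => [|n]; first exact: ler0n.
  have := hn n; have := hX (n + 1) m.
  rewrite !ler_norml ip_S => /andP [h1 h2] /andP [h3 h4]; have := ip_gt0 n; lra.
- rewrite lerBlDr; apply: (@ip_le_all _ _ _ 2) => [|n]; first exact: ler0n.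
  have := hn n; have := hX (n + 1) m.
  rewrite !ler_norml ip_S => /andP [h1 h2] /andP [h3 h4]; have := ip_gt0 n; lra.
Qed.

Lemma In_unit_intro x : Real x -> (forall n, 0 <= rq x n <= 1) -> In_unit x.
Proof.
move=> hx h; split=> //; split=> n; have /andP [h1 h2] := h n; have := ip_gt0 n; lra.
Qed.

Lemma rq_const (c : nn M) : rq (lam (fun _ : nn M => c)) = fun _ => qval c.
Proof. by apply: funext => n; rewrite /rq beta //; rep_tac. Qed.

Lemma Real_const (c : nn M) : Real (lam (fun _ : nn M => c)).
Proof. by move=> n i; rewrite !rq_const subrr normr0 ip_gt0. Qed.

Definition hcode (s : nn M -> nn M) n : nn M := qcode (horner s n) 0 (npow2 (n + n)).

Lemma qval_hcode s n : qval (hcode s n) = hval s n.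
Proof. by rewrite /hcode qval_code ?npow2_gt0 // fnat0 subr0. Qed.

Lemma rep_hcode G (s : model_env M G -> nn M -> nn M) (a : model_env M G -> nn M) :
  rep (fun g : model_env M (N :: G) => s (tl g) (hd g)) -> rep a ->
  rep (fun g => hcode (s g) (a g)).
Proof.
by move=> hs ha; apply: rep_qcode; [apply: rep_horner|apply: rep_const|rep_tac].
Qed.

End Families.

Section MctBoot.

Variable M : model.
Implicit Types (n m k i j L : nn M) (d e f x y : dom M ty1).

Lemma Mct_all (B : dom M ty1 -> dom M ty1 -> Prop) (F : dom M (Arr ty1 ty1)) :
  Mct M -> dec (fun g : model_env M [:: ty1; ty1] => B (hd (tl g)) (hd g)) ->
  (forall d, B d d) -> (forall c d e, B c d -> B d e -> B c e) ->
  (forall d e, exists c, B d c /\ B e c) -> (forall d, In_unit (sap F d)) ->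
  (forall d e, B d e -> Leq (rq (sap F d)) (rq (sap F e))) ->
  exists y, Real y /\ forall k, exists d, forall e, B d e ->
    ~ Leq (fun _ => ip k) (Abs (Sub (rq (sap F e)) (rq y))).
Proof.
move=> mct dB B_refl B_trans B_dir F_unit F_incr.
pose D : dom M ty2 := lam (fun _ => 1).
pose P : dom M (Arr ty1 (Arr ty1 N)) := lam (fun d => lam (fun e => cond (B d e) 1 0)).
have DE d : seqv (sap D d) 1 by apply/m_eq; rewrite /D beta //; rep_tac.
have PB d e : sap (sap P d) e = cond (B d e) 1 0.
  rewrite /P beta; last by apply: rep_lam; apply: rep_cond; rep_tac.
  rewrite beta //; apply: rep_cond; [|by rep_tac|by rep_tac].
  by apply: (dec_comp2 dB); rep_tac.
have PE d e : seqv (sap (sap P d) e) 1 <-> B d e by rewrite m_eq PB cond_eq1.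
have le1 n : n = 0 \/ n = 1 -> slt n 1 \/ seqv n 1.
  by case=> ->; [left; apply: nn_lt01|right; apply/m_eq].
have [||y [hy conv]] := mct D P F.
- split; first by move=> d; right.
  split; first by move=> d e; apply: le1; rewrite PB; apply: cond_binary.
  split; first by exists (default M ty1).
  split; first by move=> d _; apply/PE.
  split; first by move=> c d e _ _ _ /PE cd /PE de; apply/PE; apply: B_trans cd de.
  by move=> d e _ _; have [c [dc ec]] := B_dir d e; exists c; split=> //; split; apply/PE.
- by split=> [d _ //|d e _ _ /PE]; apply: F_incr.
exists y; split=> // k; have [d [_ h]] := conv k; exists d => e de.
by apply: h => //; apply/PE.
Qed.

Variable Y : dom M (Arr ty1 (Arr N N)).

Definition mbit d n : nn M := cond (n <^ slen d /\ sap (sap Y (sfam d n)) n = 0) 1 0.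

Lemma rep_mbit0 : rep (fun g : model_env M [:: N; ty1] => mbit (hd (tl g)) (hd g)).
Proof.
apply: rep_cond; [|by rep_tac|by rep_tac].
apply: dec_and; first by apply: dec_lt; [|apply: (rep_comp (rep_slen0 M))]; rep_tac.
apply: dec_eq; last by rep_tac.
apply: rep_app; last by rep_tac.
by apply: rep_app; [rep_tac|apply: (rep_comp2 (rep_sfam0 M)); rep_tac].
Qed.

Lemma rep_mbit d : repN1 (mbit d).
Proof. by apply: (rep_comp2 rep_mbit0); rep_tac. Qed.

Lemma mbit_binary d : binary (mbit d).
Proof. by move=> n; apply: cond_binary. Qed.

Lemma mbit_eq1 d n : mbit d n = 1 <-> n <^ slen d /\ sap (sap Y (sfam d n)) n = 0.
Proof. exact: cond_eq1. Qed.

(** Only the witnessed numbers have to persist, not the functions witnessing them; this leaves room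
    to exchange single functions. *)
Definition below d e : Prop :=
  (slen d <=^ slen e) /\ forall n, n <^ slen d -> mbit d n = 1 -> mbit e n = 1.

Lemma dec_below : dec (fun g : model_env M [:: ty1; ty1] => below (hd (tl g)) (hd g)).
Proof.
have hl G (a : model_env M G -> dom M ty1) : rep a -> rep (fun g => slen (a g)).
  exact: (rep_comp (rep_slen0 M)).
have hb G (a : model_env M G -> dom M ty1) b : rep a -> rep b -> rep (fun g => mbit (a g) (b g)).
  exact: (rep_comp2 rep_mbit0).
apply: dec_and; first by apply: dec_le; apply: hl; rep_tac.
apply: dec_ball; last by apply: hl; rep_tac.
by apply: dec_imp; apply: dec_eq; (try by apply: rep_const); apply: hb; rep_tac.
Qed.

Definition merge_fam L d (f : dom M ty1) (P : nn M -> Prop) : dom M ty1 :=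
  mkfam L (fun n i => cond (P n) (sap (sfam d n) i) (sap f (npair n i))).

Lemma fnat_mbit d e n : (mbit d n = 1 -> mbit e n = 1) -> fnat (mbit d n) <= fnat (mbit e n).
Proof.
move=> h; case: (mbit_binary d n) (mbit_binary e n) h => -> [->|->] h //; rewrite ?lexx ?fnat0 ?fnat1 ?ler01 //.
by have := h erefl => /eqP; rewrite eq_sym oner_eq0.
Qed.

(** All indices beyond some d that are long enough share digit n with the limit. Given a witness for
    n, some such index has it at position n, so the digit of the limit is 1. *)
Lemma Mct_BOOT_for : Mct M -> BOOT_for Y.
Proof.
move=> mct.
pose F : dom M (Arr ty1 ty1) := lam (fun d => lam (fun _ => hcode (mbit d) (slen d))).
have FE d : sap F d = lam (fun _ => hcode (mbit d) (slen d)).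
  rewrite /F beta //; apply: rep_lam; apply: (rep_hcode (s := fun g : model_env M [:: N; ty1] => mbit (hd (tl g)))).
    by apply: (rep_comp2 rep_mbit0); rep_tac.
  by apply: (rep_comp (rep_slen0 M)); rep_tac.
have rqF d : rq (sap F d) = fun _ => hval (mbit d) (slen d).
  by rewrite FE rq_const qval_hcode.
have repf d f (P : nn M -> Prop) : dec (fun g : model_env M [:: N] => P (hd g)) ->
    repN2 (fun n i => cond (P n) (sap (sfam d n) i) (sap f (npair n i))).
  move=> dP; apply: rep_cond.
  - by apply: (dec_comp (P := P)) => //; rep_tac.
  - by apply: rep_app; [apply: (rep_comp2 (rep_sfam0 M))|]; rep_tac.
  - by rep_tac.
have slenE L d f P : dec (fun g : model_env M [:: N] => P (hd g)) ->
    slen (merge_fam L d f P) = L.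
  by move=> dP; apply: slen_mkfam; apply: repf.
have sfamT L d f (P : nn M -> Prop) n : dec (fun g : model_env M [:: N] => P (hd g)) ->
    P n -> sfam (merge_fam L d f P) n = sfam d n.
  move=> dP Pn; apply: m_ext => i; rewrite sfam_mkfam ?condT //; exact: repf.
have sfamF L d f (P : nn M -> Prop) n : dec (fun g : model_env M [:: N] => P (hd g)) ->
    ~ P n -> sfam (merge_fam L d f P) n = lam (fun i => sap f (npair n i)).
  move=> dP Pn; apply: m_ext => i; rewrite sfam_mkfam ?condF //; last exact: repf.
  by rewrite beta //; rep_tac.
have db d : dec (fun g : model_env M [:: N] => mbit d (hd g) = 1).
  by apply: dec_eq; [apply: (rep_comp (rep_mbit d))|]; rep_tac.
have below_trans c d e : below c d -> below d e -> below c e.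
  move=> [h1 h2] [h3 h4]; split=> [|n nc bc]; first exact: le_trans h1 h3.
  by apply: h4; [apply: lt_le_trans nc h1|apply: h2].
have [||||y [hy conv]] := @Mct_all below F mct dec_below _ below_trans.
- by split=> //; rewrite lexx.
- move=> d e; pose L := cond (slen d <=^ slen e) (slen e) (slen d).
  have dL : slen d <=^ L.
    rewrite /L; case: (pselect (slen d <=^ slen e)) => h; first by rewrite condT.
    by rewrite condF.
  have eL : slen e <=^ L.
    rewrite /L; case: (pselect (slen d <=^ slen e)) => h; first by rewrite condT.
    by rewrite condF //; case: (leP (slen d) (slen e)) h => // /ltW.
  pose f : dom M ty1 := lam (fun k => sap (sfam e (nfst k)) (nsnd k)).
  have fE n : lam (fun i => sap f (npair n i)) = sfam e n.
    apply: m_ext => i; rewrite beta; last by rep_tac.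
    rewrite /f beta ?nfst_pair ?nsnd_pair //.
    by apply: rep_app; [apply: (rep_comp2 (rep_sfam0 M))|]; rep_tac.
  exists (merge_fam L d f (fun n => mbit d n = 1)); split.
  + split=> [|n nd bd]; first by rewrite slenE.
    apply/mbit_eq1; rewrite slenE // sfamT //.
    by split; [apply: lt_le_trans nd dL|have /mbit_eq1 [] := bd].
  + split=> [|n ne be]; first by rewrite slenE.
    apply/mbit_eq1; rewrite slenE //; split; first exact: lt_le_trans ne eL.
    case: (pselect (mbit d n = 1)) => bd; first by rewrite sfamT //; have /mbit_eq1 [] := bd.
    by rewrite sfamF // fE; have /mbit_eq1 [] := be.
- move=> d; apply: In_unit_intro => [|n]; first by rewrite FE; apply: Real_const.
  by rewrite rqF hval_ge0 hval_le1 //; [apply: rep_mbit|apply: mbit_binary].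
- move=> d e [h1 h2] n; rewrite !rqF.
  have h3 := hval_mono (rep_mbit d) (@mbit_binary d) h1.
  have : hval (mbit d) (slen e) <= hval (mbit e) (slen e).
    apply: hval_cmp; [exact: rep_mbit|exact: rep_mbit|].
    move=> j _; apply: fnat_mbit => bd; apply: (h2) => //.
    by have /mbit_eq1 [] := bd.
  by have := ip_gt0 n; lra.
exists (real_digit y); split; [exact: rep_real_digit|exact: real_digit_binary|move=> n].
(* This precision is 4 ^ (- n - 1) / 16, the tolerance in [real_digit_correct]. *)
have [d hd'] := conv (n + 1 + (n + 1) + 1 + 1 + 1 + 1).
have good e : below d e -> n <^ slen e -> real_digit y n = mbit e n.
  move=> de ne; have [||] := @near_const M (rq y) (hval (mbit e) (slen e)) (n + 1 + (n + 1) + 1 + 1 + 1 + 1).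
  - exact: Real_Reg.
  - by have := hd' e de; rewrite rqF.
  have -> : ip (n + 1 + (n + 1) + 1 + 1 + 1 + 1) = ip (n + 1 + (n + 1)) / 16 :> fraction M.
    by rewrite !ip_S; field.
  move=> hge hle; apply: real_digit_correct (lexx n); [exact: rep_mbit|exact: mbit_binary| |].
  - apply: Ge_trans hge; rewrite lerD2r; apply: hval_mono; [exact: rep_mbit|exact: mbit_binary|].
    by rewrite nn_leS.
  - apply: Le_trans hle; rewrite lerD2r; apply: hval_ub; [exact: rep_mbit|exact: mbit_binary].
pose L := slen d + (n + 1).
pose z := default M ty1.
have nL : n <^ L by rewrite -nn_leS /L [slen d + _]addrC nn_leDr.
have dT (P : Prop) : dec (fun g : model_env M [:: N] => P) by apply: dec_const.
(* The family d, prolonged so that position n counts. *)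
pose e0 := merge_fam L d z (fun _ => True).
have de0 : below d e0.
  split=> [|j jd bd]; first by rewrite slenE // nn_leDr.
  apply/mbit_eq1; rewrite slenE // sfamT //; have /mbit_eq1 [_ ->] := bd; split=> //.
  by apply: lt_le_trans jd _; apply: nn_leDr.
split=> [|[f hf]].
  by rewrite (good e0) ?slenE // => /mbit_eq1 [_ h]; exists (sfam e0 n).
case: (pselect (mbit e0 n = 1)) => [b0|b0]; first by rewrite (good e0) ?slenE.
pose f' : dom M ty1 := lam (fun k => sap f (nsnd k)).
have f'E : lam (fun i => sap f' (npair n i)) = f.
  apply: m_ext => i; rewrite beta; last by rep_tac.
  by rewrite /f' beta ?nsnd_pair //; rep_tac.
(* The exchange: only the n-th function is replaced. Nothing is lost, because n was not witnessed in
   [e0]. *)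
pose e1 := merge_fam L e0 f' (fun j => j <> n).
have dn : dec (fun g : model_env M [:: N] => hd g <> n) by rep_tac.
have e01 : below e0 e1.
  split=> [|j jd bd]; first by rewrite !slenE.
  apply/mbit_eq1; move: (bd) jd; rewrite mbit_eq1 !slenE // => -[h1 h2] _; split=> //.
  by rewrite sfamT // => e; apply: b0; rewrite -e.
rewrite (good e1) ?slenE //; last exact: below_trans de0 e01.
by apply/mbit_eq1; rewrite slenE // sfamF ?f'E //; apply.
Qed.

End MctBoot.

Theorem Mct_Boot (M : model) : Mct M -> Boot M.
Proof. by move=> mct; apply/Boot_iff => Y; apply: Mct_BOOT_for. Qed.

(** * Comprehension from BOOT *)

Lemma sat_fsubst (S : structure) (rho : valuation (dom S)) (f : subst) p :
  sat rho (fsubst f p) <-> sat (fun s n => eval rho (f s n)) p.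
Proof.
have ev (r : valuation (dom S)) g s (t : term s) :
    eval r (tsubst g t) = eval (fun s n => eval r (g s n)) t.
  by elim: t => //= ? ? u -> v ->.
elim: p rho f => [a b|a b||p IHp q IHq|s p IHp] rho f //=; rewrite ?ev //.
  by rewrite IHp IHq.
suff e (a : dom S s) : (fun t n => eval (push a rho) (up s f t n)) =
    push a (fun t n => eval rho (f t n)).
  by split=> h a; have := h a; rewrite IHp e.
have shiftE : (fun u m => eval (push a rho) (shift s u m)) = rho.
  apply: valuation_ext => u m.
  case: (ty_eq_dec s u) => [e|ne]; last by rewrite shift_neq //= push_neq.
  by subst u; rewrite shift_same /= pushS.
apply: valuation_ext => t n; symmetry; move: t n; apply: (push_ind (D := dom S)
  (P := fun t n b => b = eval (push a rho) (up s f t n))) => [|n|t n ne].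
- by rewrite /up scons0 /= push0.
- by rewrite /up sconsS ev shiftE.
- by rewrite /up scons_neq // ev shiftE.
Qed.

Lemma sat_comprehension (M : model) (rho : valuation (dom M)) p :
  sat rho (comprehension p) <-> exists X : dom M ty1, binary (fun n => sap X n) /\
    forall n : nn M, sap X n = 1 <-> sat (push (n : dom M N) rho) p.
Proof.
have setE X : sat (push X rho) (is_set (fun _ => Var ty1 0) (fun _ => O)) <->
    binary (fun n : nn M => sap X n).
  rewrite -Is_set_binary; pose t := Defs.App (Var ty1 0) (Var N 0).
  have orE (n : nn M) : sat (push (n : dom M N) (push X rho))
      (Or (Lt t (Con COne)) (Eq t (Con COne))) <-> slt (sap X n) 1 \/ seqv (sap X n) 1.
    exact: sat_Or.
  by split=> h n; apply/orE; apply: h.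
suff bodyE (X : dom M ty1) (n : nn M) : sat (push (n : dom M N) (push X rho))
    (Iff (Eq (Defs.App (Var ty1 0) (Var N 0)) (Con COne)) (fshift ty1 p)) <->
    (sap X n = 1 <-> sat (push (n : dom M N) rho) p).
  rewrite sat_Ex; split=> -[X].
    by move=> /sat_And [/setE h1 h2]; exists X; split=> // n; apply/bodyE; apply: h2.
  by move=> [/setE h1 h2]; exists X; apply/sat_And; split=> // n; apply/bodyE; apply: h2.
rewrite sat_Iff.
have -> : sat (push (n : dom M N) (push X rho)) (fshift ty1 p) <->
    sat (push (n : dom M N) rho) p.
  rewrite /fshift sat_fsubst; suff -> : (fun s (i : nat) => eval (push (n : dom M N) (push X rho))
    (shift ty1 s i)) = push (n : dom M N) rho by [].
  apply: valuation_ext => t i; case: (ty_eq_dec ty1 t) => [e|ne].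
    by subst t; rewrite shift_same /= push_neq // pushS push_neq.
  rewrite shift_neq //=; case: (ty_eq_dec N t) => [e|ne'].
    by subst t; case: i => [|i]; rewrite ?push0 // !pushS push_neq.
  by rewrite !push_neq.
by have -> : sat (push (n : dom M N) (push X rho))
    (Eq (Defs.App (Var ty1 0) (Var N 0)) (Con COne)) <-> sap X n = 1 by exact: m_eq.
Qed.

Section Comprehension.

Variable M : model.
Hypothesis boot : Boot M.
Implicit Types (n m k i j : nn M) (f x y : dom M ty1).

Lemma boot_ex (P : nn M -> dom M ty1 -> Prop) :
  dec (fun g : model_env M [:: ty1; N] => P (hd (tl g)) (hd g)) ->
  dec (fun g : model_env M [:: N] => exists f, P (hd g) f).
Proof.
move=> dP; have [X [hX _ HX]] := iffLR (Boot_iff M) boot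
  (lam (fun f => lam (fun n => cond (P n f) 0 1))).
apply: (@dec_equiv _ _ (fun g => X (hd g) = 1)).
  by apply: dec_eq => //; apply: rep_const.
move=> g; rewrite HX; suff h f : sap (sap (lam (fun f => lam (fun n => cond (P n f) 0 1))) f) (hd g) = 0 <-> P (hd g) f.
  by split=> -[f /h]; exists f.
rewrite beta; last first.
  apply: rep_lam; apply: rep_cond; [|by rep_tac|by rep_tac].
  by apply: (dec_comp2 dP); rep_tac.
rewrite beta; last by apply: rep_cond; [apply: (dec_comp2 dP)| |]; rep_tac.
case: (pselect (P (hd g) f)) => h; [rewrite condT //|rewrite condF //].
by split=> // /eqP; rewrite oner_eq0.
Qed.

Lemma boot_exN (P : nn M -> nn M -> Prop) :
  dec (fun g : model_env M [:: N; N] => P (hd (tl g)) (hd g)) ->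
  dec (fun g : model_env M [:: N] => exists m, P (hd g) m).
Proof.
move=> dP; apply: (@dec_equiv _ _ (fun g => exists f : dom M ty1, P (hd g) (sap f 0))).
  by apply: (boot_ex (P := fun n f => P n (sap f 0))); apply: (dec_comp2 dP); rep_tac.
move=> g; split=> [[f h]|[m h]]; first by exists (sap f 0).
by exists (lam (fun _ => m)); rewrite beta //; rep_tac.
Qed.

Lemma boot_allN (P : nn M -> nn M -> Prop) :
  dec (fun g : model_env M [:: N; N] => P (hd (tl g)) (hd g)) ->
  dec (fun g : model_env M [:: N] => forall m, P (hd g) m).
Proof.
move=> dP; apply: (@dec_equiv _ _ (fun g => ~ exists m, ~ P (hd g) m)).
  by apply: dec_not; apply: (boot_exN (P := fun n m => ~ P n m)); apply: dec_not.
move=> g; split=> [h m|h [m]]; last exact.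
by apply: contrapT => h'; apply: h; exists m.
Qed.

(** The quantified number is paired with the parameter on which the values of
    the number variables depend. *)
Lemma dec_arithmetical p (V : nn M -> valuation (dom M)) : arithmetical p ->
  (forall i : nat, rep (fun g : model_env M [:: N] => V (hd g) N i)) ->
  (forall w w' (i : nat), V w ty1 i = V w' ty1 i) ->
  dec (fun g : model_env M [:: N] => sat (V (hd g)) p).
Proof.
have repV (V' : nn M -> valuation (dom M)) s (t : term s) : low_vars t ->
    (forall i : nat, rep (fun g : model_env M [:: N] => V' (hd g) N i)) ->
    (forall w w' (i : nat), V' w ty1 i = V' w' ty1 i) ->
    rep (fun g : model_env M [:: N] => eval (V' (hd g)) t).
  elim: t => {s} [s i|s c|s r u IHu v IHv] /=.
  - by case=> -> h1 h2 //; apply: rep_ext (rep_const _ (V' 0 ty1 i)) => g.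
  - by move=> _ _ _; apply: rep_const.
  - by move=> [hu hv] h1 h2; apply: rep_app; [apply: IHu|apply: IHv].
elim: p V => [a b|a b||p IHp q IHq|s p IHp] V /= ar h1 h2.
- have [ha hb] := ar; apply: (@dec_equiv _ _ (fun g => eval (V (hd g)) a = eval (V (hd g)) b)).
    by apply: dec_eq; apply: repV.
  by move=> g; rewrite m_eq.
- have [ha hb] := ar; apply: (@dec_equiv _ _ (fun g => eval (V (hd g)) a <^ eval (V (hd g)) b)).
    by apply: dec_lt; apply: repV.
  by move=> g; rewrite nn_ltE.
- exact: dec_const.
- by have [hp hq] := ar; apply: dec_imp; [apply: IHp|apply: IHq].
have [e hp] := ar; subst s.
pose V' u := push (nsnd u : dom M N) (V (nfst u)).
have dV : dec (fun g : model_env M [:: N] => sat (V' (hd g)) p).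
  apply: IHp => // [[|i]|w w' i].
  - apply: (@rep_ext _ _ _ (fun g => nsnd (hd g))); last by rep_tac.
    by move=> g; rewrite /V' push0.
  - apply: (@rep_ext _ _ _ (fun g => V (nfst (hd g)) N i)).
      by move=> g; rewrite /V' pushS.
    by apply: (rep_comp (e := fun w => V w N i)) => //; rep_tac.
  - by rewrite /V' !push_neq.
apply: (@dec_equiv _ _ (fun g => forall v, sat (V' (npair (hd g) v)) p)).
  apply: (boot_allN (P := fun n v => sat (V' (npair n v)) p)).
  by apply: (dec_comp (P := fun u => sat (V' u) p)) => //; rep_tac.
by move=> g; split=> h v; have := h v; rewrite /V' nfst_pair nsnd_pair.
Qed.

Lemma boot_ACA0 q (rho : valuation (dom M)) : ACA0 q -> sat rho q.
Proof.
move=> [p ar ->]; apply/sat_comprehension.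
have dp : dec (fun g : model_env M [:: N] => sat (push (hd g : dom M N) rho) p).
  apply: (dec_arithmetical (V := fun w => push (w : dom M N) rho)) => // -[|i].
  - by apply: (@rep_ext _ _ _ (fun g => hd g)); [move=> g; rewrite push0|rep_tac].
  - apply: (@rep_ext _ _ _ (fun g => rho N i)); first by move=> g; rewrite pushS.
    exact: rep_const.
pose c n : nn M := cond (sat (push (n : dom M N) rho) p) 1 0.
have hc : repN1 c by apply: rep_cond => //; rep_tac.
exists (lam c); split=> n /=; rewrite beta //; first exact: cond_binary.
by rewrite cond_eq1.
Qed.

End Comprehension.

(** * Suprema from BOOT *)

Section Supremum.

Variable M : model.
Hypothesis boot : Boot M.
Implicit Types (n m k i j : nn M) (f x y : dom M ty1).

(** Prefixing a number to a function bundles a numerical and a functional witness, so that one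
    function quantifier covers both. *)
Definition ftl f : dom M ty1 := lam (fun i => sap f (i + 1)).
Definition fcons m f : dom M ty1 := lam (fun k => cond (k = 0) m (sap f (nn_pred k))).

Lemma rep_ftl0 : rep (fun g : model_env M [:: ty1] => ftl (hd g)).
Proof. by rewrite /ftl; rep_tac. Qed.

Lemma fcons0 m f : sap (fcons m f) 0 = m.
Proof. by rewrite /fcons beta ?condT //; rep_tac. Qed.

Lemma ftl_cons m f : ftl (fcons m f) = f.
Proof.
apply: m_ext => i; rewrite /ftl beta; last by rep_tac.
rewrite /fcons beta; last by rep_tac.
by rewrite condF ?nn_predS //; apply: nn_S_neq0.
Qed.

Lemma not_Le_witness (X : nn M -> fraction M) q : ~ Le X q <-> exists m, q + ip m < X m.
Proof.
split=> [h|[m hm] h]; last by have := h m; lra.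
apply: contrapT => h'; apply: h => m; rewrite leNgt; apply/negP => hm.
by apply: h'; exists m; lra.
Qed.

Variables (H : dom M (Arr ty1 ty1)) (G : dom M ty1 -> Prop).
Hypothesis G_dec : dec (fun g : model_env M [:: ty1] => G (hd g)).
Hypothesis H_unit : forall f, G f -> In_unit (sap H f).
Hypothesis G_nonempty : exists f, G f.

Let exceeds n j : Prop := exists f, G f /\ ~ Le (rq (sap H f)) (fnat j * ip n).

(** That a real exceeds a fraction has a numerical witness; carried as the head of the function, it
    leaves a single existential quantifier over a decidable matrix, as BOOT requires. *)
Let exceeds_dec : dec (fun g : model_env M [:: N; N] => exceeds (hd (tl g)) (hd g)).
Proof.
pose Q c f := G (ftl f) /\
  fnat (nsnd c) * ip (nfst c) + ip (sap f 0) < rq (sap H (ftl f)) (sap f 0).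
have dQ : dec (fun g : model_env M [:: N] => exists f, Q (hd g) f).
  have ht : rep (fun g : model_env M [:: ty1; N] => ftl (hd g)).
    by apply: (rep_comp rep_ftl0); rep_tac.
  apply: boot_ex => //; apply: dec_and; first exact: (dec_comp G_dec).
  by rewrite /rq; apply: dec_ltq; rep_tac.
apply: (@dec_equiv _ _ (fun g => exists f, Q (npair (hd (tl g)) (hd g)) f)).
  by apply: (dec_comp (P := fun c => exists f, Q c f)) => //; rep_tac.
move=> g; rewrite /Q nfst_pair nsnd_pair; split=> -[f [h1 h2]].
  by exists (ftl f); split=> //; apply/not_Le_witness; exists (sap f 0).
by have [m hm] := iffLR (not_Le_witness _ _) h2; exists (fcons m f); rewrite ftl_cons fcons0.
Qed.

(** The supremum lies between J n and J n + 1 in units of 2 ^ (- n); since the values lie in [0, 1],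
    the search may stop at 2 ^ n. *)
Let J n : nn M := bmin (fun j => ~ exceeds n (j + 1)) (npow2 n).

Let rep_J : repN1 J.
Proof.
apply: rep_bmin; last by rep_tac.
by apply: dec_not; apply: (dec_comp2 exceeds_dec); rep_tac.
Qed.

Let J_spec n : ~ exceeds n (J n + 1) /\ (J n = 0 \/ exceeds n (J n)).
Proof.
have dJ : dec (fun g : model_env M [:: N] => ~ exceeds n (hd g + 1)).
  by apply: dec_not; apply: (dec_comp2 exceeds_dec); rep_tac.
have [z ez] : exists z, npow2 n = z + 1.
  have : 0 + 1 <=^ npow2 n by rewrite nn_leS npow2_gt0.
  by move=> /nn_le_exists [z ->]; exists z; rewrite add0r addrC.
have zP : ~ exceeds n (z + 1).
  move=> [f [Gf h]]; apply: h; rewrite -ez mulrC ip_mul.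
  have [hr [_ h]] := H_unit Gf.
  exact: (iffLR (Leq_Le _ (Real_Reg hr)) h).
have zb : z <^ npow2 n by rewrite ez nn_ltxS.
split; first exact: (@bmin_P M (fun j => ~ exceeds n (j + 1)) dJ _ z zb zP).
case: (nn_case (J n)) => [|e]; [by left|right].
have [_ h _] := @bmin_spec M (fun j => ~ exceeds n (j + 1)) dJ (npow2 n).
rewrite e; apply: contrapT; apply: h.
by rewrite -[bmin _ _]/(J n) {2}e nn_ltxS.
Qed.

Let J_ub n f : G f -> Le (rq (sap H f)) ((fnat (J n) + 1) * ip n).
Proof.
move=> Gf; apply: contrapT => h; have [nex _] := J_spec n; apply: nex.
by exists f; rewrite fnatD fnat1.
Qed.

Let J_lb n : exists f, G f /\ Ge (rq (sap H f)) (fnat (J n) * ip n).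
Proof.
have [_ [->|[f [Gf h]]]] := J_spec n.
  have [f Gf] := G_nonempty; exists f; split=> //; rewrite fnat0 mul0r.
  have [hr [h _]] := H_unit Gf.
  exact: (iffLR (Leq_Ge _ (Real_Reg hr)) h).
exists f; split=> //; have [hr _] := H_unit Gf.
have [h'|h'] := @Le_or_Ge M (rq (sap H f)) (fnat (J n) * ip n) (Real_Reg hr).
  by case: (h h').
exact: h'.
Qed.

(** A value above the lower estimate at level n is bounded by the upper estimate at level m.
    Strictness is needed for the strict inequality in [Real]. *)
Let J_cross n m : fnat (J n) * ip n < (fnat (J m) + 1) * ip m.
Proof.
have [_ [->|[f [Gf h]]]] := J_spec n.
  rewrite fnat0 mul0r; apply: mulr_gt0; last exact: ip_gt0.
  by have := fnat_ge0 (J m); lra.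
rewrite ltNge; apply/negP => h'; apply: h; exact: Le_trans h' (J_ub m Gf).
Qed.

Let y : dom M ty1 := lam (fun n => qcode (J n) 0 (npow2 n)).

Let rq_y n : rq y n = fnat (J n) * ip n.
Proof.
rewrite /rq beta; last by apply: rep_qcode; [exact: rep_J|rep_tac|rep_tac].
by rewrite qval_code ?npow2_gt0 // fnat0 subr0.
Qed.

Let Real_y : Real y.
Proof.
move=> n i; rewrite !rq_y ltr_norml.
have := J_cross n (n + i); have := J_cross (n + i) n; rewrite !mulrDl !mul1r.
have := ip_le (nn_leDr n i).
by move=> h1 h2 h3; apply/andP; split; lra.
Qed.

Lemma boot_sup : exists y, [/\ Real y, (forall f, G f -> Leq (rq (sap H f)) (rq y)) &
  forall k, exists f, G f /\ ~ Leq (rq (sap H f)) (Sub (rq y) (fun _ => ip k))].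
Proof.
exists y; split=> // [f Gf n|k].
  by have := J_ub n Gf n; rewrite rq_y mulrDl; lra.
(* At level k + 1 the two estimates differ by half of the allowed 2 ^ (- k), so the inequality
   becomes strict. *)
have [f [Gf hf]] := J_lb (k + 1); exists f; split=> //.
have hr : Reg (rq (sap H f)) by apply: Real_Reg; have [] := H_unit Gf.
have hy := Real_Reg Real_y.
set q := (fnat (J (k + 1)) + 1) * ip (k + 1).
have le_q : Le (rq y) q.
  by move=> m; rewrite rq_y /q; have := J_cross m (k + 1); have := ip_gt0 m; lra.
have lt : q - ip k < fnat (J (k + 1)) * ip (k + 1).
  by have := ip_gt0 (k + 1); rewrite /q (ip_half k) mulrDl; lra.
exact: (not_Leq_intro hr (Reg_Sub hy (Reg_const (ip k))) lt (Sub_ip_Le k hy le_q) hf).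
Qed.

End Supremum.

(** The limit is the supremum y of the net: if the value at d exceeds y - 2 ^ (- k - 1), then by
    monotonicity so do all later ones, and none exceeds y. *)
Theorem Boot_Mct (M : model) : Boot M -> Mct M.
Proof.
move=> boot D P F [D1 [P1 [[d0 D0] [P_refl [P_trans P_dir]]]]] [F_unit F_incr].
have [] := @boot_sup M boot F (fun d => sap D d = 1) _ _ _.
- by rep_tac.
- by move=> d /m_eq; apply: F_unit.
- by exists d0; apply/m_eq.
move=> y [hy ub lb]; exists y; split=> // k.
have [d [Dd hd']] := lb (k + 1); exists d; split; first exact/m_eq.
have regF e : sap D e = 1 -> Reg (rq (sap F e)).
  by move=> /m_eq /F_unit [h _]; apply: Real_Reg.
have regy := Real_Reg hy.
have regS : Reg (Sub (rq y) (fun _ => ip (k + 1))).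
  exact: Reg_Sub regy (Reg_const _).
have [q [r [qr hq hr]]] := not_Leq (regF _ Dd) regS hd'.
have {}hq := Le_Sub_ip regy hq.
move=> e /m_eq De /m_eq de.
have hre : Ge (rq (sap F e)) r.
  have le_de : Leq (rq (sap F d)) (rq (sap F e)) by apply: F_incr; apply/m_eq.
  exact: (iffLR (Leq_by_Ge (regF _ Dd) (regF _ De)) le_de r hr).
have le_ey := ub e De.
have regA : Reg (Abs (Sub (rq (sap F e)) (rq y))).
  exact: Reg_Abs (Reg_Sub (regF _ De) regy).
have lt : ip (k + 1) < ip k :> fraction M.
  by have := ip_gt0 (k + 1); rewrite (ip_half k); lra.
refine (@not_Leq_intro M (fun _ => ip k) _ _ _ (Reg_const (ip k)) regA lt _ _).
- move=> n; rewrite /Abs /Sub lerBlDr ler_norml.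
  have := le_ey (n + 1); have := hre (n + 1); have := hq (n + 1).
  have := ip_gt0 (k + 1); have := ip_gt0 n; rewrite !ip_S => h1 h2 h3 h4 h5.
  by apply/andP; split; lra.
- by move=> n; have := ip_gt0 n; lra.
Qed.

(** * Reals as paths through dyadic intervals *)

Section Paths.

Variable M : model.
Implicit Types (n m k i j p z : nn M) (f x y : dom M ty1) (live : nn M -> nn M -> Prop).

(** The [j]-th of the [2 ^ n] dyadic intervals of length [2 ^ (- n)]. *)
Definition in_cell x n j : Prop :=
  Ge (rq x) (fnat j * ip n) /\ Le (rq x) ((fnat j + 1) * ip n).

(** The sequence [f] chooses between the left and the right half, but is
    overruled when the chosen half is not live. *)
Definition path live f n : nn M := natrec 0 (fun i p =>
  cond (sap f i = 0)
    (cond (live (i + 1) (p + p)) (p + p) (p + p + 1))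
    (cond (live (i + 1) (p + p + 1)) (p + p + 1) (p + p))) n.

Definition path_real live f : dom M ty1 :=
  lam (fun n => qcode (path live f n) 0 (npow2 n)).

Section FixedTree.

Variable live : nn M -> nn M -> Prop.
Hypothesis live_dec : dec (fun g : model_env M [:: N; N] => live (hd (tl g)) (hd g)).

Lemma rep_path0 : rep (fun g : model_env M [:: N; ty1] => path live (hd (tl g)) (hd g)).
Proof.
rewrite /path; apply: rep_natrec; [by rep_tac|by rep_tac|].
apply: rep_cond; first by rep_tac.
  apply: rep_cond; [|by rep_tac|by rep_tac].
  by apply: (dec_comp2 live_dec); rep_tac.
apply: rep_cond; [|by rep_tac|by rep_tac].
by apply: (dec_comp2 live_dec); rep_tac.
Qed.

Lemma rep_path f : repN1 (path live f).
Proof. by apply: (rep_comp2 rep_path0); rep_tac. Qed.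

Lemma rep_path_real0 : rep (fun g : model_env M [:: ty1] => path_real live (hd g)).
Proof.
apply: rep_lam; apply: rep_qcode; [|by rep_tac|by rep_tac].
by apply: (rep_comp2 rep_path0); rep_tac.
Qed.

Lemma path0 f : path live f 0 = 0.
Proof. exact: natrec0. Qed.

Lemma pathS f n (p := path live f n) : path live f (n + 1) =
  cond (sap f n = 0)
    (cond (live (n + 1) (p + p)) (p + p) (p + p + 1))
    (cond (live (n + 1) (p + p + 1)) (p + p + 1) (p + p)).
Proof.
rewrite /path natrecS //.
apply: rep_cond; first by rep_tac.
  apply: rep_cond; [|by rep_tac|by rep_tac].
  by apply: (dec_comp2 live_dec); rep_tac.
apply: rep_cond; [|by rep_tac|by rep_tac].
by apply: (dec_comp2 live_dec); rep_tac.
Qed.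

Lemma pathS_cases f n (p := path live f n) :
  path live f (n + 1) = p + p \/ path live f (n + 1) = p + p + 1.
Proof.
rewrite pathS -/p; case: (pselect (sap f n = 0)) => h; [rewrite (condT _ _ h)|rewrite (condF _ _ h)].
  case: (pselect (live (n + 1) (p + p))) => h'; [rewrite (condT _ _ h')|rewrite (condF _ _ h')].
    by left.
  by right.
case: (pselect (live (n + 1) (p + p + 1))) => h'; [rewrite (condT _ _ h')|rewrite (condF _ _ h')].
  by right.
by left.
Qed.

Lemma rq_path_real f n : rq (path_real live f) n = fnat (path live f n) * ip n.
Proof.
rewrite /rq /path_real beta; last first.
  by apply: rep_qcode; [exact: rep_path|rep_tac|rep_tac].
by rewrite qval_code ?npow2_gt0 // fnat0 subr0.
Qed.

Lemma path_le f n k : fnat (path live f n) * ip n <= fnat (path live f (n + k)) * ip (n + k) /\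
  fnat (path live f (n + k)) * ip (n + k) <= (fnat (path live f n) + 1) * ip n - ip (n + k).
Proof.
have hq (a : model_env M [:: N] -> nn M) : rep a -> rep (fun g => path live f (a g)).
  exact: (rep_comp (rep_path f)).
move: k; apply: nn_ind => [||k [h1 h2]].
- have hk : rep (fun g : model_env M [:: N] => path live f (n + hd g)) by apply: hq; rep_tac.
  by rep_tac.
- by rewrite addr0; split; lra.
- have -> : n + (k + 1) = n + k + 1 by rewrite addrA.
  move: h1 h2; have -> : fnat (path live f (n + k)) * ip (n + k) =
      (fnat (path live f (n + k)) + fnat (path live f (n + k))) * ip (n + k + 1).
    by rewrite ip_S; field.
  have := ip_gt0 (n + k); rewrite (ip_half (n + k)) => h3.
  by case: (pathS_cases f (n + k)) => ->; rewrite ?fnatD ?fnat1 => h1 h2; split; lra.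
Qed.

Lemma Real_path f : Real (path_real live f).
Proof.
move=> n k; rewrite !rq_path_real ltr_norml; have [h1 h2] := path_le f n k.
by have := ip_gt0 (n + k); have := ip_gt0 n => h3 h4; apply/andP; split; lra.
Qed.

Lemma In_unit_path f : In_unit (path_real live f).
Proof.
apply: In_unit_intro => [|n]; first exact: Real_path.
rewrite rq_path_real; apply/andP; split.
  by apply: mulr_ge0; [apply: fnat_ge0|apply: ltW; apply: ip_gt0].
have [_] := path_le f 0 n; rewrite add0r path0 fnat0 ip_0 add0r mulr1.
by have := ip_gt0 n; lra.
Qed.

Lemma in_cell_path f n : in_cell (path_real live f) n (path live f n).
Proof.
have reg := Real_Reg (Real_path f).
split=> m; have := reg n m; rewrite ler_norml rq_path_real => /andP [h1 h2].
- apply: ip_le_all1 => k.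
  have := reg (n + k) m; rewrite ler_norml rq_path_real => /andP [h3 h4].
  have [h5 h6] := path_le f n k; have := ip_le (nn_leDr k n); rewrite addrC => h7.
  by lra.
- rewrite lerBlDr; apply: ip_le_all1 => k.
  have := reg (n + k) m; rewrite ler_norml rq_path_real => /andP [h3 h4].
  have [h5 h6] := path_le f n k; have := ip_le (nn_leDr k n); rewrite addrC => h7.
  by have := ip_gt0 (n + k); lra.
Qed.

Lemma path_live f : live 0 0 ->
  (forall n j, live n j -> live (n + 1) (j + j) \/ live (n + 1) (j + j + 1)) ->
  forall n, live n (path live f n).
Proof.
move=> l0 lS; apply: nn_ind => [||n h].
- by apply: (dec_comp2 live_dec); [rep_tac|exact: rep_path].
- by rewrite path0.
rewrite pathS; set p := path live f n in h *.
case: (pselect (sap f n = 0)) => h0; [rewrite (condT _ _ h0)|rewrite (condF _ _ h0)].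
  case: (pselect (live (n + 1) (p + p))) => h'; [by rewrite (condT _ _ h')|rewrite (condF _ _ h')].
  by case: (lS n p h).
case: (pselect (live (n + 1) (p + p + 1))) => h'; [by rewrite (condT _ _ h')|rewrite (condF _ _ h')].
by case: (lS n p h).
Qed.

End FixedTree.

(** * Every real of the unit interval is presented by a path *)

Section Surjectivity.

Hypothesis boot : Boot M.

Lemma dec_Le_cell x : dec (fun g : model_env M [:: N; N] =>
  Le (rq x) (fnat (hd g) * ip (hd (tl g)))).
Proof.
have h : dec (fun g : model_env M [:: N] => forall m,
    rq x m - ip m <= fnat (nsnd (hd g)) * ip (nfst (hd g))).
  apply: (boot_allN boot (P := fun c m => rq x m - ip m <= fnat (nsnd c) * ip (nfst c))).
  by rewrite /rq; rep_tac.
apply: (@dec_equiv _ _ (fun g => forall m, rq x m - ip m <=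
    fnat (nsnd (npair (hd (tl g)) (hd g))) * ip (nfst (npair (hd (tl g)) (hd g))))).
  apply: (dec_comp (P := fun c => forall m, rq x m - ip m <= fnat (nsnd c) * ip (nfst c))).
    exact: h.
  by rep_tac.
by move=> g; rewrite nfst_pair nsnd_pair.
Qed.

Lemma dec_Ge_cell x : dec (fun g : model_env M [:: N; N] =>
  Ge (rq x) (fnat (hd g) * ip (hd (tl g)))).
Proof.
have h : dec (fun g : model_env M [:: N] => forall m,
    fnat (nsnd (hd g)) * ip (nfst (hd g)) <= rq x m + ip m).
  apply: (boot_allN boot (P := fun c m => fnat (nsnd c) * ip (nfst c) <= rq x m + ip m)).
  by rewrite /rq; rep_tac.
apply: (@dec_equiv _ _ (fun g => forall m,
    fnat (nsnd (npair (hd (tl g)) (hd g))) * ip (nfst (npair (hd (tl g)) (hd g))) <= rq x m + ip m)).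
  apply: (dec_comp (P := fun c => forall m, fnat (nsnd c) * ip (nfst c) <= rq x m + ip m)).
    exact: h.
  by rep_tac.
by move=> g; rewrite nfst_pair nsnd_pair.
Qed.

Lemma dec_in_cell x : dec (fun g : model_env M [:: N; N] => in_cell x (hd (tl g)) (hd g)).
Proof.
apply: dec_and; first exact: dec_Ge_cell.
apply: (@dec_equiv _ _ (fun g => Le (rq x) (fnat (hd g + 1) * ip (hd (tl g))))).
  by apply: (dec_comp2 (P := fun n j => Le (rq x) (fnat j * ip n)) (dec_Le_cell x)); rep_tac.
by move=> g; rewrite fnatD fnat1.
Qed.

Lemma in_cell_split x n j : Real x -> in_cell x n j ->
  (Le (rq x) (fnat (j + j + 1) * ip (n + 1)) -> in_cell x (n + 1) (j + j)) /\
  (~ Le (rq x) (fnat (j + j + 1) * ip (n + 1)) -> in_cell x (n + 1) (j + j + 1)).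
Proof.
move=> hx [h1 h2].
have e1 : fnat j * ip n = fnat (j + j) * ip (n + 1) by rewrite fnatD ip_S; field.
have e2 : (fnat j + 1) * ip n = (fnat (j + j + 1) + 1) * ip (n + 1).
  by rewrite !fnatD fnat1 ip_S; field.
rewrite e1 in h1; rewrite e2 in h2.
split=> h; split.
- exact: h1.
- by have -> : fnat (j + j) + 1 = fnat (j + j + 1) by rewrite [RHS]fnatD fnat1.
- have [h'|h'] := @Le_or_Ge M (rq x) (fnat (j + j + 1) * ip (n + 1)) (Real_Reg hx).
    by case: (h h').
  exact: h'.
- exact: h2.
Qed.

(** Go left exactly when x is at most the midpoint, a question decided by BOOT. The visited cells
    contain x and hence are live, so the choices are never overruled. *)
Lemma path_onto live x : dec (fun g : model_env M [:: N; N] => live (hd (tl g)) (hd g)) ->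
  In_unit x -> (forall n j, in_cell x n j -> live n j) ->
  exists f, forall n, in_cell x n (path live f n).
Proof.
move=> live_dec [hx [x0 x1]] hl.
have dLe := dec_Le_cell x.
pose low i p := Le (rq x) (fnat (p + p + 1) * ip (i + 1)).
have dlow : dec (fun g : model_env M [:: N; N] => low (hd (tl g)) (hd g)).
  apply: (dec_comp2 (P := fun n j => Le (rq x) (fnat j * ip n)) dLe); rep_tac.
pose q n := natrec 0 (fun i p => cond (low i p) (p + p) (p + p + 1)) n.
have rq_ : repN1 q.
  apply: rep_natrec; [by rep_tac|by rep_tac|].
  by apply: rep_cond; [apply: (dec_comp2 dlow)| |]; rep_tac.
have qS n : q (n + 1) = cond (low n (q n)) (q n + q n) (q n + q n + 1).
  rewrite /q natrecS //.
  by apply: rep_cond; [apply: (dec_comp2 dlow)| |]; rep_tac.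
have q_cell : forall n, in_cell x n (q n).
  apply: nn_ind => [||n h].
  - by apply: (dec_comp2 (dec_in_cell x)); [rep_tac|exact: rq_].
  - rewrite /q natrec0; split.
      by rewrite fnat0 mul0r; apply: (iffLR (Leq_Ge _ (Real_Reg hx)) x0).
    by rewrite fnat0 add0r ip_0 mulr1; apply: (iffLR (Leq_Le _ (Real_Reg hx)) x1).
  - rewrite qS; have [h1 h2] := in_cell_split hx h.
    case: (pselect (low n (q n))) => hlow; [rewrite (condT _ _ hlow)|rewrite (condF _ _ hlow)].
      exact: h1.
    exact: h2.
pose b n : nn M := cond (low n (q n)) 0 1.
have rb : repN1 b.
  apply: rep_cond; [|by rep_tac|by rep_tac].
  by apply: (dec_comp2 dlow); [rep_tac|exact: rq_].
exists (lam b) => n; suff -> : path live (lam b) n = q n by exact: q_cell.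
move: n; apply: nn_ind => [||n e].
- by apply: dec_eq; [exact: rep_path|exact: rq_].
- by rewrite path0 /q natrec0.
rewrite (pathS live_dec) e qS (beta n rb) /b; have [h1 h2] := in_cell_split hx (q_cell n).
case: (pselect (low n (q n))) => hlow.
  have hl' : live (n + 1) (q n + q n) by apply: hl; exact: h1.
  by rewrite !(condT _ _ hlow) (condT _ _ erefl) (condT _ _ hl').
have hl' : live (n + 1) (q n + q n + 1) by apply: hl; exact: h2.
have one0 : 1 <> 0 :> nn M by move=> /eqP; rewrite oner_eq0.
by rewrite !(condF _ _ hlow) (condF _ _ one0) (condT _ _ hl').
Qed.

Lemma in_cell_Eqr x y (q : nn M -> nn M) : Real x -> Real y ->
  (forall n, in_cell x n (q n)) -> (forall n, in_cell y n (q n)) -> Eqr (rq x) (rq y).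
Proof.
have half u v : Real u -> Real v -> (forall n, in_cell u n (q n)) ->
    (forall n, in_cell v n (q n)) -> Leq (rq u) (rq v).
  move=> hu hv h1 h2; apply: (iffRL (Leq_Reg (Real_Reg hu) (Real_Reg hv))) => n m.
  apply: ip_le_all1 => k.
  by have [_ /(_ n)] := h1 k; have [/(_ m)] := h2 k; rewrite !mulrDl; lra.
by move=> hx hy h1 h2; apply/Eqr_Leq; split; apply: half.
Qed.

Lemma path_real_onto live x :
  dec (fun g : model_env M [:: N; N] => live (hd (tl g)) (hd g)) ->
  In_unit x -> (forall n j, in_cell x n j -> live n j) ->
  exists f, Eqr (rq x) (rq (path_real live f)).
Proof.
move=> live_dec hx hl; have [f hf] := path_onto live_dec hx hl; exists f.
have [rx _] := hx.
exact: in_cell_Eqr rx (Real_path live_dec f) hf (in_cell_path live_dec f).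
Qed.

(** Turns a supremum over reals into one over functions: P has to be covered by K only up to
    equality of reals, which F respects. *)
Lemma boot_sup_image (P : dom M ty1 -> Prop) (K : dom M ty1 -> dom M ty1)
    (G : dom M ty1 -> Prop) F :
  rep (fun g : model_env M [:: ty1] => K (hd g)) ->
  dec (fun g : model_env M [:: ty1] => G (hd g)) ->
  (forall x, P x -> In_unit x) -> (forall f, G f -> P (K f)) ->
  (forall x, P x -> exists f, G f /\ Eqr (rq x) (rq (K f))) ->
  (exists x, P x) -> Fun_unit F -> Sup_exists P F.
Proof.
move=> rK dG Punit PK Konto [x0 Px0] [F1 F2].
pose H : dom M (Arr ty1 ty1) := lam (fun f => sap F (K f)).
have HE f : sap H f = sap F (K f).
  by rewrite /H beta //; apply: rep_app; [apply: rep_const|exact: rK].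
have [||y [hy ub lb]] := @boot_sup M boot H G dG.
- by move=> f Gf; rewrite HE; apply: F1; apply: Punit; apply: PK.
- by have [f [Gf _]] := Konto x0 Px0; exists f.
exists y; split; [exact: hy|split].
- move=> x Px; have [f [Gf xf]] := Konto x Px.
  have hxf : Eqr (rq (sap F x)) (rq (sap F (K f))).
    exact: F2 (Punit x Px) (Punit _ (PK f Gf)) xf.
  have [h1 _] := iffLR (Eqr_Leq _ _) hxf.
  have rx : Reg (rq (sap F x)) by apply: Real_Reg; have [] := F1 x (Punit x Px).
  have rf : Reg (rq (sap F (K f))).
    by apply: Real_Reg; have [] := F1 _ (Punit _ (PK f Gf)).
  have h2 := ub f Gf; rewrite HE in h2.
  exact: Leq_trans_Reg rx rf (Real_Reg hy) h1 h2.
- move=> k; have [f [Gf hf]] := lb k; exists (K f); split; first exact: PK.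
  by rewrite -HE.
Qed.

Theorem Boot_Sup_sets : Sup_sets M.
Proof.
move=> A F [[A1 A2] A_unit] A_ne F_unit.
pose live (n j : nn M) := True.
have dlive : dec (fun g : model_env M [:: N; N] => live (hd (tl g)) (hd g)).
  exact: dec_const.
pose K f := path_real live (ftl f).
(* The head of f names a precision at which positivity of A shows, which makes membership a
   decidable condition on f. *)
pose G f := ip (sap f 0) < rq (sap A (K f)) (sap f 0).
have rK : rep (fun g : model_env M [:: ty1] => K (hd g)).
  by apply: (rep_comp (rep_path_real0 dlive)); apply: (rep_comp (rep_ftl0 M)); rep_tac.
have pos x : Real x -> ~ Leq (rq (sap A x)) (fun _ => 0) <-> exists m, ip m < rq (sap A x) m.
  move=> hx; have rA := Real_Reg (A1 x hx).
  have -> : ~ Leq (rq (sap A x)) (fun _ => 0) <-> ~ Le (rq (sap A x)) 0.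
    by split=> h h'; apply: h; apply/(Leq_Le 0 rA).
  rewrite not_Le_witness; split=> -[m hm]; exists m; first by rewrite add0r in hm.
  by rewrite add0r.
apply: (@boot_sup_image (Mem A) K G).
- exact: rK.
- by rewrite /G /rq; apply: dec_ltq; rep_tac.
- exact: A_unit.
- move=> f Gf; split; first exact: Real_path.
  by apply/pos; [exact: Real_path|exists (sap f 0)].
- move=> x Ax; have [hx xpos] := Ax.
  have [f hf] := path_real_onto dlive (A_unit x Ax) (fun _ _ _ => I).
  have AE := A2 _ _ hx (Real_path dlive f) hf.
  have fpos : ~ Leq (rq (sap A (path_real live f))) (fun _ => 0).
    move=> h; apply: xpos; have [h1 _] := iffLR (Eqr_Leq _ _) AE.
    apply: Leq_trans_Reg h1 h.
    + exact: Real_Reg (A1 _ hx).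
    + exact: Real_Reg (A1 _ (Real_path dlive f)).
    + exact: Reg_const.
  have [m hm] := iffLR (pos _ (Real_path dlive f)) fpos.
  by exists (fcons m f); rewrite /G /K ftl_cons fcons0.
- exact: A_ne.
- exact: F_unit.
Qed.

End Surjectivity.

End Paths.

(** * Closed sets as bodies of pruned trees *)

Section ClosedSets.

Variable M : model.
Hypothesis boot : Boot M.
Variables a r : dom M ty1.
Implicit Types (n m k i j p z : nn M) (x y : dom M ty1).

Definition inside n j m : Prop :=
  (rq a m - rq r m < fnat j * ip n) /\ ((fnat j + 1) * ip n < rq a m + rq r m).

(** All subintervals of level [n + z] lie in one of the first [n + z] balls;
    by compactness, an interval meets the closed set iff this fails for all [z]. *)
Definition covered n j z : Prop := forall i, i <^ npow2 z ->
  exists m, (m <^ n + z + 1) /\ inside (n + z) (j * npow2 z + i) m.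

Definition alive n j : Prop := forall z, ~ covered n j z.

Lemma dec_alive : dec (fun g : model_env M [:: N; N] => alive (hd (tl g)) (hd g)).
Proof.
have h : dec (fun g : model_env M [:: N] => forall z, ~ covered (nfst (hd g)) (nsnd (hd g)) z).
  apply: (boot_allN boot (P := fun c z => ~ covered (nfst c) (nsnd c) z)).
  by rewrite /covered /inside /rq; rep_tac.
apply: (@dec_equiv _ _ (fun g => forall z,
    ~ covered (nfst (npair (hd (tl g)) (hd g))) (nsnd (npair (hd (tl g)) (hd g))) z)).
  apply: (dec_comp (P := fun c => forall z, ~ covered (nfst c) (nsnd c) z)).
    exact: h.
  by rep_tac.
by move=> g; rewrite nfst_pair nsnd_pair.
Qed.

Lemma nn_half i : exists h : nn M, i = h + h \/ i = h + h + 1.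
Proof.
suff [h [_ e]] : exists h, (h <^ i + 1) /\ (i = h + h \/ i = h + h + 1) by exists h.
move: i; apply: nn_ind => [||i [h [_ [->|->]]]].
- by rep_tac.
- by exists 0; split; [rewrite nn_ltS lexx|left; rewrite addr0].
- by exists h; split; [nn_lra|right].
- by exists (h + 1); split; [nn_lra|left; ring].
Qed.

Lemma covered_S n j z : covered n j z -> covered n j (z + 1).
Proof.
move=> cov i; rewrite npow2_S => iz; have [h hi] := nn_half i.
have hz : h <^ npow2 z.
  by case: hi => e; rewrite e in iz; move: (npow2 z) iz => P iz; nn_lra.
have [m [mz [h1 h2]]] := cov h hz; exists m; split.
  by rewrite addrA; apply: lt_le_trans mz (nn_leDr _ _).
rewrite addrA /inside ip_S; have := ip_gt0 (n + z); move: h1 h2.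
rewrite !(fnatD, fnatM) => h1 h2 h3.
by case: hi => ->; rewrite !(fnatD, fnat1); split; lra.
Qed.

Lemma covered_D n j z k : covered n j z -> covered n j (z + k).
Proof.
move=> cov; move: k; apply: nn_ind => [||k].
- by rewrite /covered /inside /rq; rep_tac.
- by rewrite addr0.
- by rewrite addrA; apply: covered_S.
Qed.

(** Coverings of both halves can be refined to a common depth z; together they cover the interval
    itself at depth z + 1, the subintervals of the right half being numbered from 2 ^ z on. *)
Lemma alive_split n j : alive n j -> alive (n + 1) (j + j) \/ alive (n + 1) (j + j + 1).
Proof.
move=> al; apply: contrapT => /not_orP [h1 h2].
have ex p : ~ alive (n + 1) p -> exists z, covered (n + 1) p z.
  by move=> h; apply: contrapT => h'; apply: h => z cov; apply: h'; exists z.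
have [z1 c1] := ex _ h1; have [z2 c2] := ex _ h2.
have {}c1 := covered_D (k := z2) c1; have {}c2 := covered_D (k := z1) c2.
rewrite [z2 + z1]addrC in c2; move: (z1 + z2) c1 c2 => z c1 c2.
apply: (al (z + 1)) => i; rewrite npow2_S => iz.
have e : n + (z + 1) = n + 1 + z by ring.
rewrite e; case: (ltP i (npow2 z)) => [h|/nn_le_exists [k ek]].
  have [m [hm hin]] := c1 i h; exists m; split; first exact: hm.
  by have <- : (j + j) * npow2 z + i = j * (npow2 z + npow2 z) + i by ring.
have kz : k <^ npow2 z by move: iz; rewrite ek [npow2 z + k]addrC nn_ltD2rE.
have [m [hm hin]] := c2 k kz; exists m; split; first exact: hm.
by have <- : (j + j + 1) * npow2 z + k = j * (npow2 z + npow2 z) + i by rewrite ek; ring.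
Qed.

Lemma in_cell_descend x n j z : Real x -> in_cell x n j ->
  exists i, (i <^ npow2 z) /\ in_cell x (n + z) (j * npow2 z + i).
Proof.
move=> hx hc; move: z; apply: nn_ind => [||z [i [iz hi]]].
- apply: dec_bex; last by rep_tac.
  by apply: (dec_comp2 (dec_in_cell boot x)); rep_tac.
- exists 0; split; first exact: npow2_gt0.
  by rewrite !addr0 npow2_0 mulr1.
have [h1 h2] := in_cell_split hx hi; rewrite addrA npow2_S.
have e : j * (npow2 z + npow2 z) + (i + i) = j * npow2 z + i + (j * npow2 z + i) by ring.
case: (pselect (Le (rq x) (fnat (j * npow2 z + i + (j * npow2 z + i) + 1) * ip (n + z + 1)))).
  move=> /h1 h; exists (i + i); split; last by rewrite e.
  by move: (npow2 z) iz => P iz; nn_lra.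
move=> /h2 h; exists (i + i + 1); split; last by rewrite addrA e.
by move: (npow2 z) iz => P iz; nn_lra.
Qed.

Lemma Reg_ball x m : Real x -> Reg (Abs (Sub (rq x) (fun _ => rq a m))).
Proof. by move=> hx; apply: Reg_Abs (Reg_Sub (Real_Reg hx) (Reg_const _)). Qed.

(** In a covered interval, x would lie in a subinterval strictly inside a removed ball. *)
Lemma alive_of_cell x n j : Mem_closed a r x -> in_cell x n j -> alive n j.
Proof.
move=> [[hx _] out] hc z cov.
have [i [iz [hlo hhi]]] := in_cell_descend z hx hc.
have [m [_ [h1 h2]]] := cov i iz.
have {out}hr := iffLR (Leq_Ge _ (Reg_ball m hx)) (out m).
move: hlo hhi h1 h2; move: (fnat _ * ip _) ((fnat _ + 1) * ip _) => lo hi hlo hhi h1 h2.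
(* w is the larger distance from the center to an end of the subinterval; it bounds the distance of
   x and is still below the radius. *)
have [w [w1 w2 w3]] : exists w, [/\ hi - rq a m <= w, rq a m - lo <= w & w < rq r m].
  case: (leP (hi - rq a m) (rq a m - lo)) => h; [exists (rq a m - lo)|exists (hi - rq a m)];
    by split; lra.
suff : rq r m <= w by lra.
apply: (@ip_le_all _ _ _ 2) => [|k]; first by lra.
have := hr k; have := hlo (k + 1); have := hhi (k + 1); rewrite /Abs /Sub.
have := ip_gt0 k; rewrite ip_S => h3 h4 h5 h6.
have : `|rq x (k + 1) - rq a m| <= w + ip k / 2.
  by rewrite ler_norml; apply/andP; split; lra.
by lra.
Qed.

(** If the point were strictly inside ball m, a small enough interval of its path would be inside
    too. It would be covered at depth 0, whereas the path runs through alive intervals only. *)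
Lemma Mem_closed_path f : alive 0 0 -> Mem_closed a r (path_real alive f).
Proof.
move=> al0; split; first exact: In_unit_path dec_alive f.
move=> m; apply: contrapT => hn.
have hx := Real_path dec_alive f.
have [q [s [qs hq hs]]] := not_Leq (Reg_const _) (Reg_ball m hx) hn.
have sr : s <= rq r m by apply: ip_le_all1 => k; have := hs k; lra.
have [k hk] : exists k, ip k < (rq r m - q) / 2.
  by apply: ip_small; apply: divr_gt0; lra.
(* Besides being large for the sake of precision, n has to be at least m, so that ball m is among
   those considered at level n + 1. *)
have {hk}[n [mn hn']] : exists n, (m <=^ n) /\ ip n < (rq r m - q) / 2.
  exists (m + k); split; first exact: nn_leDr.
  by apply: le_lt_trans hk; apply: ip_le; rewrite addrC nn_leDr.
have := hq n; rewrite /Abs /Sub rq_path_real; last exact: dec_alive.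
set p := path alive f (n + 1) => h.
have hp : alive (n + 1) p := path_live dec_alive f al0 alive_split (n + 1).
apply: (hp 0) => i; rewrite npow2_0 -[X in _ <^ X]add0r nn_ltS => i0.
have -> : i = 0 by apply: le_anti; rewrite i0 nn_ge0.
exists m; split; first by rewrite addr0 nn_ltS; apply: le_trans mn (nn_leDr _ _).
rewrite /inside !addr0 mulr1; move: h; rewrite lerBlDr ler_norml => /andP [h1 h2].
by have := ip_gt0 n; rewrite mulrDl mul1r ip_S in h1 h2 *; split; lra.
Qed.

End ClosedSets.

Theorem Boot_Sup_closed (M : model) : Boot M -> Sup_closed M.
Proof.
move=> boot a r F [x0 hx0] F_unit.
have dal := dec_alive boot a r.
have al0 : alive a r 0 0.
  apply: (alive_of_cell boot hx0); have [[hx [h1 h2]] _] := hx0; split.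
    by rewrite fnat0 mul0r; apply: (iffLR (Leq_Ge _ (Real_Reg hx)) h1).
  by rewrite fnat0 add0r ip_0 mulr1; apply: (iffLR (Leq_Le _ (Real_Reg hx)) h2).
apply: (@boot_sup_image M boot (Mem_closed a r) (path_real (alive a r)) (fun _ => True)).
- exact: rep_path_real0 dal.
- exact: dec_const.
- by move=> x [].
- by move=> f _; apply: Mem_closed_path.
- move=> x hx; have [hu _] := hx.
  have [f hf] := path_real_onto boot dal hu (fun n j => alive_of_cell boot hx (n := n) (j := j)).
  by exists f.
- by exists x0.
- exact: F_unit.
Qed.

(** * Comprehension from suprema *)

Section Sigma1.

Variable M : model.
Implicit Types (n m k i j : nn M) (x y : dom M ty1) (G : nn M -> nn M -> nn M).

Definition Sigma1_comprehension : Prop := forall G, repN2 G -> exists X : nn M -> nn M,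
  [/\ repN1 X, binary X & forall n, X n = 1 <-> exists m, G n m = 0].

Lemma ACA0_Sigma1 : (forall q rho, ACA0 q -> @sat M rho q) -> Sigma1_comprehension.
Proof.
move=> aca G hG.
pose v (i : nat) : tm N := fun _ => Var N i.
(* Under the two quantifiers, index 0 is the code, 1 is m and 2 is n. Only parameters of types 0 and
   1 are arithmetical, so G is turned into a function on codes of pairs. *)
pose paired := is_pair (v 0%N) (v 2%N) (v 1%N) (fun _ => 0%N).
pose zero := Eq (Defs.App (Var ty1 0) (Var N 0)) (Con CZero).
pose p := Ex N (Ex N (And paired zero)).
have ar : arithmetical p by cbv; tauto.
pose g : dom M ty1 := lam (fun c => G (nfst c) (nsnd c)).
have gE c : sap g c = G (nfst c) (nsnd c).
  by rewrite /g beta //; apply: (rep_comp2 hG); rep_tac.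
pose rho : valuation (dom M) := push g (some_valuation M).
have pE (n : nn M) : sat (push (n : dom M N) rho) p <-> exists m, G n m = 0.
  have body m c : sat (push (c : dom M N) (push (m : dom M N) (push (n : dom M N) rho)))
      (And paired zero) <-> npair n m = c /\ G (nfst c) (nsnd c) = 0.
    rewrite sat_And -gE.
    have -> : sat (push (c : dom M N) (push (m : dom M N) (push (n : dom M N) rho))) zero <->
        sap g c = 0 by exact: m_eq.
    have -> : sat (push (c : dom M N) (push (m : dom M N) (push (n : dom M N) rho))) paired <->
        c + c = (n + m) * ((n + m) + 1) + (m + m) by exact: m_eq.
    rewrite -npairE; move: (npair n m) => c'.
    by split=> -[h1 h2]; split=> //; [nn_lra|rewrite h1].
  rewrite sat_Ex; split=> -[m].
    by move=> /sat_Ex [c /body [<-]]; rewrite nfst_pair nsnd_pair; exists m.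
  move=> h; exists m; apply/sat_Ex; exists (npair n m); apply/body.
  by rewrite nfst_pair nsnd_pair.
have [X [X_set X_spec]] := iffLR (sat_comprehension rho p) (aca _ rho (ex_intro2 _ _ _ ar erefl)).
exists (fun n => sap X n); split=> // [|n]; first by rewrite /repN1; rep_tac.
by rewrite X_spec pE.
Qed.

Lemma qval_surj (q : fraction M) : exists c, qval c = q.
Proof. by have [c [_ h]] := repq_code (@repq_const M [::] q); exists (c tt). Qed.

Lemma In_unit_const c : 0 <= qval c -> qval c <= 1 -> In_unit (lam (fun _ : nn M => c)).
Proof.
by move=> h0 h1; apply: In_unit_intro => [|n]; [apply: Real_const|rewrite rq_const h0 h1].
Qed.

Lemma Fun_unit_id : Fun_unit (lam (fun x : dom M ty1 => x)).
Proof. by split=> [x|x y]; rewrite !beta //; rep_tac. Qed.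

(** The infimum of the [c k] is the supremum of their lower bounds in [0, 1],
    obtained by removing the balls of radius 1 centered at [c k + 1]. *)
Lemma inf_exists (c : nn M -> fraction M) : Sup_closed M ->
  repq (fun g : model_env M [:: N] => c (hd g)) -> (forall k, 0 <= c k <= 1) ->
  exists y, Real y /\ (forall k, Le (rq y) (c k)) /\
    forall e : fraction M, 0 < e -> exists k, Ge (rq y) (c k - e).
Proof.
move=> sup rc c01.
have [ca [rca caE]] : exists ca : model_env M [:: N] -> nn M,
    rep ca /\ forall g, qval (ca g) = c (hd g) + 1.
  by apply: repq_code; apply: repq_add rc (repq_const _ _).
have [c1 c1E] := qval_surj 1.
pose a : dom M ty1 := lam (fun k => ca (tt, k)).
pose r : dom M ty1 := lam (fun _ : nn M => c1).
have aE k : rq a k = c k + 1.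
  rewrite /rq /a beta; first exact: caE (tt, k).
  by apply: rep_ext rca => -[[] k'].
have rE k : rq r k = 1 by rewrite /r rq_const.
have lower x : Mem_closed a r x -> forall k, Le (rq x) (c k).
  move=> [[hx [_ x1]] out] k m; have /andP [k0 k1] := c01 k.
  have {}x1 := iffLR (Leq_Le _ (Real_Reg hx)) x1.
  apply: (@ip_le_all _ _ _ 2) => [|i]; first by lra.
  have hn := out k (i + 1 + 1 + 1); rewrite /Abs /Sub aE rE in hn.
  have h1 := x1 (i + 1 + 1 + 1 + 1); have h2 := Real_Reg hx m (i + 1 + 1 + 1 + 1).
  have := ip_gt0 i; have := ip_le1 i; move: hn h1 h2; rewrite !ip_S.
  move: (rq x (i + 1 + 1 + 1 + 1)) (rq x m) (ip i) (ip m) (c k) k0 k1.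
  move=> u w p q b b0 b1 hn h1; rewrite ler_norml => /andP [h2 h3] h4 h5.
  case: (leP 0 (u - (b + 1))) => h6; last by rewrite ltr0_norm // in hn; lra.
  by rewrite ger0_norm // in hn; lra.
have inC q : 0 <= qval q -> (forall k, qval q <= c k) -> Mem_closed a r (lam (fun _ : nn M => q)).
  move=> q0 qc; split.
    by apply: In_unit_const => //; have := qc 0; have /andP [_] := c01 0; lra.
  move=> k n; rewrite /Abs /Sub rq_const aE rE ler0_norm; last first.
    by have := qc k; lra.
  by have := qc k; have := ip_gt0 n; lra.
have [c0 c0E] := qval_surj 0.
have c0C : Mem_closed a r (lam (fun _ : nn M => c0)).
  by apply: inC; rewrite c0E // => k; have /andP [] := c01 k.
pose F : dom M (Arr ty1 ty1) := lam (fun x : dom M ty1 => x).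
have FE x : sap F x = x by rewrite /F beta //; rep_tac.
have [y [hy [ub lb]]] := sup a r F (ex_intro _ _ c0C) Fun_unit_id.
have regy := Real_Reg hy.
exists y; split; [exact: hy|split].
- move=> k m; rewrite lerBlDr; apply: ip_le_all1 => i.
  have [x [xC]] := lb i; rewrite FE => hx.
  have rx : Reg (rq x) by apply: Real_Reg; have [[]] := xC.
  have [q [s [qs hq hs]]] := not_Leq rx (Reg_Sub regy (Reg_const _)) hx.
  have h1 := Le_Ge_le hs (lower x xC k).
  have h2 := Le_Sub_ip regy hq m.
  by lra.
- move=> e e0; apply: contrapT => nk.
  have hk k : Le (rq y) (c k - e).
    have [//|h] := @Le_or_Ge M (rq y) (c k - e) regy.
    by case: nk; exists k.
  have [m hm] : exists m, ip m < e / 2 by apply: ip_small; apply: divr_gt0; lra.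
  (* If y stayed below every [c k] by e, this number would be a lower bound in [0, 1] too, but it
     exceeds y because 2 * 2 ^ (- m) < e. *)
  have [q qE] := qval_surj (rq y m - ip m + e).
  have ge0 : Ge (rq y) 0.
    apply: (iffLR (Leq_Ge _ regy)).
    by have := ub _ c0C; rewrite FE rq_const c0E.
  have qC : Mem_closed a r (lam (fun _ : nn M => q)).
    apply: inC => [|k]; rewrite qE; first by have := ge0 m; lra.
    by have := hk k m; lra.
  have hq : Ge (rq y) (qval q).
    by apply: (iffLR (Leq_Ge _ regy)); have := ub _ qC; rewrite FE rq_const.
  by have := hq m; rewrite qE; lra.
Qed.

Section Stages.

Variable G : nn M -> nn M -> nn M.
Hypothesis rG : repN2 G.

(** The [k]-th approximation, from above, to the complement of the set. *)
Definition approximant k j : nn M := cond (exists m, (m <^ k) /\ G j m = 0) 0 1.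

Lemma rep_approximant : repN2 approximant.
Proof.
apply: rep_cond; [|by rep_tac|by rep_tac].
by apply: dec_bex; [apply: dec_eq; [apply: (rep_comp2 rG)|]|]; rep_tac.
Qed.

Lemma rep_approximant1 k : repN1 (approximant k).
Proof. by apply: (rep_comp2 rep_approximant); rep_tac. Qed.

Lemma approximant_eq0 k j : approximant k j = 0 <-> exists m, (m <^ k) /\ G j m = 0.
Proof.
rewrite /approximant; case: (pselect (exists m, (m <^ k) /\ G j m = 0)) => h.
  by rewrite condT.
by rewrite condF //; split=> // /eqP; rewrite oner_eq0.
Qed.

Lemma approximant_binary k : binary (approximant k).
Proof.
move=> j; rewrite /approximant; case: (pselect (exists m, (m <^ k) /\ G j m = 0)) => h.
  by left; rewrite condT.
by right; rewrite condF.
Qed.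

Lemma approximant_decr k i j : fnat (approximant (k + i) j) <= fnat (approximant k j).
Proof.
have /andP [h0 h1] := binary_fnat j (approximant_binary (k + i)).
case: (approximant_binary k j) => e; last by rewrite e fnat1.
suff -> : approximant (k + i) j = 0 by rewrite e.
have [m [mk hm]] := iffLR (approximant_eq0 k j) e.
by apply/approximant_eq0; exists m; split=> //; apply: lt_le_trans mk (nn_leDr _ _).
Qed.

(** The added 4 ^ (- k) makes up for all the digits from k on, so the sequence decreases although
    more and more digits are counted. *)
Definition approximant_bound k : fraction M := hval (approximant k) k + ip (k + k).

Lemma approximant_bound_decr k i : approximant_bound (k + i) <= approximant_bound k.
Proof.
have h1 := hval_cmp (n := k + i) (rep_approximant1 (k + i)) (rep_approximant1 k) (fun j _ => approximant_decr k i j).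
have [_ h2] := hval_tail k i (rep_approximant1 k) (approximant_binary k).
have h3 : ip (k + i + (k + i)) <= ip (k + k).
  by apply: ip_le; rewrite [X in _ <=^ X](_ : _ = k + k + (i + i)) ?nn_leDr //; ring.
by rewrite /approximant_bound; lra.
Qed.

(** Each digit of the approximants changes at most once, but at an unknown stage. Once the bounds
    are within u of their infimum y, the digits up to n agree with those of y, which gives all
    eventual values at once. *)
Lemma Sup_closed_approximant : Sup_closed M ->
  exists y, forall n, exists k, forall i, real_digit y n = approximant (k + i) n.
Proof.
move=> sup; have [||y [hy [ub lb]]] := @inf_exists approximant_bound sup.
- apply: repq_add; last by rep_tac.
  by apply: repq_hval; [apply: (rep_comp2 rep_approximant)|]; rep_tac.
- move=> k; have h1 := hval_ge0 (approximant k) k; have := ip_gt0 (k + k).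
  have [_] := hval_tail 0 k (rep_approximant1 k) (approximant_binary k).
  rewrite hval0 !add0r ip_0 => h2 h3; have h4 := ip_le1 (k + k).
  by rewrite /approximant_bound; apply/andP; split; lra.
exists y => n; set u := ip (n + 1 + (n + 1)) / 16.
have u0 : 0 < u by rewrite /u; have := ip_gt0 (n + 1 + (n + 1)); lra.
(* The tolerance u is 4 ^ (- n - 3), so n + 3 stages suffice to bring the added 4 ^ (- k) below
   it. *)
have [k0 hk0] := lb u u0; exists (n + 1 + (1 + 1) + k0) => i.
set k := n + 1 + (1 + 1) + k0 + i.
have e0 : approximant_bound k <= approximant_bound k0.
  by rewrite [k](_ : _ = k0 + (n + 1 + (1 + 1) + i)) /k ?approximant_bound_decr //; ring.
have [k' e] : exists k', k = n + 1 + k' by exists (1 + 1 + k0 + i); rewrite /k; ring.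
have hu : ip (k + k) <= u.
  have -> : u = ip (n + 1 + (1 + 1) + (n + 1 + (1 + 1))).
    have -> : n + 1 + (1 + 1) + (n + 1 + (1 + 1)) = n + 1 + (n + 1) + 1 + 1 + 1 + 1 by ring.
    by rewrite /u !ip_S; field.
  apply: ip_le.
  by rewrite [X in _ <=^ X](_ : _ = n + 1 + (1 + 1) + (n + 1 + (1 + 1)) + (k0 + i + (k0 + i)))
    /k ?nn_leDr //; ring.
have [h1 h2] := hval_tail (n + 1) k' (rep_approximant1 k) (approximant_binary k).
rewrite -e in h1 h2; have k0' := ip_gt0 (k + k).
apply: (@real_digit_correct M y (approximant k) n (rep_approximant1 k) (@approximant_binary k) _ _ n (lexx n)).
- by apply: Ge_trans hk0; rewrite /approximant_bound in e0 *; rewrite -/u; lra.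
- by apply: Le_trans (ub k); rewrite /approximant_bound -/u; lra.
Qed.

End Stages.

Lemma Sup_closed_Sigma1 : Sup_closed M -> Sigma1_comprehension.
Proof.
move=> sup G rG; have [y hy] := Sup_closed_approximant rG sup.
exists (fun n => cond (real_digit y n = 0) 1 0); split=> [|n|n].
- apply: rep_cond; [|by rep_tac|by rep_tac].
  by apply: dec_eq; [apply: (rep_comp (rep_real_digit y))|]; rep_tac.
- exact: cond_binary.
have [k hk] := hy n; rewrite cond_eq1; split=> [|[m hm]].
  by rewrite (hk 0) => /approximant_eq0 [m [_ hm]]; exists m.
rewrite (hk (m + 1)); apply/approximant_eq0; exists m; split=> //.
by rewrite -nn_leS [k + _]addrC nn_leDr.
Qed.

End Sigma1.

(** * Grilliot's trick *)

Section Grilliot.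

Variable M : model.
Implicit Types (n m k i j b c z : nn M) (f g x y : dom M ty1).

Definition Exists2 : Prop :=
  exists E : dom M ty2, forall g, sap E g = 0 <-> exists n, sap g n = 0.

Definition truncate k f : dom M ty1 := lam (fun i => cond (i <^ k) (sap f i) 0).

Lemma truncateE k f i : sap (truncate k f) i = cond (i <^ k) (sap f i) 0.
Proof. by rewrite /truncate beta //; rep_tac. Qed.

(** Otherwise [Y] would be discontinuous at [f] along the truncations of [f], and
    a zero of [g] could be detected by truncating [f] at the first one. *)
Lemma zero_truncate (Y : dom M (Arr ty1 (Arr N N))) f n : ~ Exists2 ->
  sap (sap Y f) n = 0 -> exists k, sap (sap Y (truncate k f)) n = 0.
Proof.
move=> nE Yf; apply: contrapT => h; apply: nE.
pose J g : dom M ty1 := lam (fun i => cond (exists j, (j <^ i + 1) /\ sap g j = 0) 0 (sap f i)).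
have JE g i : sap (J g) i = cond (exists j, (j <^ i + 1) /\ sap g j = 0) 0 (sap f i).
  by rewrite /J beta //; rep_tac.
have rJ : rep (fun e : model_env M [:: ty1] => J (hd e)) by rewrite /J; rep_tac.
exists (lam (fun g => cond (sap (sap Y (J g)) n = 0) 1 0)) => g.
rewrite beta; last first.
  apply: rep_cond; [apply: dec_eq|by rep_tac|by rep_tac]; last by rep_tac.
  by apply: rep_app; [apply: rep_app; [rep_tac|exact: rJ]|rep_tac].
case: (pselect (exists j, sap g j = 0)) => [[j0 hj0]|hg].
  have [|j [gj least]] := @nn_least M (fun j => sap g j = 0) _ j0 hj0; first by rep_tac.
  suff -> : J g = truncate j f.
    rewrite condF; first by split=> // _; exists j.
    by move=> e; apply: h; exists j.
  apply: m_ext => i; rewrite JE truncateE; case: (ltP i j) => ij.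
    rewrite condF ?condT // => -[j' [h1 h2]]; apply: (least j') h2.
    by rewrite nn_ltS in h1; apply: le_lt_trans h1 ij.
  by rewrite condT; [rewrite condF|exists j; rewrite nn_ltS].
have -> : J g = f by apply: m_ext => i; rewrite JE condF // => -[j [_ e]]; apply: hg; exists j.
by rewrite condT //; split=> [/eqP|[j e]]; [rewrite oner_eq0|case: hg; exists j].
Qed.

(** Finite sequences are coded by pairing on the left, the last entry outermost; entry i of a
    sequence of length k is reached by removing k - (i + 1) pairs. *)
Definition unwind b j : nn M := natrec b (fun _ r => nfst r) j.
Definition prefix f k : nn M := natrec 0 (fun i b => npair b (sap f i)) k.
Definition finseq c : dom M ty1 := lam (fun i =>
  cond (i <^ nfst c) (nsnd (unwind (nsnd c) (nn_sub (nfst c) (i + 1)))) 0).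

Lemma rep_finseq0 : rep (fun g : model_env M [:: N] => finseq (hd g)).
Proof. by rewrite /finseq /unwind; rep_tac. Qed.

Lemma prefixS f k : prefix f (k + 1) = npair (prefix f k) (sap f k).
Proof. by rewrite /prefix natrecS //; rep_tac. Qed.

Lemma unwind_prefix f k j : j <=^ k -> unwind (prefix f k) j = prefix f (nn_sub k j).
Proof.
move: j; apply: nn_ind => [||j IH jk].
- by rewrite /unwind /prefix; rep_tac.
- by rewrite /unwind natrec0 nn_sub0.
rewrite /unwind natrecS; last by rep_tac.
rewrite -/(unwind (prefix f k) j) IH; last exact: le_trans (nn_leDr _ _) jk.
rewrite nn_subS; case: (nn_case (nn_sub k j)) => [/nn_subE h|->]; last first.
  by rewrite nn_predS prefixS nfst_pair.
by rewrite nn_leS ltNge h in jk.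
Qed.

Lemma finseq_prefix f k : finseq (npair k (prefix f k)) = truncate k f.
Proof.
apply: m_ext => i; rewrite truncateE /finseq beta; last by rewrite /unwind; rep_tac.
rewrite nfst_pair nsnd_pair; case: (pselect (i <^ k)) => ik; last by rewrite !condF.
have [z e] : exists z, k = i + 1 + z by apply: nn_le_exists; rewrite nn_leS.
rewrite !condT // e [X in nn_sub X]addrC nn_addK unwind_prefix; last by rewrite addrC nn_leDr.
by rewrite nn_addK prefixS nsnd_pair.
Qed.

Lemma not_Exists2_BOOT_for (Y : dom M (Arr ty1 (Arr N N))) : Sigma1_comprehension M -> ~ Exists2 -> BOOT_for Y.
Proof.
move=> sigma1 nE; have [|X [rX bX hX]] := sigma1 (fun n c => sap (sap Y (finseq c)) n).
  apply: rep_app; last by rep_tac.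
  by apply: rep_app; [rep_tac|apply: (rep_comp rep_finseq0); rep_tac].
exists X; split=> // n; rewrite hX; split=> [[c hc]|[f hf]]; first by exists (finseq c).
have [k hk] := zero_truncate nE hf; exists (npair k (prefix f k)).
by rewrite finseq_prefix.
Qed.

Section WithExists2.

Hypothesis e2 : Exists2.

(** A set obtained from BOOT decides a quantifier for fixed function parameters, whereas E acts
    uniformly in them; hence the arbitrary context. *)
Lemma Exists2_ex (G : list ty) (P : model_env M G -> nn M -> Prop) :
  dec (fun e : model_env M (N :: G) => P (tl e) (hd e)) -> dec (fun e => exists n, P e n).
Proof.
have [E hE] := e2; case=> c [F hF] cP.
exists (fun e => sap E (sapn (G := G) (t := ty1) F e)) => [|e].
  by apply: rep_app; [apply: rep_const|exists F].
rewrite hE; have h n : sap (sapn (G := G) (t := ty1) F e) n = 0 <-> P e n.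
  by rewrite (cP (e, n)) -(hF (e, n)).
by split=> -[n /h]; exists n.
Qed.

Lemma Exists2_all (G : list ty) (P : model_env M G -> nn M -> Prop) :
  dec (fun e : model_env M (N :: G) => P (tl e) (hd e)) -> dec (fun e => forall n, P e n).
Proof.
move=> dP; apply: (@dec_equiv _ _ (fun e => ~ exists n, ~ P e n)).
  by apply: dec_not; apply: (Exists2_ex (P := fun e n => ~ P e n)); apply: dec_not.
move=> e; split=> [h n|h [n]]; last exact.
by apply: contrapT => h'; apply: h; exists n.
Qed.

Lemma dec_In_unit : dec (fun e : model_env M [:: ty1] => In_unit (hd e)).
Proof.
apply: dec_and.
  apply: (Exists2_all (P := fun e n => forall i, `|rq (hd e) n - rq (hd e) (n + i)| < ip n)).
  apply: (Exists2_all (P := fun e i =>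
    `|rq (hd (tl e)) (hd e) - rq (hd (tl e)) (hd e + i)| < ip (hd e))).
  by apply: (@dec_equiv _ _ (fun e : model_env M [:: N; N; ty1] =>
      - ip (hd (tl e)) < rq (hd (tl (tl e))) (hd (tl e)) - rq (hd (tl (tl e))) (hd (tl e) + hd e) /\
      rq (hd (tl (tl e))) (hd (tl e)) - rq (hd (tl (tl e))) (hd (tl e) + hd e) < ip (hd (tl e))));
    [rewrite /rq; rep_tac|move=> e; rewrite ltr_norml; split=> /andP].
apply: dec_and.
  apply: (Exists2_all (P := fun e n => 0 <= rq (hd e) n + 2 * ip n)).
  by rewrite /rq; rep_tac.
apply: (Exists2_all (P := fun e n => rq (hd e) n <= 1 + 2 * ip n)).
by rewrite /rq; rep_tac.
Qed.

End WithExists2.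

End Grilliot.

(** * BOOT from suprema *)

Section SupBoot.

Variable M : model.
Implicit Types (n m k i j c : nn M) (f g x y : dom M ty1).

Definition Sup_unit : Prop := forall F, Fun_unit F -> Sup_exists (@In_unit M) F.

(** The unit interval is the closed set whose removed balls all have radius 0. *)
Lemma Sup_closed_unit : Sup_closed M -> Sup_unit.
Proof.
move=> sup F hF; have [c cE] := @qval_surj M 0.
pose a : dom M ty1 := lam (fun _ : nn M => c).
have e : Mem_closed a a = @In_unit M.
  apply: funext => x; apply: propext; split=> [[]//|hx]; split=> // k n.
  rewrite /a rq_const cE /Abs; have := ip_gt0 n.
  by have := normr_ge0 (Sub (rq x) (fun=> 0) n); lra.
have := sup a a F; rewrite e; apply => //.
by exists a; apply: In_unit_const; rewrite cE // ler01.
Qed.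

Lemma Eqr_sym (X Y : nn M -> fraction M) : Eqr X Y -> Eqr Y X.
Proof. by move=> h n; rewrite distrC. Qed.

Lemma In_unit_Eqr x y : Real y -> Eqr (rq x) (rq y) -> In_unit x -> In_unit y.
Proof.
move=> hy /Eqr_Leq [xy yx] [hx [x0 x1]]; split; [exact: hy|split].
- exact: Leq_trans_Reg (Reg_const _) (Real_Reg hx) (Real_Reg hy) x0 xy.
- exact: Leq_trans_Reg (Real_Reg hy) (Real_Reg hx) (Reg_const _) yx x1.
Qed.

(** With E, being a real in [0, 1] is decidable, so the unit interval has a characteristic function;
    it respects equality of reals because membership does. *)
Lemma Sup_sets_unit : Exists2 M -> Sup_sets M -> Sup_unit.
Proof.
move=> e2 sup F hF.
have [c0 c0E] := @qval_surj M 0; have [c1 c1E] := @qval_surj M 1.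
pose K (c : nn M) : dom M ty1 := lam (fun _ : nn M => c).
pose A : dom M (Arr ty1 ty1) := lam (fun x => K (cond (In_unit x) c1 c0)).
have rd := dec_In_unit e2.
have AE x : sap A x = K (cond (In_unit x) c1 c0).
  rewrite /A beta //; apply: rep_lam; apply: rep_cond; [|by rep_tac|by rep_tac].
  by apply: (dec_comp rd); rep_tac.
have e : Mem A = @In_unit M.
  apply: funext => x; apply: propext; rewrite /Mem AE rq_const; split=> [[_]|hx].
    apply: contraPP => hx; rewrite (condF _ _ hx) c0E => h; apply: h => n.
    by have := ip_gt0 n; lra.
  split; first by have [] := hx.
  rewrite (condT _ _ hx) c1E => h.
  have [n hn] : exists n : nn M, ip n < 1 / 2 by apply: ip_small; lra.
  by have := h n; lra.
have supA := sup A F; rewrite e in supA; apply: supA; last exact: hF.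
  split; last by move=> x; rewrite e.
  split=> [x _|x y hx hy xy]; first by rewrite AE; apply: Real_const.
  rewrite !AE; have -> : In_unit x = In_unit y.
    apply: propext; split; first exact: In_unit_Eqr hy xy.
    exact: In_unit_Eqr hx (Eqr_sym xy).
  by move=> n; rewrite subrr normr0; have := ip_gt0 n; lra.
by exists (K c0); apply: In_unit_const; rewrite c0E // ler01.
Qed.

(** This is QF-AC for the formula saying that E(g) = 0 implies g(n) = 0, which is quantifier-free
    with parameter E and always has a solution n. *)
Lemma Exists2_mu : Exists2 M -> exists mu : dom M ty2, forall g n, sap g n = 0 ->
  sap g (sap mu g) = 0.
Proof.
move=> [E hE]; pose p := Imp (Eq (Defs.App (Var ty2 0) (Var ty1 0)) (Con CZero))
  (Eq (Defs.App (Var ty1 0) (Var N 0)) (Con CZero)).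
pose rho : valuation (dom M) := push E (some_valuation M).
have hq : RCA0w (qf_ac10_axiom p) by apply: ax_qf_ac10; cbv.
have total : sat rho (All ty1 (Ex N p)).
  move=> g; apply/sat_Ex; case: (pselect (exists n, sap g n = 0)) => [[n hn]|h].
    by exists n => _; apply/m_eq.
  by exists (0 : nn M) => /m_eq /hE.
have /sat_Ex [mu hmu] : sat rho (Ex ty2 (All ty1
    (inst (Defs.App (Var ty2 0) (Var ty1 0)) (fshift ty2 p)))).
  exact: (m_ax rho hq) total.
exists mu => g n gn; apply/m_eq; apply: (hmu g).
by apply/m_eq/hE; exists n.
Qed.

Lemma Real_hcode s : repN1 s -> binary s ->
  In_unit (lam (hcode s)) /\ forall n : nn M, Ge (rq (lam (hcode s))) (hval s n) /\
    Le (rq (lam (hcode s))) (hval s n + ip (n + n) / 3).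
Proof.
move=> rs bs; have E (n : nn M) : rq (lam (hcode s)) n = hval s n.
  rewrite /rq beta ?qval_hcode //; apply: (rep_hcode (s := fun _ => s)); last by rep_tac.
  by apply: (rep_comp rs); rep_tac.
have ip2 (n : nn M) : ip (n + n) <= ip n by apply: ip_le; apply: nn_leDr.
have real_s : Real (lam (hcode s)).
  move=> n i; rewrite !E ltr_norml.
  have h1 := hval_ub n (n + i) rs bs; have h2 := hval_mono rs bs (nn_leDr n i).
  by have := ip2 n; have := ip_gt0 n; move=> h3 h4; apply/andP; split; lra.
split; first by apply: In_unit_intro => // n; rewrite E hval_ge0 hval_le1.
move=> n; split=> m; rewrite E.
- by have := hval_ub m n rs bs; have := ip2 m; have := ip_gt0 m; lra.
- by have := hval_ub n m rs bs; have := ip_gt0 m; lra.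
Qed.

(** * Sequences of functions read from reals by means of E *)

Section Canonical.

Hypothesis e2 : Exists2 M.

(** Unlike [real_bit], this does not depend on the representation of [x]. *)
Definition canonical_bit x m j : nn M := cond (~ Le (rq x) (threshold m j)) 1 0.

Definition canonical_digit x n : nn M := digit (canonical_bit x) n.

#[local] Transparent threshold digits.

Lemma rep_canonical_bit G (x : model_env M G -> dom M ty1) (m j : model_env M G -> nn M) :
  rep x -> rep m -> rep j -> rep (fun e => canonical_bit (x e) (m e) (j e)).
Proof.
move=> rx rm rj; apply: rep_cond; [apply: dec_not|by rep_tac|by rep_tac].
apply: (Exists2_all e2 (P := fun e n => rq (x e) n - ip n <= threshold (m e) (j e))).
have {}rx := rep_weak N rx; have {}rm := rep_weak N rm; have {}rj := rep_weak N rj.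
by rewrite /threshold /rq; rep_tac.
Qed.

Lemma rep_canonical_digit G (x : model_env M G -> dom M ty1) (n : model_env M G -> nn M) :
  rep x -> rep n -> rep (fun e => canonical_digit (x e) (n e)).
Proof.
move=> rx rn; apply: rep_canonical_bit => //; apply: rep_natrec; [by rep_tac|by []|].
apply: rep_add; first by rep_tac.
by apply: rep_canonical_bit; [apply: rep_weak (rep_weak _ rx)| |]; rep_tac.
Qed.

#[local] Opaque threshold digits.

Lemma canonical_digit_Eqr x y : Real x -> Real y -> Eqr (rq x) (rq y) ->
  canonical_digit x = canonical_digit y.
Proof.
move=> hx hy /Eqr_Leq [xy yx]; suff e : canonical_bit x = canonical_bit y.
  by rewrite /canonical_digit e.
apply: funext => m; apply: funext => j; rewrite /canonical_bit.
suff -> : Le (rq x) (threshold m j) = Le (rq y) (threshold m j) by [].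
have rx := Real_Reg hx; have ry := Real_Reg hy.
apply: propext; rewrite -(Leq_Le _ rx) -(Leq_Le _ ry); split=> h.
- exact: Leq_trans_Reg ry rx (Reg_const _) yx h.
- exact: Leq_trans_Reg rx ry (Reg_const _) xy h.
Qed.

Lemma canonical_digit_hcode s : repN1 s -> binary s ->
  forall n : nn M, canonical_digit (lam (hcode s)) n = s n.
Proof.
move=> rs bs n; have [_ h] := Real_hcode rs bs; set x := lam (hcode s) in h *.
apply: (@digit_correct M (canonical_bit x) s n _ rs _ n (lexx n)).
  by apply: rep_canonical_bit; rep_tac.
move=> j _; have [hge hle] := h (j + 1).
have := @digit_bounds M s j j (hval s (j + 1) + ip (j + 1 + (j + 1)) / 3) (hval s (j + 1)) rs bs (lexx j).
have := ip_gt0 (j + 1 + (j + 1)); have := ip_gt0 (j + j); move=> h1 h2 [||b1 b0].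
- by lra.
- by lra.
rewrite /canonical_bit; case: (bs j) => e; rewrite e.
- by rewrite condF //; apply; apply: Le_trans hle; have := b0 e; lra.
- by rewrite condT // => h3; have := Le_Ge_le hge h3; have := b1 e; lra.
Qed.

Variables (mu : dom M ty2) (Y : dom M (Arr ty1 (Arr N N))).
Hypothesis mu_min : forall g (n : nn M), sap g n = 0 -> sap g (sap mu g) = 0.

(** The digits of [x] at the positions [((n, i), m)] are read as the graphs of
    functions. *)
Definition read x n : dom M ty1 := lam (fun i => sap mu (lam (fun m =>
  cond (canonical_digit x (npair (npair n i) m) = 1) 0 1))).

Lemma rep_read G (x : model_env M G -> dom M ty1) (n : model_env M G -> nn M) :
  rep x -> rep n -> rep (fun e => read (x e) (n e)).
Proof.
move=> rx rn; apply: rep_lam; apply: rep_app; first by rep_tac.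
have {}rx := rep_weak N (rep_weak N rx); have {}rn := rep_weak N (rep_weak N rn).
apply: rep_lam; apply: rep_cond; [|by rep_tac|by rep_tac].
by apply: dec_eq; [apply: rep_canonical_digit|]; rep_tac.
Qed.

(** The digit at ((n, i), m) is set to 1 exactly when h n i = m; since m is unique, any zero found
    by [mu] is the right one. *)
Lemma read_onto (h : nn M -> nn M -> nn M) : repN2 h ->
  exists x, In_unit x /\ forall n, read x n = lam (h n).
Proof.
move=> rh; pose s c : nn M := cond (h (nfst (nfst c)) (nsnd (nfst c)) = nsnd c) 1 0.
have rs : repN1 s.
  apply: rep_cond; [|by rep_tac|by rep_tac].
  by apply: dec_eq; [apply: (rep_comp2 rh)|]; rep_tac.
have bs : binary s by move=> c; apply: cond_binary.
exists (lam (hcode s)); split=> [|n]; first by have [] := Real_hcode rs bs.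
apply: m_ext => i; set x := lam (hcode s).
have xE := canonical_digit_hcode rs bs; rewrite -/x in xE.
rewrite /read beta; last first.
  apply: rep_app; first by rep_tac.
  apply: rep_lam; apply: rep_cond; [|by rep_tac|by rep_tac].
  by apply: dec_eq; [apply: rep_canonical_digit|]; rep_tac.
rewrite beta; last by apply: (rep_comp2 rh); rep_tac.
set g := lam _; have gE m : sap g m = cond (h n i = m) 0 1.
  rewrite /g beta; last first.
    apply: rep_cond; [|by rep_tac|by rep_tac].
    by apply: dec_eq; [apply: rep_canonical_digit|]; rep_tac.
  by rewrite xE /s !nfst_pair !nsnd_pair; congr (cond _ _ _); apply: propext; apply: cond_eq1.
have : sap g (sap mu g) = 0 by apply: (mu_min (n := h n i)); rewrite gE condT.
rewrite gE; case: (pselect (h n i = sap mu g)) => [<- //|ne].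
by rewrite condF // => /eqP; rewrite oner_eq0.
Qed.

Definition read_bit x n : nn M := cond (sap (sap Y (read x n)) n = 0) 1 0.

Lemma rep_read_bit : rep (fun e : model_env M [:: N; ty1] => read_bit (hd (tl e)) (hd e)).
Proof.
apply: rep_cond; [apply: dec_eq|by rep_tac|by rep_tac]; last by rep_tac.
by apply: rep_app; [apply: rep_app; [|apply: rep_read]|]; rep_tac.
Qed.

(** Let x nearly attain the supremum y. Every real whose first n + 1 bits have at least the value of
    those of x shares digit n with y, in particular x with a witness f of n put in place of its n-th
    function. *)
Lemma Sup_unit_BOOT_for : Sup_unit -> BOOT_for Y.
Proof.
move=> sup; have rb x : repN1 (read_bit x) by apply: (rep_comp2 rep_read_bit); rep_tac.
have bb x : binary (read_bit x) by move=> n; apply: cond_binary.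
pose F : dom M (Arr ty1 ty1) := lam (fun x => lam (hcode (read_bit x))).
have FE x : sap F x = lam (hcode (read_bit x)).
  rewrite /F beta //; apply: rep_lam.
  apply: (rep_hcode (s := fun e : model_env M [:: N; ty1] => read_bit (hd (tl e)))).
    by apply: (rep_comp2 rep_read_bit); rep_tac.
  by rep_tac.
have Fx x := Real_hcode (rb x) (bb x).
have regF x : Reg (rq (sap F x)).
  by rewrite FE; apply: Real_Reg; have [[]] := Fx x.
have [|y [hy [ub lb]]] := sup F.
  split=> [x _|x x' [hx _] [hx' _] xx']; first by rewrite FE; have [] := Fx x.
  rewrite !FE /read_bit /read (canonical_digit_Eqr hx hx' xx') => n.
  by rewrite subrr normr0; have := ip_gt0 n; lra.
have regy := Real_Reg hy.
exists (real_digit y); split; [exact: rep_real_digit|exact: real_digit_binary|move=> n].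
(* The bound is the tolerance of [real_digit_correct] at position n. *)
have [k hk] : exists k : nn M, ip k < ip (n + 1 + (n + 1)) / 16.
  by apply: ip_small; have := ip_gt0 (n + 1 + (n + 1)); lra.
have [x [xu]] := lb k.
move=> /(not_Leq (regF x) (Reg_Sub regy (Reg_const _))) [q [r [qr hq hr]]].
have bound (a b c d e q' r' : fraction M) :
    a <= b -> r' <= a + c -> q' < r' -> d < e -> q' + d <= b + c + e by lra.
have good x' : In_unit x' -> hval (read_bit x) (n + 1) <= hval (read_bit x') (n + 1) ->
    real_digit y n = read_bit x' n.
  move=> x'u xx'; apply: (@real_digit_correct M y (read_bit x') n (rb x') (bb x') _ _ n (lexx n)).
    have := iffLR (Leq_by_Ge (regF x') regy) (ub x' x'u) (hval (read_bit x') (n + 1)).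
    rewrite FE => h; apply: Ge_trans (h (proj1 (proj2 (Fx x') (n + 1)))).
    by rewrite gerBl; apply: divr_ge0; [apply: ltW; apply: ip_gt0|].
  apply: Le_trans (Le_Sub_ip regy hq); rewrite FE in hr.
  have rx := Le_Ge_le hr (proj2 (proj2 (Fx x) (n + 1))).
  exact: bound xx' rx qr hk.
rewrite (good x xu (lexx _)); split=> [/cond_eq1|[f hf]]; first by exists (read x n).
pose h j i : nn M := cond (j = n) (sap f i) (sap (read x j) i).
have rh : repN2 h.
  apply: rep_cond; [by rep_tac|by rep_tac|].
  by apply: rep_app; [apply: rep_read|]; rep_tac.
have [x' [x'u x'E]] := read_onto rh.
have hn : read x' n = f.
  by rewrite x'E -[RHS]sap_lam_eta; congr lam; apply: funext => i; rewrite /h condT.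
have hj j : j <> n -> read x' j = read x j.
  move=> jn; rewrite x'E -[RHS]sap_lam_eta; congr lam; apply: funext => i.
  by rewrite /h condF.
have bn : read_bit x' n = 1 by apply/cond_eq1; rewrite hn.
suff le : hval (read_bit x) (n + 1) <= hval (read_bit x') (n + 1).
  by rewrite -(good x xu (lexx _)) (good x' x'u le) bn.
apply: hval_cmp (rb x) (rb x') _ => j _.
case: (pselect (j = n)) => [->|/hj e]; last by rewrite /read_bit e lexx.
by rewrite bn fnat1; have /andP [] := binary_fnat n (bb x).
Qed.

End Canonical.

Theorem Sup_unit_Boot : Sigma1_comprehension M -> (Exists2 M -> Sup_unit) -> Boot M.
Proof.
move=> sigma1 sup; apply/Boot_iff => Y.
case: (pselect (Exists2 M)) => [e2|]; last exact: not_Exists2_BOOT_for.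
have [mu hmu] := Exists2_mu e2; exact: Sup_unit_BOOT_for e2 mu Y hmu (sup e2).
Qed.

Theorem Sup_closed_Boot : Sup_closed M -> Boot M.
Proof.
move=> sup; apply: Sup_unit_Boot; first exact: Sup_closed_Sigma1.
by move=> _; apply: Sup_closed_unit.
Qed.

Theorem Sup_sets_Boot : (forall q rho, ACA0 q -> @sat M rho q) -> Sup_sets M -> Boot M.
Proof.
move=> aca sup; apply: Sup_unit_Boot; first exact: ACA0_Sigma1.
by move=> e2; apply: Sup_sets_unit.
Qed.

End SupBoot.

Theorem theorem3p19 :
  proves_equiv RCA0w ACA0_SUP_sets (sentence MCT_net) /\
  proves RCA0w (Iff (sentence MCT_net) (sentence BOOT)) /\
  proves RCA0w (Iff (sentence BOOT) (sentence SUP_closed)).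
Proof.
split; first split.
- apply: model_completeness => [q|M hM rho]; first by left.
  apply/sat_MCT_net; apply: Boot_Mct; apply: Sup_sets_Boot => [q rho' hq|].
    by apply: hM; right; left.
  by apply/(sat_SUP_sets rho)/hM; right; right.
- move=> q hq; apply: model_completeness => // M _ rho /sat_MCT_net /Mct_Boot boot.
  case: hq => [hq|->]; first exact: boot_ACA0.
  by apply/sat_SUP_sets; apply: Boot_Sup_sets.
split; apply: model_completeness => // M _ rho; apply/sat_Iff.
- rewrite sat_MCT_net sat_BOOT; split; [exact: Mct_Boot|exact: Boot_Mct].
- rewrite sat_BOOT sat_SUP_closed; split; [exact: Boot_Sup_closed|exact: Sup_closed_Boot].
Qed.
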